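(* Let $\xi>0$, let the cost function be $\mathcal{C}\equiv 1$, let $\mathbf{p}_0=((0,0),(1,0))\in\mathbb{R}^2\times S^1$, and let $d_{\mathrm{c}}$, $d_{\mathrm{proj}}$ and $\tilde{\mathcal{Q}}_\xi\subset\mathbb{R}^2\times P^1$ be as defined in the context. Let $[\mathbf{p}_1]\in\mathbb{R}^2\times P^1$. (1) If $[\mathbf{p}_1]\in\tilde{\mathcal{Q}}_\xi$, then $[\mathbf{p}_1]$ can be connected to $[\mathbf{p}_0]$ by a minimizing geodesic (of $d_{\mathrm{proj}}$) departing from $[\mathbf{p}_0]$ whose spatial projection is cusp-free, $$d_{\mathrm{c}}([\mathbf{p}_0],[\mathbf{p}_1])=d_{\mathrm{proj}}([\mathbf{p}_0],[\mathbf{p}_1]),$$ and the triangle inequality $$d_{\mathrm{c}}([\mathbf{p}_0],[\mathbf{p}_1])\le d_{\mathrm{c}}([\mathbf{p}_0],[\mathbf{p}_2])+d_{\mathrm{c}}([\mathbf{p}_2],[\mathbf{p}_1])$$ holds for all $[\mathbf{p}_2]\in\mathbb{R}^2\times P^1$. (2) If $[\mathbf{p}_1]\notin\tilde{\mathcal{Q}}_\xi$, then $$d_{\mathrm{c}}([\mathbf{p}_0],[\mathbf{p}_1])>d_{\mathrm{proj}}([\mathbf{p}_0],[\mathbf{p}_1]),$$ and the triangle inequality is violated in the following sense: either there exists $[\mathbf{r}_1]\in\mathbb{R}^2\times P^1$ such that $$d_{\mathrm{c}}([\mathbf{p}_0],[\mathbf{r}_1])+d_{\mathrm{c}}([\mathbf{r}_1],[\mathbf{p}_1])<d_{\mathrm{c}}([\mathbf{p}_0],[\mathbf{p}_1]),$$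 or there exist $[\mathbf{r}_1],[\mathbf{r}_2]\in\mathbb{R}^2\times P^1$ such that $$d_{\mathrm{c}}([\mathbf{p}_0],[\mathbf{r}_1])+d_{\mathrm{c}}([\mathbf{r}_1],[\mathbf{r}_2])+d_{\mathrm{c}}([\mathbf{r}_2],[\mathbf{p}_1])<d_{\mathrm{c}}([\mathbf{p}_0],[\mathbf{p}_1]).$$
   Context: Projective line bundle. $P^1=S^1/\sim$ with $\mathbf{n}_1\sim\mathbf{n}_2\iff\mathbf{n}_1=\pm\mathbf{n}_2$. For $\mathbf{p}=(\mathbf{x},\mathbf{n})\in\mathbb{R}^2\times S^1$ put $\overline{\mathbf{p}}=(\mathbf{x},-\mathbf{n})$; the corresponding point of $\mathbb{R}^2\times P^1$ is the class $[\mathbf{p}]=\{\mathbf{p},\overline{\mathbf{p}}\}$. Curves and controls. For $\mathbf{q}_0,\mathbf{q}_1\in\mathbb{R}^2\times S^1$, $\Gamma_0(\mathbf{q}_0,\mathbf{q}_1)$ is the set of piecewise $C^1$ curves $\gamma=(\mathbf{x},\mathbf{n}):[0,1]\to\mathbb{R}^2\times S^1$ with $\gamma(0)=\mathbf{q}_0$, $\gamma(1)=\mathbf{q}_1$ and $\dot{\mathbf{x}}\in\mathrm{span}\{\mathbf{n}\}$ a.e. (horizontal curves). $\Gamma_0^+(\mathbf{q}_0,\mathbf{q}_1)$ is the subset of those with $\dot{\mathbf{x}}\cdot\mathbf{n}\ge 0$ a.e. Writing $\mathbf{n}(t)=(\cos\theta(t),\sin\theta(t))$, the spatial and angular controls of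 a horizontal curve are $u^1=\dot{\mathbf{x}}\cdot\mathbf{n}$ and $u^3=\dot\theta$, so that $\dot{\mathbf{x}}=u^1\mathbf{n}$ and $\dot{\mathbf{n}}=u^3(-\sin\theta,\cos\theta)$. Length and distances (with $\mathcal{C}\equiv1$). $L(\gamma)=\int_0^1\sqrt{\xi^2|u^1(t)|^2+|u^3(t)|^2}\,dt$, $d_{\mathcal{F}_0}(\mathbf{q}_0,\mathbf{q}_1)=\inf_{\gamma\in\Gamma_0(\mathbf{q}_0,\mathbf{q}_1)}L(\gamma)$ and $d_{\mathcal{F}_0^+}(\mathbf{q}_0,\mathbf{q}_1)=\inf_{\gamma\in\Gamma_0^+(\mathbf{q}_0,\mathbf{q}_1)}L(\gamma)$. On $\mathbb{R}^2\times P^1$ define $$d_{\mathrm{c}}([\mathbf{p}],[\mathbf{q}])=\min_{\mathbf{q}_0\in[\mathbf{p}],\,\mathbf{q}_1\in[\mathbf{q}]}d_{\mathcal{F}_0^+}(\mathbf{q}_0,\mathbf{q}_1),\qquad d_{\mathrm{proj}}([\mathbf{p}],[\mathbf{q}])=\min_{\mathbf{q}_0\in[\mathbf{p}],\,\mathbf{q}_1\in[\mathbf{q}]}d_{\mathcal{F}_0}(\mathbf{q}_0,\mathbf{q}_1).$$ Minimizing geodesics and cusps. A minimizing geodesic of $d_{\mathrm{proj}}$ connecting $[\mathbf{p}_0]$ and $[\mathbf{p}_1]$ is a curve $\gamma\in\Gamma_0(\mathbf{q}_0,\mathbf{q}_1)$ with $\mathbf{q}_0\in[\mathbf{p}_0]$,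 $\mathbf{q}_1\in[\mathbf{p}_1]$ and $L(\gamma)=d_{\mathrm{proj}}([\mathbf{p}_0],[\mathbf{p}_1])$, parametrized with constant speed (i.e. $\xi^2|u^1|^2+|u^3|^2$ constant). A cusp of a horizontal curve (in its spatial projection) is a zero-crossing of $u^1$ at some time $t_0\in(0,1)$: $u^1(t_0)=0$ and $\dot u^1(t_0)\ne0$. A curve is cusp-free if it has no cusp. The set $\tilde{\mathcal{Q}}_\xi$ is the set of all $[\mathbf{p}_1]\in\mathbb{R}^2\times P^1$ for which there exists a cusp-free minimizing geodesic of $d_{\mathrm{proj}}$ connecting an element of $[\mathbf{p}_0]$ to an element of $[\mathbf{p}_1]$. *)

(* Defs.v *)
From HB Require Import structures.
From mathcomp Require Import all_boot all_order all_algebra.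
From mathcomp Require Import all_classical all_reals all_analysis.
Import Order.TTheory GRing.Theory Num.Theory.
Import numFieldNormedType.Exports.

Set Implicit Arguments.
Unset Strict Implicit.
Unset Printing Implicit Defensive.

Local Open Scope quotient_scope.
Local Open Scope ring_scope.
Local Open Scope classical_set_scope.

Section PositionsOrientations.
Variable R : realType.

Definition dotv (u v : 'rV[R]_2) : R := (u *m v^T) 0 0.

(* [perp (cos a, sin a) = (- sin a, cos a)] *)
Definition perp (u : 'rV[R]_2) : 'rV[R]_2 :=
  \row_j (if j == 0 then - u 0 1 else u 0 0).

Record circle := Circle {
  circle_val : 'rV[R]_2; _ : dotv circle_val circle_val == 1 }.
HB.instance Definition _ := [isSub for circle_val].
HB.instance Definition _ := [Choice of circle by <:].

Lemma dotvNN (n : 'rV[R]_2) : dotv (- n) (- n) = dotv n n.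
Proof. by rewrite /dotv linearN/= mulNmx mulmxN opprK. Qed.

Fact antipode_subproof (n : circle) : dotv (- val n) (- val n) == 1.
Proof. by rewrite dotvNN (valP n). Qed.

Definition antipode (n : circle) : circle := Circle (antipode_subproof n).

Lemma antipodeK : involutive antipode.
Proof. by move=> n; apply: val_inj; rewrite /= opprK. Qed.

Definition antipodal : rel circle :=
  [rel n1 n2 | (n1 == n2) || (n1 == antipode n2)].

Fact antipodal_refl : reflexive antipodal.
Proof. by move=> n; rewrite /antipodal/= eqxx. Qed.

Fact antipodal_sym : symmetric antipodal.
Proof.
move=> n m; rewrite /antipodal/= [m == n]eq_sym [m == antipode n]eq_sym.
by rewrite (can2_eq antipodeK antipodeK).
Qed.

Fact antipodal_trans : transitive antipodal.
Proof.
move=> m n p /orP[/eqP->//|/eqP->] /orP[/eqP->|/eqP->];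
  by rewrite /antipodal/= ?antipodeK eqxx ?orbT.
Qed.

Canonical antipodal_equiv :=
  EquivRel antipodal antipodal_refl antipodal_sym antipodal_trans.

Definition projective_line := {eq_quot antipodal_equiv}.

Definition R2S1 := ('rV[R]_2 * circle)%type.
Definition R2P1 := ('rV[R]_2 * projective_line)%type.

Definition class_of (p : R2S1) : R2P1 := (p.1, \pi_projective_line p.2).

Definition bar (p : R2S1) : R2S1 := (p.1, antipode p.2).

Definition lifts (P : R2P1) : set R2S1 := [set p | class_of p = P].

Lemma lifts_class_of (p : R2S1) : lifts (class_of p) = [set p; bar p].
Proof.
case: p => x n; apply/seteqP; split => -[y m]; rewrite /lifts /class_of /bar/=.
  by move=> [-> /eqmodP/orP[/eqP->|/eqP->]]; [left|right].
by move=> [[-> ->]//|[-> ->]]; congr pair; apply/eqmodP; rewrite /=/antipodal/= eqxx orbT.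
Qed.

Fact east_subproof : dotv (delta_mx 0 0) (delta_mx 0 0) == 1.
Proof. by rewrite /dotv trmx_delta mul_delta_mx mxE !eqxx. Qed.

(* [((0, 0), (1, 0))] *)
Definition p_origin : R2S1 := (0, Circle east_subproof).

(* C^1 on the closed interval [a, b], one-sided at the end points: restriction
   of a C^1 function on the real line. *)
Definition C1_on (a b : R) (f : R -> 'rV[R]_2) : Prop :=
  exists F : R -> 'rV[R]_2,
    [/\ forall t, derivable F t 1, continuous (derive1 F) &
        forall t, t \in `[a, b] -> f t = F t].

Definition position (gamma : R -> R2S1) : R -> 'rV[R]_2 :=
  fun t => (gamma t).1.
Definition orientation (gamma : R -> R2S1) : R -> 'rV[R]_2 :=
  fun t => val (gamma t).2.

(* A curve [0, 1] -> R2S1 is a function on R whose values outside [0, 1] are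
   irrelevant: [piecewise_C1] (which includes continuity on [0, 1], as pieces
   share their end points) and the other conditions only involve values on
   [0, 1] and derivatives in its interior, up to the negligible {0, 1}. *)
Definition piecewise_C1 (gamma : R -> R2S1) : Prop :=
  exists s : seq R, itv_partition 0 1 s /\
    forall i, (i < size s)%N ->
      C1_on (nth 0 (0 :: s) i) (nth 0 (0 :: s) i.+1) (position gamma) /\
      C1_on (nth 0 (0 :: s) i) (nth 0 (0 :: s) i.+1) (orientation gamma).

Definition ae01 (P : R -> Prop) : Prop :=
  {ae @lebesgue_measure R, forall t, t \in `[0, 1] -> P t}.

Definition u1 (gamma : R -> R2S1) : R -> R :=
  fun t => dotv (derive1 (position gamma) t) (orientation gamma t).

(* Since n = (cos theta, sin theta) gives n' = theta' (- sin theta, cos theta),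
   this is theta', with no choice of an angular lift. *)
Definition u3 (gamma : R -> R2S1) : R -> R :=
  fun t => dotv (derive1 (orientation gamma) t) (perp (orientation gamma t)).

Definition Gamma0 (q0 q1 : R2S1) : set (R -> R2S1) :=
  [set gamma | [/\ piecewise_C1 gamma, gamma 0 = q0, gamma 1 = q1 &
    ae01 (fun t => exists c : R,
      derive1 (position gamma) t = c *: orientation gamma t)]].

Definition Gamma0_plus (q0 q1 : R2S1) : set (R -> R2S1) :=
  [set gamma | Gamma0 q0 q1 gamma /\
    ae01 (fun t => 0 <= dotv (derive1 (position gamma) t) (orientation gamma t))].

Section Metric.
Variable xi : R.

Definition curve_length (gamma : R -> R2S1) : \bar R :=
  (\int[@lebesgue_measure R]_(t in [set` `[0%R, 1%R]])
     (Num.sqrt (xi ^+ 2 * `|u1 gamma t| ^+ 2 + `|u3 gamma t| ^+ 2))%:E)%E.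

Definition d_F0 (q0 q1 : R2S1) : \bar R :=
  ereal_inf [set curve_length gamma | gamma in Gamma0 q0 q1].

Definition d_F0_plus (q0 q1 : R2S1) : \bar R :=
  ereal_inf [set curve_length gamma | gamma in Gamma0_plus q0 q1].

(* The infimum is a minimum over at most four values, see [min_liftsE]. *)
Definition min_lifts (d : R2S1 -> R2S1 -> \bar R) (P Q : R2P1) : \bar R :=
  ereal_inf [set d q0 q1 | q0 in lifts P & q1 in lifts Q].

Lemma min_liftsE d (p q : R2S1) :
  min_lifts d (class_of p) (class_of q) =
  mine (mine (d p q) (d p (bar q))) (mine (d (bar p) q) (d (bar p) (bar q))).
Proof.
rewrite /min_lifts !lifts_class_of; apply/eqP; rewrite eq_le; apply/andP; split.
  rewrite !le_min; do ![apply/andP; split]; apply: ereal_inf_lbound;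
    (eexists; last (eexists; last reflexivity)); rewrite /=; tauto.
apply: le_ereal_inf_tmp => _ [q0 [->|->] [q1 [->|->] <-]];
  by rewrite !ge_min lexx ?orbT.
Qed.

Definition d_c : R2P1 -> R2P1 -> \bar R := min_lifts d_F0_plus.
Definition d_proj : R2P1 -> R2P1 -> \bar R := min_lifts d_F0.

Definition constant_speed (gamma : R -> R2S1) : Prop :=
  exists c : R,
    ae01 (fun t => xi ^+ 2 * `|u1 gamma t| ^+ 2 + `|u3 gamma t| ^+ 2 = c).

Definition minimizing_geodesic (P Q : R2P1) (gamma : R -> R2S1) : Prop :=
  exists q0 q1 : R2S1,
    [/\ lifts P q0, lifts Q q1, Gamma0 q0 q1 gamma,
        curve_length gamma = d_proj P Q & constant_speed gamma].

Definition cusp (gamma : R -> R2S1) (t0 : R) : Prop :=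
  [/\ t0 \in `]0, 1[, u1 gamma t0 = 0, derivable (u1 gamma) t0 1 &
      derive1 (u1 gamma) t0 != 0].

Definition cusp_free (gamma : R -> R2S1) : Prop := forall t0, ~ cusp gamma t0.

Definition Q_tilde : set R2P1 :=
  [set P1 | exists gamma,
     minimizing_geodesic (class_of p_origin) P1 gamma /\ cusp_free gamma].

End Metric.
End PositionsOrientations.
Arguments p_origin {R}.

(* Main.v *)
(* For a given angle function, the spatial control of least energy producing a given
   displacement is u = p cos theta + q sin theta, where (p, q) solves a 2 x 2 linear
   system. Curves of nearly minimal length, reparametrized at nearly constant speed, have
   equi-Lipschitz angles, hence converge along an ultrafilter. Comparing their energy with
   that of their perturbations shows that the limit angle solves
   theta'' = - xi^2 (p cos theta + q sin theta) (q cos theta - p sin theta) and drives a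
   minimizer of length m with u as spatial control, so that theta'^2 + xi^2 u^2 = m^2. For
   a constant sequence, this shows that all minimizers are of this form. Unless u vanishes
   identically, its zeros in ]0, 1[ are exactly the cusps. Hence a cusp-free minimizer has a
   control u of constant sign and, up to replacing theta by theta + pi, it competes for d_c.
   Conversely, if d_c = d_proj, then curves with nonnegative spatial controls have as limit
   a minimizer without cusp. Finally theta' = m or - m at a zero of u, and two zeros with
   the same theta' cannot coexist: running the arc between them backwards would give a
   minimizer with a corner. So there are at most two cusps, and cutting a minimizer there
   gives the violations of the triangle inequality. *)

Require Import Defs.
From mathcomp Require Import all_boot all_order all_algebra.
From mathcomp Require Import all_classical all_reals all_analysis.
From mathcomp Require Import measurable_realfun ring lra.
Import Order.TTheory GRing.Theory Num.Theory.
Import numFieldNormedType.Exports.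

Set Implicit Arguments.
Unset Strict Implicit.
Unset Printing Implicit Defensive.

Local Open Scope classical_set_scope.
Local Open Scope ring_scope.

(** Horizontality is the obstacle to variations: a curve cannot be perturbed freely with its end
    points fixed. With the angle as sole unknown the constraint disappears, for an angle is
    completed to a joining curve whenever its moment matrix is invertible. A singular matrix forces
    a constant angle, hence a straight segment, which is treated apart. Nearly minimal curves are
    only piecewise C1, and their velocities need not converge. So no velocity is passed to the
    limit: each angle is compared with a C2 function, [shot], obtained from it by integrating the
    Euler-Lagrange equation twice. Near-minimality makes the two close, and [shot] only involves
    primitives of continuous functions, which do pass to pointwise limits. Energies are carried by
    continuous functions differentiable off a finite set, so that integral inequalities reduce to
    comparisons of derivatives. The Lebesgue integral serves only to construct primitives and to
    evaluate lengths. *)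

Definition deriv1 {R : realType} (f : R -> R) (t d : R) : Prop :=
  is_derive t 1 f d.

(** * Calculus of derivatives and of continuity on the line *)

Section DerivativeRules.
Context {R : realType}.
Implicit Types (f g : R -> R) (t a b c : R).

Lemma deriv1_eq f t a b : deriv1 f t a -> a = b -> deriv1 f t b.
Proof. by move=> + <-. Qed.

Lemma deriv1D f g t a b :
  deriv1 f t a -> deriv1 g t b -> deriv1 (fun s => f s + g s) t (a + b).
Proof. by move=> ? ?; exact: is_deriveD. Qed.

Lemma deriv1N f t a : deriv1 f t a -> deriv1 (fun s => - f s) t (- a).
Proof. by move=> ?; exact: is_deriveN. Qed.

Lemma deriv1M f g t a b : deriv1 f t a -> deriv1 g t b ->
  deriv1 (fun s => f s * g s) t (f t * b + g t * a).
Proof. by move=> ? ?; exact: is_deriveM. Qed.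

Lemma deriv1_cst c t : deriv1 (fun=> c) t 0.
Proof. exact: is_derive_cst. Qed.

Lemma deriv1_id t : deriv1 (fun s => s) t 1.
Proof. exact: is_derive_id. Qed.

Lemma deriv1X f n t a :
  deriv1 f t a -> deriv1 (fun s => f s ^+ n.+1) t (n.+1%:R * f t ^+ n * a).
Proof.
by move=> fa; have := is_deriveX n.+1 fa; rewrite exprfctE.
Qed.

Lemma deriv1_comp f g t a b :
  deriv1 f (g t) a -> deriv1 g t b -> deriv1 (fun s => f (g s)) t (a * b).
Proof. exact: (@is_derive1_comp R f g t a b). Qed.

Lemma deriv1_cos f t a :
  deriv1 f t a -> deriv1 (fun s => cos (f s)) t (- sin (f t) * a).
Proof. by apply: deriv1_comp; exact: is_derive_cos. Qed.

Lemma deriv1_sin f t a :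
  deriv1 f t a -> deriv1 (fun s => sin (f s)) t (cos (f t) * a).
Proof. by apply: deriv1_comp; exact: is_derive_sin. Qed.

Lemma deriv1_near f g t a :
  (\near t, f t = g t) -> deriv1 f t a -> deriv1 g t a.
Proof. exact: near_eq_is_derive. Qed.

Lemma deriv1_itv f g (c d : R) t a : t \in `]c, d[ ->
  {in `]c, d[, f =1 g} -> deriv1 f t a -> deriv1 g t a.
Proof.
move=> tcd fg; apply: deriv1_near.
have H : \forall s \near t, s \in `]c, d[ by exact: near_in_itvoo.
by near=> s; apply: fg; near: s.
Unshelve. all: by end_near. Qed.

Lemma deriv1_continuous f t a : deriv1 f t a -> {for t, continuous f}.
Proof.
by move=> [df _]; exact/differentiable_continuous/derivable1_diffP.
Qed.

Lemma deriv1_uniq f t a b : deriv1 f t a -> deriv1 f t b -> a = b.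
Proof. by move=> [_ <-] [_ <-]. Qed.

Lemma deriv1_val f t a : deriv1 f t a -> derive1 f t = a.
Proof. by move=> [_ <-]; rewrite derive1E. Qed.

Lemma derivable_deriv1 f t : derivable f t 1 -> deriv1 f t (derive1 f t).
Proof. by move=> df; rewrite derive1E; exact: derivableP. Qed.

Lemma deriv1_mull c t : deriv1 ( *%R c) t c.
Proof.
by apply: (deriv1_eq (deriv1M (deriv1_cst c t) (deriv1_id t))); rewrite mulr0 addr0 mulr1.
Qed.

Lemma deriv1_addl c t : deriv1 (+%R c) t 1.
Proof. by apply: (deriv1_eq (deriv1D (deriv1_cst c t) (deriv1_id t))); rewrite add0r. Qed.

End DerivativeRules.

(** The value of the derivative stays an existential variable that the rules fill in; [derivs] then
    leaves its equality with the expected value as the goal. *)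
Ltac deriv_step :=
  lazymatch goal with
  | |- deriv1 (fun s => _ + _) _ _ => eapply deriv1D
  | |- deriv1 (fun s => - _) _ _ => eapply deriv1N
  | |- deriv1 (fun s => _ * _) _ _ => eapply deriv1M
  | |- deriv1 (fun s => _ ^+ _) _ _ => eapply deriv1X
  | |- deriv1 (fun s => cos _) _ _ => eapply deriv1_cos
  | |- deriv1 (fun s => sin _) _ _ => eapply deriv1_sin
  | |- deriv1 (fun s => s) _ _ => eapply deriv1_id
  | |- deriv1 (GRing.mul _) _ _ => eapply deriv1_mull
  | |- deriv1 (GRing.add _) _ _ => eapply deriv1_addl
  | |- deriv1 (fun s => ?c) _ _ => eapply deriv1_cst
  | |- deriv1 _ _ _ => solve [eauto]
  end.
Ltac derivs := eapply deriv1_eq; [repeat deriv_step|cbv beta].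

Section ContinuityRules.
Context {T : topologicalType} {R : realType}.
Implicit Types (f g : T -> R).

Lemma contD f g : continuous f -> continuous g -> continuous (fun s => f s + g s).
Proof. by move=> cf cg t; apply: cvgD; [exact: cf|exact: cg]. Qed.
Lemma contN f : continuous f -> continuous (fun s => - f s).
Proof. by move=> cf t; apply: cvgN; exact: cf. Qed.
Lemma contM f g : continuous f -> continuous g -> continuous (fun s => f s * g s).
Proof. by move=> cf cg t; apply: cvgM; [exact: cf|exact: cg]. Qed.
Lemma contX f n : continuous f -> continuous (fun s => f s ^+ n).
Proof.
move=> cf; elim: n => [|n IH] t; first exact: cvg_cst.
rewrite (_ : (fun s => _) = (fun s => f s * f s ^+ n)); last first.
  by apply/funext => s; rewrite exprS.
by apply: cvgM; [exact: cf|exact: IH].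
Qed.
Lemma cont_cst (c : R) : continuous (fun _ : T => c).
Proof. by move=> t; exact: cvg_cst. Qed.
Lemma cont_cos f : continuous f -> continuous (fun s => cos (f s)).
Proof. by move=> cf t; apply: continuous_comp; [exact: cf|exact: continuous_cos]. Qed.
Lemma cont_sin f : continuous f -> continuous (fun s => sin (f s)).
Proof. by move=> cf t; apply: continuous_comp; [exact: cf|exact: continuous_sin]. Qed.
Lemma cont_norm f : continuous f -> continuous (fun s => `|f s|).
Proof. by move=> cf t; apply: cvg_norm; exact: cf. Qed.
Lemma cont_comp (h : R -> R) f : continuous h -> continuous f -> continuous (fun s => h (f s)).
Proof. by move=> ch cf t; apply: continuous_comp; [exact: cf|exact: ch]. Qed.
Lemma cont_id : continuous (fun s : T => s).
Proof. by move=> t. Qed.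
End ContinuityRules.

Lemma cont_mull {R : realType} (c : R) : continuous ( *%R c).
Proof. exact: mulrl_continuous. Qed.

Ltac cont_step :=
  lazymatch goal with
  | |- continuous (fun s => _ + _) => apply: contD
  | |- continuous (fun s => - _) => apply: contN
  | |- continuous (fun s => _ * _) => apply: contM
  | |- continuous (fun s => _ ^+ _) => apply: contX
  | |- continuous (fun s => cos _) => apply: cont_cos
  | |- continuous (fun s => sin _) => apply: cont_sin
  | |- continuous (fun s => `| _ |) => apply: cont_norm
  | |- continuous (GRing.mul _) => apply: cont_mull
  | |- continuous (fun s => s) => apply: cont_id
  | |- continuous (fun s => ?c) => apply: cont_cst
  | |- continuous _ => solve [eauto]
  end.
Ltac conts := repeat cont_step.

(** * Mean value inequalities off a finite set *)

Section Monotonicity.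
Context {R : realType}.
Implicit Types (f g : R -> R) (S : seq R) (a b : R).

(** Continuity at an exceptional point allows the interval to be cut there, whence the induction on
    [S]. In this form the breakpoints of piecewise C1 curves cause no trouble. *)
Lemma le_of_deriv_ge0 f S a b : a <= b -> continuous f ->
  (forall t, t \in `]a, b[ -> t \notin S -> exists2 d, deriv1 f t d & 0 <= d) ->
  f a <= f b.
Proof.
move=> + cf; elim: S a b => [|c S IH] a b.
  rewrite le_eqVlt => /predU1P[->//|ab] H.
  have H' t : t \in `]a, b[ -> deriv1 f t (derive1 f t) /\ 0 <= derive1 f t.
    by move=> /H /(_ isT) [d fd d0]; rewrite (deriv1_val fd).
  have [t tab E] := @MVT R f (derive1 f) a b ab (fun t th => (H' t th).1)
    (continuous_subspaceT cf).
  by rewrite -subr_ge0 E mulr_ge0 ?subr_ge0 ?(ltW ab)//; have [] := H' t tab.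
move=> ab H.
(* An interval that avoids [c] meets only exceptional points of the tail. *)
have sub a' b' : a <= a' -> b' <= b -> a' <= b' -> c \notin `]a', b'[ -> f a' <= f b'.
  move=> aa' b'b a'b' cab; apply: IH => // t tab tS; apply: H.
    by move: tab; rewrite !in_itv/= => /andP[? ?]; rewrite (le_lt_trans aa')//= (lt_le_trans _ b'b).
  by rewrite inE negb_or tS andbT; apply: contraNN cab => /eqP <-.
have [cab|cab] := boolP (c \in `]a, b[); last exact: sub.
move: (cab); rewrite in_itv/= => /andP[ac cb].
apply: (@le_trans _ _ (f c)); apply: sub => //; rewrite ?ltW// in_itv/= ?ltxx//.
by rewrite andbF.
Qed.

Lemma eq_of_deriv0 f S a b : a <= b -> continuous f ->
  (forall t, t \in `]a, b[ -> t \notin S -> deriv1 f t 0) -> f a = f b.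
Proof.
move=> ab cf H; apply/eqP; rewrite eq_le; apply/andP; split.
  by apply: (le_of_deriv_ge0 (S := S)) => // t tab tS; exists 0; rewrite ?lexx//; exact: H.
rewrite -lerN2; apply: (@le_of_deriv_ge0 (fun t => - f t) S) => //.
  exact: contN.
by move=> t tab tS; exists 0 => //; have ? := H t tab tS; derivs; rewrite oppr0.
Qed.

Lemma le_deriv_le f g S a b : a <= b -> continuous f -> continuous g ->
  (forall t, t \in `]a, b[ -> t \notin S ->
    exists d e, [/\ deriv1 f t d, deriv1 g t e & d <= e]) ->
  f b - f a <= g b - g a.
Proof.
move=> ab cf cg H.
have : g a - f a <= g b - f b.
  apply: (@le_of_deriv_ge0 (fun t => g t - f t) S) => //; first by conts.
  move=> t tab tS; have [d [e [fd ge de]]] := H t tab tS.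
  by exists (e - d); [derivs|rewrite subr_ge0].
lra.
Qed.

Lemma eq_deriv_eq f g S a b : a <= b -> continuous f -> continuous g ->
  (forall t, t \in `]a, b[ -> t \notin S ->
    exists2 d, deriv1 f t d & deriv1 g t d) ->
  f b - f a = g b - g a.
Proof.
move=> ab cf cg H; apply/eqP; rewrite eq_le; apply/andP; split;
  apply: (le_deriv_le (S := S)) => // t tab tS; have [d fd gd] := H t tab tS;
  by exists d, d.
Qed.

Lemma lip_of_deriv f S B a b : a <= b -> continuous f ->
  (forall t, t \in `]a, b[ -> t \notin S -> exists2 d, deriv1 f t d & `|d| <= B) ->
  `|f b - f a| <= B * (b - a).
Proof.
move=> ab cf H; rewrite ler_norml; apply/andP; split.
  have := @le_deriv_le (fun t => - B * t) f S a b ab.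
  rewrite -mulrBr -mulNr; apply=> //; first by conts.
  move=> t tab tS; have [d fd] := H t tab tS; rewrite ler_norml => /andP[? _].
  by exists (- B), d; split => //; derivs; ring.
have := @le_deriv_le f (fun t => B * t) S a b ab.
rewrite -mulrBr; apply=> //; first by conts.
move=> t tab tS; have [d fd] := H t tab tS; rewrite ler_norml => /andP[_ ?].
by exists d, B; split => //; derivs; ring.
Qed.

End Monotonicity.

Section Clamp.
Context {R : realType}.
Implicit Types (a b t : R) (f : R -> R).

(** For a <= b this retracts the line onto [a, b]; composing with it makes a function given on
    [a, b] continuous on the whole line. *)
Definition clamp a b t := Num.max a (Num.min b t).

Lemma clamp_id a b t : t \in `[a, b] -> clamp a b t = t.
Proof.
by rewrite in_itv/= /clamp => /andP[at1 tb]; rewrite (min_idPr tb) (max_idPr at1).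
Qed.

Lemma clamp_in a b t : a <= b -> clamp a b t \in `[a, b].
Proof.
move=> ab; rewrite in_itv/= /clamp le_max lexx/= ge_max ab/=.
by rewrite ge_min lexx.
Qed.

Lemma clamp_cont a b : continuous (clamp a b).
Proof.
move=> t; apply: continuous_max; first exact: cvg_cst.
by apply: continuous_min; [exact: cvg_cst|exact: cvg_id].
Qed.

End Clamp.

(** * Piecewise continuous functions and the Lebesgue integral *)

Section PiecewisePrimitive.
Context {R : realType}.
Implicit Types (f : R -> R) (S : seq R) (a b B : R).
Notation mu := (@lebesgue_measure R).

Lemma seq_measurable (A : set R) S : A `<=` [set` S] -> measurable A.
Proof.
move=> AS; apply: countable_measurable; first by move=> t; exact: measurable_set1.
by apply/finite_set_countable/(sub_finite_set AS); exact: finite_seq.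
Qed.

Lemma seq_mu0 (A : set R) S : A `<=` [set` S] -> mu A = 0%E.
Proof.
move=> AS; apply: countable_lebesgue_measure0.
by apply/finite_set_countable/(sub_finite_set AS); exact: finite_seq.
Qed.

Lemma open_itv_minus_seq a b S : open [set t : R | (t \in `]a, b[) /\ (t \notin S)].
Proof.
rewrite (_ : mkset _ = [set t | t \in `]a, b[] `&` ~` [set` S]); last first.
  by apply/seteqP; split => t /= [? /negP ?].
apply: openI; first exact: interval_open.
rewrite openC; apply: accessible_finite_set_closed.1 (finite_seq S).
exact/hausdorff_accessible/Rhausdorff.
Qed.

(** This turns lengths, which are Lebesgue integrals, into increments of a continuous function whose
    derivative is known off the breakpoints. *)
Lemma piecewise_primitive f S B a b : a < b ->
  (forall t, t \in `]a, b[ -> t \notin S -> {for t, continuous f} /\ `|f t| <= B) ->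
  exists G : R -> R, [/\ continuous G,
    forall t, t \in `]a, b[ -> t \notin S -> deriv1 G t (f t) &
    (\int[mu]_(t in `[a, b]) (f t)%:E)%E = (G b - G a)%:E].
Proof.
move=> ab H.
pose D : set R := [set t : R | (t \in `]a, b[) /\ (t \notin S)].
have oD : open D  by exact: open_itv_minus_seq.
have mD : measurable D by exact: open_measurable.
have mfD : measurable_fun D f.
  apply: open_continuous_measurable_fun => // t; rewrite inE => -[tab tS].
  by have [] := H t tab tS.
(* Nothing is known of [f] on [S] or outside ]a, b[. Its restriction to the open set [D], extended
   by 0, is bounded and measurable on the line. *)
pose h := f \_ D.
have hD t : D t -> h t = f t by move=> Dt; rewrite /h patchE mem_set.
have h0 t : ~ D t -> h t = 0 by move=> Dt; rewrite /h patchE memNset.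
have mh : measurable_fun setT h by apply/(measurable_restrictT _ _).1.
have hB t : `|h t| <= Num.max B 0.
  have [Dt|Dt] := pselect (D t); last by rewrite h0// normr0 le_max lexx orbT.
  by rewrite hD// le_max; have [_ ->] := H t Dt.1 Dt.2.
have ih c d : mu.-integrable `[c, d] (EFin \o h).
  apply: measurable_bounded_integrable => //.
  - rewrite -[ltLHS]/(mu `[c, d]) lebesgue_measure_itv/=.
    by case: ifPn => _; rewrite ?ltry// -EFinB ltry.
  - exact: measurable_funS mh.
  - exists (Num.max B 0); split; first exact: num_real.
    by move=> x xB t _ /=; rewrite (le_trans (hB t))// ltW.
(* The margin makes a and b interior points, where the indefinite integral is continuous on both
   sides. *)
pose a1 := a - 1; pose b1 := b + 1.
have [a1a bb1] : a1 < a /\ b < b1 by rewrite /a1 /b1; split; lra.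
have a1b1 : a1 < b1 by rewrite (lt_trans a1a)// (lt_trans ab).
pose G0 t := parameterized_integral mu a1 t h.
have cG0 : {within `[a1, b1], continuous G0}.
  exact: parameterized_integral_continuous (ltW a1b1) (ih _ _).
have cG0' t : t \in `]a1, b1[ -> {for t, continuous G0}.
  by have [] := (continuous_within_itvP G0 a1b1).1 cG0 => + _ _; exact.
pose G t := G0 (clamp a b t).
have GE t : t \in `[a, b] -> G t = G0 t by move=> tab; rewrite /G clamp_id.
have cG : continuous G.
  move=> t; apply: (@continuous_comp _ _ _ (clamp a b) G0); first exact: clamp_cont.
  apply: cG0'; have := @clamp_in R a b t (ltW ab).
  rewrite !in_itv/= => /andP[l r]; rewrite (lt_le_trans a1a)//=.
  exact: le_lt_trans bb1.
exists G; split => //.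
  move=> t tab tS.
  have Dt : D t by split.
  have ct : {for t, continuous h}.
    have ft := (H t tab tS).1.
    rewrite /prop_for /continuous_at hD//; apply: cvg_trans ft; apply: near_eq_cvg.
    by apply: filterS (open_nbhs_nbhs (conj oD Dt)) => s Ds; rewrite hD.
  move: (tab); rewrite in_itv/= => /andP[ta tb].
  have [dG0 G0h] := @continuous_FTC1_closed R h a1 t b1 (lt_trans tb bb1) (ih _ _)
    (lt_trans a1a ta) ct.
  apply: (@deriv1_itv R G0 G a b) => //.
    by move=> s sab; rewrite GE//; exact: subset_itv_oo_cc.
  by apply: (deriv1_eq (derivable_deriv1 dG0)); rewrite G0h hD.
rewrite !GE ?in_itv/= ?lexx ?(ltW ab)//.
have -> : G0 b - G0 a = \int[mu]_(t in `]a, b]) h t.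
  rewrite /G0 /parameterized_integral (@Rintegral_itvB R h _ _ a) => //.
  - by rewrite bnd_simp ltW.
  - by rewrite bnd_simp ltW.
have -> : (\int[mu]_(t in `[a, b]) (f t)%:E = \int[mu]_(t in `[a, b]) (h t)%:E)%E.
  (* On [a, b], [f] and [h] can differ only on this finite set, which also yields the measurability
     of [f] on [a, b]. *)
  have sub : `[a, b] `\` D `<=` [set` a :: b :: S].
    move=> t /= [tab nDt]; rewrite !inE.
    have [->//|ta] := eqVneq t a; have [->//|tb] := eqVneq t b => /=.
    apply: contrapT => /negP tS; apply: nDt; split => //.
    by move: tab; rewrite !in_itv/= !lt_def (eq_sym b t) ta tb.
  have mF := seq_measurable sub.
  have DF : `[a, b]%classic = D `|` (`[a, b] `\` D).
    apply/seteqP; split=> t; last by move=> [[tab _]|[]]//; exact: subset_itv_oo_cc.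
    by move=> tab; have [?|?] := pselect (D t); [left|right].
  apply: ae_eq_integral => //.
  - apply/measurable_EFinP; rewrite DF; apply/(measurable_funU _ mD mF); split => //.
    move=> _ Y mY; apply: (@seq_measurable _ (a :: b :: S)).
    by move=> t [/sub].
  - by apply/measurable_EFinP; exact: measurable_funS mh.
  - exists (`[a, b] `\` D); split; [exact: mF|exact: seq_mu0 sub|].
    move=> t /= /not_implyP[tab fh]; split => // Dt; apply: fh.
    by rewrite hD.
rewrite /Rintegral fineK; last first.
  by apply: integrable_fin_num => //; apply: integrableS (ih a b) => //; exact: subset_itv_oc_cc.
have mh' : measurable_fun `]a, b[ (EFin \o h).
  by apply/measurable_EFinP; exact: measurable_funS mh.
by rewrite (integral_itv_bndoo _ _ mh') (integral_itv_bndoo _ _ mh').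
Qed.

End PiecewisePrimitive.

(** * Primitives of continuous functions *)

Section Primitive.
Context {R : realType}.
Implicit Types (f g : R -> R) (S : seq R) (a b t B : R).

Lemma bounded_itv f a b : continuous f -> exists B, forall t, t \in `[a, b] -> `|f t| <= B.
Proof.
move=> cf; have [ab|ba] := leP a b; last first.
  by exists 0 => t; rewrite in_itv/= => /andP[at1 tb]; have := le_trans at1 tb; rewrite leNgt ba.
have [c _ cM] := @EVT_max R (fun t => `|f t|) a b ab (continuous_subspaceT (cont_norm cf)).
by exists `|f c| => t tab; exact: cM.
Qed.

(** Primitives on the intervals ]-n-1, n+1[, normalized at 0, agree where they overlap and glue
    together. *)
Lemma primitive_exists f : continuous f ->
  exists G : R -> R, (forall t, deriv1 G t (f t)) /\ G 0 = 0.
Proof.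
move=> cf.
have /choice[G GP] (n : nat) : exists G : R -> R, continuous G /\
    forall t, t \in `](- n.+1%:R), n.+1%:R[ -> deriv1 G t (f t).
  have nn : (- n.+1%:R : R) < n.+1%:R by rewrite gtrN ?ltr0Sn.
  have [B HB] := @bounded_itv f (- n.+1%:R) n.+1%:R cf.
  have [|G [cG dG _]] := @piecewise_primitive R f [::] B _ _ nn.
    by move=> t tn _; split; [exact: cf|apply: HB; exact: subset_itv_oo_cc].
  by exists G; split => // t tn; exact: dG.
have GE n m t : `|t| < n.+1%:R -> `|t| < m.+1%:R ->
    G n t - G n 0 = G m t - G m 0.
  rewrite !ltr_norml => /andP[tn1 tn2] /andP[tm1 tm2].
  have [c1 d1] := GP n; have [c2 d2] := GP m.
  have n0 : 0 < n.+1%:R :> R by rewrite ltr0Sn.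
  have m0 : 0 < m.+1%:R :> R by rewrite ltr0Sn.
  have [t0|t0] := leP 0 t.
    apply: (eq_deriv_eq (S := [::])) => // s.
    rewrite in_itv/= => /andP[s0 st] _; exists (f s).
      by apply: d1; rewrite in_itv/=; apply/andP; split; lra.
    by apply: d2; rewrite in_itv/=; apply/andP; split; lra.
  apply: oppr_inj; rewrite !opprB.
  apply: (eq_deriv_eq (S := [::])) => //; first exact: ltW.
  move=> s; rewrite in_itv/= => /andP[s0 st] _; exists (f s).
    by apply: d1; rewrite in_itv/=; apply/andP; split; lra.
  by apply: d2; rewrite in_itv/=; apply/andP; split; lra.
pose n t := (Num.truncn `|t|).
have nP t : `|t| < (n t).+1%:R by have /andP[] := truncn_itv (normr_ge0 t).
pose H t := G (n t) t - G (n t) 0.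
have H0 : H 0 = 0 by rewrite /H subrr.
exists H; split => // t.
(* One more than the index used at [t], so that the window ]t - 1, t + 1[ fits in the domain. *)
pose N := (n t).+1.
have tN : `|t| + 1 < N.+1%:R.
  by rewrite /N -[X in _ < X]natr1 ltrD2r.
apply: (@deriv1_itv R (fun s => G N s - G N 0) H (t - 1) (t + 1)).
- by rewrite in_itv/=; apply/andP; split; lra.
- move=> s; rewrite in_itv/= => /andP[ts st]; apply: GE; last exact: nP.
  apply: le_lt_trans tN; rewrite -lerBlDl (le_trans (lerB_dist _ _))//.
  by rewrite ler_norml; apply/andP; split; lra.
- have tN' : `|t| < N.+1%:R by lra.
  have [_ /(_ t)] := GP N; rewrite in_itv/= -ltr_norml tN' => /(_ isT) d.
  by derivs; rewrite oppr0 addr0.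
Qed.

(** A total function of [f], so that integrals from 0 are handled by rewriting; the zero function is
    returned when no such primitive exists. *)
Definition prim f : R -> R :=
  xget (fun=> 0) [set G | (forall t, deriv1 G t (f t)) /\ G 0 = 0].

Lemma prim_spec f : continuous f ->
  (forall t, deriv1 (prim f) t (f t)) /\ prim f 0 = 0.
Proof.
move=> /primitive_exists [G HG]; rewrite /prim.
by case: xgetP => [? -> //|/(_ G)].
Qed.

Lemma prim_deriv f t : continuous f -> deriv1 (prim f) t (f t).
Proof. by move=> /prim_spec[]. Qed.

Lemma prim0 f : continuous f -> prim f 0 = 0.
Proof. by move=> /prim_spec[]. Qed.

Lemma prim_cont f : continuous f -> continuous (prim f).
Proof. by move=> cf t; exact: deriv1_continuous (prim_deriv _ cf). Qed.

Lemma primE f G S t : continuous f -> continuous G -> 0 <= t ->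
  (forall s, s \in `]0, t[ -> s \notin S -> deriv1 G s (f s)) ->
  prim f t = G t - G 0.
Proof.
move=> cf cG t0 H.
rewrite -(@eq_deriv_eq R (prim f) G S 0 t t0) ?prim0 ?subr0//; first exact: prim_cont.
by move=> s st sS; exists (f s); [exact: prim_deriv|exact: H].
Qed.

Lemma eq_prim f g t : continuous f -> continuous g -> 0 <= t ->
  (forall s, s \in `]0, t[ -> f s = g s) -> prim f t = prim g t.
Proof.
move=> cf cg t0 fg; rewrite (@primE f (prim g) [::])//.
- by rewrite prim0// subr0.
- exact: prim_cont.
- by move=> s st _; rewrite fg//; exact: prim_deriv.
Qed.

Lemma prim_le f g t : continuous f -> continuous g -> 0 <= t ->
  (forall s, s \in `]0, t[ -> f s <= g s) -> prim f t <= prim g t.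
Proof.
move=> cf cg t0 fg; have := @le_deriv_le R (prim f) (prim g) [::] 0 t t0.
rewrite !prim0// !subr0; apply; try exact: prim_cont.
move=> s st _; exists (f s), (g s); split; try exact: prim_deriv.
exact: fg.
Qed.

Lemma primD f g t : continuous f -> continuous g -> 0 <= t ->
  prim (fun s => f s + g s) t = prim f t + prim g t.
Proof.
move=> cf cg t0; rewrite (@primE _ (fun s => prim f s + prim g s) [::])//.
- by rewrite !prim0// addr0 subr0.
- exact: contD.
- by apply: contD; exact: prim_cont.
- by move=> s _ _; exact: (deriv1D (prim_deriv s cf) (prim_deriv s cg)).
Qed.

Lemma primZ f c t : continuous f -> 0 <= t ->
  prim (fun s => c * f s) t = c * prim f t.
Proof.
move=> cf t0; have cp := prim_cont cf.
rewrite (@primE _ (fun s => c * prim f s) [::])//.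
- by rewrite !prim0// mulr0 subr0.
- by conts.
- by conts.
- by move=> s _ _; have := prim_deriv s cf => ?; derivs; rewrite mulr0 addr0.
Qed.

Lemma prim_cst c t : 0 <= t -> prim (fun=> c) t = c * t.
Proof.
move=> t0; rewrite (@primE _ (fun s => c * s) [::])//.
- by rewrite mulr0 subr0.
- by conts.
- by conts.
- by move=> s _ _; derivs; ring.
Qed.

Lemma prim_ge0 f t : continuous f -> 0 <= t ->
  (forall s, s \in `]0, t[ -> 0 <= f s) -> 0 <= prim f t.
Proof.
move=> cf t0 fg; have -> : 0 = prim (fun=> 0) t by rewrite prim_cst// mul0r.
by apply: prim_le => //; conts.
Qed.

Lemma prim_bound f B t : continuous f -> 0 <= t ->
  (forall s, s \in `]0, t[ -> `|f s| <= B) -> `|prim f t| <= B * t.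
Proof.
move=> cf t0 fB; have := @lip_of_deriv R (prim f) [::] B 0 t t0 (prim_cont cf).
rewrite prim0// !subr0; apply=> s st _; exists (f s); first exact: prim_deriv.
exact: fB.
Qed.

(** The primitive is nondecreasing with equal values at 0 and 1, hence constant, and its derivative
    vanishes. *)
Lemma prim_eq0 f : continuous f ->
  (forall s, s \in `]0, 1[ -> 0 <= f s) -> prim f 1 = 0 ->
  forall s, s \in `]0, 1[ -> f s = 0.
Proof.
move=> cf f0 f1 s s01.
have mono a b : 0 <= a -> a <= b -> b <= 1 -> prim f a <= prim f b.
  move=> a0 ab b1; apply: (le_of_deriv_ge0 (S := [::])) => //; first exact: prim_cont.
  move=> t; rewrite in_itv/= => /andP[ta tb] _; exists (f t); first exact: prim_deriv.
  by apply: f0; rewrite in_itv/=; apply/andP; split; lra.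
apply: (@deriv1_uniq R (prim f) s); first exact: prim_deriv.
apply: (@deriv1_itv R (fun=> 0) (prim f) 0 1) => //; last exact: deriv1_cst.
move=> t; rewrite in_itv/= => /andP[ta tb]; apply/eqP; rewrite eq_le; apply/andP; split.
  by rewrite -(prim0 cf); apply: mono => //; exact: ltW.
by rewrite -f1; apply: mono => //; exact: ltW.
Qed.

End Primitive.

(** * Trigonometric estimates *)

Section TrigBounds.
Context {R : realType}.
Implicit Types (a b h p q : R).

Lemma cos_lip a b : `|cos a - cos b| <= `|a - b|.
Proof.
wlog ab : a b / a <= b => [H|].
  by have [/H//|/ltW/H] := leP a b; rewrite (distrC (cos b)) (distrC b).
rewrite distrC [leRHS]distrC (ger0_norm (_ : 0 <= b - a)) ?subr_ge0//.
rewrite -[leRHS]mul1r; apply: (lip_of_deriv (S := [::])) => //.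
  exact: continuous_cos.
move=> t _ _; exists (- sin t); first exact: is_derive_cos.
by rewrite normrN sin_max.
Qed.

Lemma sin_lip a b : `|sin a - sin b| <= `|a - b|.
Proof.
wlog ab : a b / a <= b => [H|].
  by have [/H//|/ltW/H] := leP a b; rewrite (distrC (sin b)) (distrC b).
rewrite distrC [leRHS]distrC (ger0_norm (_ : 0 <= b - a)) ?subr_ge0//.
rewrite -[leRHS]mul1r; apply: (lip_of_deriv (S := [::])) => //.
  exact: continuous_sin.
move=> t _ _; exists (cos t); first exact: is_derive_sin.
by rewrite cos_max.
Qed.

Lemma norm_sin_le a : `|sin a| <= `|a|.
Proof. by have := sin_lip a 0; rewrite sin0 !subr0. Qed.

Lemma normM_lip (x1 x2 y1 y2 d : R) : `|x1| <= 1 -> `|y2| <= 1 ->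
  `|x1 - x2| <= d -> `|y1 - y2| <= d -> `|x1 * y1 - x2 * y2| <= 2 * d.
Proof.
move=> hx hy dx dy.
have -> : x1 * y1 - x2 * y2 = x1 * (y1 - y2) + (x1 - x2) * y2 by ring.
rewrite (le_trans (ler_normD _ _))// !normrM.
have : `|x1| * `|y1 - y2| <= 1 * d by rewrite ler_pM.
have : `|x1 - x2| * `|y2| <= d * 1 by rewrite ler_pM.
lra.
Qed.

Lemma cos2_lip a b : `|cos a ^+ 2 - cos b ^+ 2| <= 2 * `|a - b|.
Proof. by rewrite !expr2 normM_lip ?cos_max ?cos_lip. Qed.
Lemma sin2_lip a b : `|sin a ^+ 2 - sin b ^+ 2| <= 2 * `|a - b|.
Proof. by rewrite !expr2 normM_lip ?sin_max ?sin_lip. Qed.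
Lemma cossin_lip a b : `|cos a * sin a - cos b * sin b| <= 2 * `|a - b|.
Proof. by rewrite normM_lip ?cos_max ?sin_max ?sin_lip ?cos_lip. Qed.

(** The derivative of t - sin t cos t is 2 (sin t)^2, which is at most 2 t for t > 0. *)
Lemma sub_sin_cos_le h : `|h - sin h * cos h| <= h ^+ 2.
Proof.
wlog h0 : h / 0 <= h => [H|].
  have [/H//|/ltW h0] := leP 0 h.
  have := H (- h); rewrite oppr_ge0 => /(_ h0).
  rewrite sinN cosN sqrrN -[X in `|X|]opprK normrN.
  by rewrite (_ : - (- h - - sin h * cos h) = h - sin h * cos h)//; ring.
have cg : continuous (fun t : R => t - sin t * cos t).
  conts; [exact: continuous_sin|exact: continuous_cos].
have dg t : deriv1 (fun t : R => t - sin t * cos t) t (2 * sin t ^+ 2).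
  have ? : deriv1 (@sin R) t (cos t) by exact: is_derive_sin.
  have ? : deriv1 (@cos R) t (- sin t) by exact: is_derive_cos.
  by derivs; have := cos2Dsin2 t; nra.
rewrite ger0_norm; last first.
  have := @le_of_deriv_ge0 R _ [::] 0 h h0 cg; rewrite sin0 mul0r subr0; apply.
  by move=> t _ _; exists (2 * sin t ^+ 2) => //; rewrite mulr_ge0// sqr_ge0.
have := @le_deriv_le R _ (fun t => t ^+ 2) [::] 0 h h0 cg.
rewrite sin0 mul0r subr0 expr0n/= !subr0; apply; first by conts.
move=> t; rewrite in_itv/= => /andP[t0 _] _.
exists (2 * sin t ^+ 2), (2 * t); split => //; first by derivs; ring.
rewrite ler_pM2l ?ltr0Sn// -real_normK ?num_real//.
have := norm_sin_le t; have := sin_max t; rewrite (gtr0_norm t0) => s1 st.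
by rewrite expr2 -[leRHS]mul1r ler_pM.
Qed.

(** The components of the vector (p, q) along n = (cos a, sin a) and along n rotated by a right
    angle; [pq] is also the derivative of [pn] in the angle. *)
Definition pn p q a := p * cos a + q * sin a.
Definition pq p q a := q * cos a - p * sin a.

(** A second-order Taylor estimate, uniform in the angle. A lower bound is what is needed, because
    the integral of [pn] squared enters the perturbed energy with a minus sign, see
    [moment_perturbation]. *)
Lemma pn_sqr_shift p q a h :
  pn p q a ^+ 2 - 2 * h * (pn p q a * pq p q a) - 2 * (p ^+ 2 + q ^+ 2) * h ^+ 2
  <= pn p q (a - h) ^+ 2.
Proof.
have -> : pn p q (a - h) = pn p q a * cos h - pq p q a * sin h.
  by rewrite /pn /pq cosB sinB; ring.
have pnq : pn p q a ^+ 2 + pq p q a ^+ 2 = p ^+ 2 + q ^+ 2.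
  rewrite /pn /pq; have := cos2Dsin2 a; set c := cos a; set s := sin a => E.
  transitivity ((p ^+ 2 + q ^+ 2) * (c ^+ 2 + s ^+ 2)); first by ring.
  by rewrite E mulr1.
rewrite -pnq; move: (pn _ _ _) (pq _ _ _) => x y {pnq}.
have := sub_sin_cos_le h; have := norm_sin_le h; have := cos2Dsin2 h.
set c := cos h; set s := sin h => E sh gh.
have s2 : s ^+ 2 <= h ^+ 2.
  by rewrite -(real_normK (num_real s)) -(real_normK (num_real h)) lerXn2r ?nnegrE.
have xy : `|2 * (x * y)| <= x ^+ 2 + y ^+ 2.
  rewrite ler_norml; apply/andP; split.
    by have := sqr_ge0 (x + y); rewrite sqrrD; lra.
  by have := sqr_ge0 (x - y); rewrite sqrrB; lra.
have := ler_pM (normr_ge0 _) (normr_ge0 _) xy gh; rewrite -normrM ler_norml => /andP[l _].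
have x2 := mulr_ge0 (sqr_ge0 x) (_ : 0 <= h ^+ 2 - s ^+ 2); rewrite subr_ge0 in x2.
have y2 := mulr_ge0 (sqr_ge0 y) (sqr_ge0 s).
have y3 := mulr_ge0 (sqr_ge0 y) (sqr_ge0 h).
have {}x2 := x2 s2.
have c2 : c ^+ 2 = 1 - s ^+ 2 by lra.
have -> : (x * c - y * s) ^+ 2 = x ^+ 2 * (1 - s ^+ 2) + y ^+ 2 * s ^+ 2 - 2 * (x * y) * (s * c).
  by rewrite -c2; ring.
lra.
Qed.

Lemma cont_pn p q (f : R -> R) : continuous f -> continuous (fun t => pn p q (f t)).
Proof. by move=> cf; rewrite /pn; conts. Qed.
Lemma cont_pq p q (f : R -> R) : continuous f -> continuous (fun t => pq p q (f t)).
Proof. by move=> cf; rewrite /pq; conts. Qed.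

Lemma deriv1_pn p q (f : R -> R) t d :
  deriv1 f t d -> deriv1 (fun t => pn p q (f t)) t (pq p q (f t) * d).
Proof. by move=> df; rewrite /pn /pq; derivs; ring. Qed.
End TrigBounds.

(** * Angle functions of least energy *)

Section PiecewiseC1.
Context {R : realType}.
Implicit Types (f g : R -> R) (s : seq R) (a b : R).

Definition C1_ext a b f := exists F d : R -> R,
  [/\ forall t, deriv1 F t (d t), continuous d & forall t, t \in `[a, b] -> f t = F t].

Definition pieces s (P : R -> R -> Prop) := itv_partition 0 1 s /\
  forall i, (i < size s)%N -> P (nth 0 (0 :: s) i) (nth 0 (0 :: s) i.+1).

Definition pwC1 f := exists s, pieces s (fun a b => C1_ext a b f).

Lemma pwC1_lincomb f F d x y : pwC1 f -> (forall t, deriv1 F t (d t)) -> continuous d ->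
  pwC1 (fun t => x * f t + y * F t).
Proof.
move=> [s [ps H]] dF cd; exists s; split => // i /H [G [g [dG cg fG]]].
exists (fun t => x * G t + y * F t), (fun t => x * g t + y * d t); split.
- by move=> t; have ? := dG t; have ? := dF t; derivs; ring.
- by conts.
- by move=> t /fG ->.
Qed.

End PiecewiseC1.

Section Variational.
Context {R : realType}.
Variables (xi m alpha beta D1 D2 : R).
Implicit Types (th w Q W V f g : R -> R) (S : seq R) (p q B d e : R).

(* The matrix of the map (p, q) |-> int_0^1 <(p, q), n> n with n = (cos th, sin th). *)
Definition Ma th := prim (fun t => cos (th t) ^+ 2) 1.
Definition Mb th := prim (fun t => cos (th t) * sin (th t)) 1.
Definition Mc th := prim (fun t => sin (th t) ^+ 2) 1.

Lemma prim_moment th p q : continuous th ->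
  prim (fun t => pn p q (th t) * cos (th t)) 1 = Ma th * p + Mb th * q /\
  prim (fun t => pn p q (th t) * sin (th t)) 1 = Mb th * p + Mc th * q.
Proof.
move=> ct.
have c1 : continuous (fun t => cos (th t) ^+ 2) by conts.
have c2 : continuous (fun t => cos (th t) * sin (th t)) by conts.
have c3 : continuous (fun t => sin (th t) ^+ 2) by conts.
have cp : continuous (fun t => pn p q (th t)) by exact: cont_pn.
rewrite /Ma /Mb /Mc [_ * p]mulrC [_ * q]mulrC [prim _ _ * p]mulrC [prim _ _ * q]mulrC.
rewrite -!primZ// -!primD//; try by conts.
by split; apply: eq_prim => //; try (by conts); move=> t _; rewrite /pn; ring.
Qed.

(* For a given angle, the spatial control of least energy with total displacement
   (D1, D2) is pn p q th for the multipliers (p, q) solving this system. *)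
Definition moment_eq th p q :=
  Ma th * p + Mb th * q = D1 /\ Mb th * p + Mc th * q = D2.

(** Vanishing sines prescribe the end angles modulo pi, as befits the projective line. [w] is
    meaningful only off the breakpoints, so its energy is carried by the continuous function [Q]. *)
Definition angle_curve th w Q S := [/\ continuous th, pwC1 th,
  sin (th 0 - alpha) = 0 /\ sin (th 1 - beta) = 0, continuous Q &
  forall t, t \in `]0, 1[ -> t \notin S ->
    deriv1 th t (w t) /\ deriv1 Q t (w t ^+ 2)].

(** By [moment_energy], p D1 + q D2 is the integral of the squared control [pn p q th]; the
    right-hand side is thus the energy of the curve that [th] determines. The first variation uses
    nothing else about the minimality of m. *)
Definition energy_lower_bound := forall th w Q S p q,
  angle_curve th w Q S -> moment_eq th p q ->
  m ^+ 2 <= Q 1 - Q 0 + xi ^+ 2 * (p * D1 + q * D2).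

(** Half the derivative, in the angle, of the square of [pn p q]. *)
Definition force p q th := fun t => pn p q (th t) * pq p q (th t).
(* The solution of phi'' = - xi^2 force p q th with the same end points as th. *)
Definition shot p q th :=
  let G := prim (prim (force p q th)) in
  fun t => th 0 + (th 1 - th 0 + xi ^+ 2 * G 1) * t - xi ^+ 2 * G t.
Definition shotv p q th :=
  fun t => th 1 - th 0 + xi ^+ 2 * prim (prim (force p q th)) 1
           - xi ^+ 2 * prim (force p q th) t.

Lemma cont_force p q th : continuous th -> continuous (force p q th).
Proof. by move=> ct; apply: contM; [exact: cont_pn|exact: cont_pq]. Qed.

Lemma deriv1_shotv p q th t : continuous th ->
  deriv1 (shotv p q th) t (- (xi ^+ 2 * force p q th t)).
Proof.
move=> ct; have ? := prim_deriv t (@cont_force p q th ct).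
by rewrite /shotv; derivs; ring.
Qed.

Lemma deriv1_shot p q th t : continuous th ->
  deriv1 (shot p q th) t (shotv p q th t).
Proof.
move=> ct; have ? := prim_deriv t (prim_cont (@cont_force p q th ct)).
by rewrite /shot /shotv; derivs; ring.
Qed.

Lemma cont_shotv p q th : continuous th -> continuous (shotv p q th).
Proof. by move=> ct t; apply: deriv1_continuous; exact: deriv1_shotv. Qed.

Lemma cont_shot p q th : continuous th -> continuous (shot p q th).
Proof. by move=> ct t; apply: deriv1_continuous; exact: deriv1_shot. Qed.

Lemma shot0 p q th : continuous th -> shot p q th 0 = th 0.
Proof.
by move=> ct; rewrite /shot prim0 ?mulr0 ?subr0 ?addr0//; exact/prim_cont/cont_force.
Qed.

Lemma shot1 p q th : shot p q th 1 = th 1.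
Proof. by rewrite /shot; ring. Qed.

(* A primitive of (w - shotv)^2, integrated by parts so as to involve only primitives of
   continuous functions and the primitive Q of w^2. *)
Definition gap_energy p q th Q := fun t => Q t
  - 2 * (th t * shotv p q th t + xi ^+ 2 * prim (fun t => th t * force p q th t) t)
  + prim (fun t => shotv p q th t ^+ 2) t.

Lemma cont_gap_energy p q th Q : continuous th -> continuous Q ->
  continuous (gap_energy p q th Q).
Proof.
move=> ct cQ; have cf := @cont_force p q th ct; have cv := @cont_shotv p q th ct.
by rewrite /gap_energy; conts; apply: prim_cont; conts.
Qed.

Lemma deriv1_gap_energy p q th w Q t : continuous th ->
  deriv1 th t (w t) -> deriv1 Q t (w t ^+ 2) ->
  deriv1 (gap_energy p q th Q) t ((w t - shotv p q th t) ^+ 2).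
Proof.
move=> ct dth dQ; have cf := @cont_force p q th ct; have cv := @cont_shotv p q th ct.
have dv := @deriv1_shotv p q th t ct.
have ? : deriv1 (prim (fun t => th t * force p q th t)) t (th t * force p q th t).
  by apply: (prim_deriv t); conts.
have ? : deriv1 (prim (fun t => shotv p q th t ^+ 2)) t (shotv p q th t ^+ 2).
  by apply: (prim_deriv t); conts.
by rewrite /gap_energy; derivs; ring.
Qed.

Lemma Ma_Mc th : continuous th -> Ma th + Mc th = 1.
Proof.
move=> ct; rewrite /Ma /Mc -primD//; [|by conts..].
rewrite -[RHS](@mulr1 R 1) -(@prim_cst R 1 1)//; apply: eq_prim => //; try by conts.
by move=> s _; exact: cos2Dsin2.
Qed.

Lemma Ma_ge0 th : continuous th -> 0 <= Ma th.
Proof. by move=> ct; apply: prim_ge0 => //; [conts|move=> *; exact: sqr_ge0]. Qed.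
Lemma Mc_ge0 th : continuous th -> 0 <= Mc th.
Proof. by move=> ct; apply: prim_ge0 => //; [conts|move=> *; exact: sqr_ge0]. Qed.
Lemma Mb_le1 th : continuous th -> `|Mb th| <= 1.
Proof.
move=> ct; rewrite -[leRHS](@mulr1 R 1); apply: prim_bound => //; first by conts.
by move=> s _; rewrite normrM -[leRHS](@mulr1 R 1) ler_pM ?cos_max ?sin_max.
Qed.

Lemma pn_prim th p q : continuous th ->
  prim (fun t => pn p q (th t) ^+ 2) 1 =
  p ^+ 2 * Ma th + 2 * (p * q) * Mb th + q ^+ 2 * Mc th.
Proof.
move=> ct.
have c1 : continuous (fun t => cos (th t) ^+ 2) by conts.
have c2 : continuous (fun t => cos (th t) * sin (th t)) by conts.
have c3 : continuous (fun t => sin (th t) ^+ 2) by conts.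
rewrite /Ma /Mb /Mc -!primZ// -!primD//; try by conts.
by apply: eq_prim => //; [exact/contX/cont_pn|conts|move=> s _; rewrite /pn; ring].
Qed.

Lemma prim_lip_diff f g d : continuous f -> continuous g ->
  (forall t, t \in `]0, 1[ -> `|f t - g t| <= d) -> `|prim f 1 - prim g 1| <= d.
Proof.
move=> cf cg H; rewrite -[leRHS]mulr1.
have -> : prim f 1 - prim g 1 = prim (fun t => f t + -1 * g t) 1.
  by rewrite primD ?primZ//; [ring|conts].
by apply: prim_bound => //; [conts|move=> s /H; rewrite mulN1r].
Qed.

(** Let M' be the perturbed matrix, z = (p, q) and r = D - M' z the residual. The energy for M' is D
    . M'^-1 D = 2 z . D - z . M' z + r . M'^-1 r. Keeping the old multipliers therefore costs only
    the last term, quadratic in r, and r is of order e. *)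
Lemma moment_perturbation a b c a' b' c' p q B d e :
  a + c = 1 -> a' + c' = 1 -> 0 <= a -> 0 <= c -> 0 <= a' -> 0 <= c' ->
  `|b| <= 1 -> `|b'| <= 1 -> `|p| <= B -> `|q| <= B -> 0 <= B ->
  0 < d -> d <= a * c - b ^+ 2 -> 0 < e -> 16 * B * e <= d ->
  `|a' - a| <= 2 * (e * B) -> `|b' - b| <= 2 * (e * B) -> `|c' - c| <= 2 * (e * B) ->
  a * p + b * q = D1 -> b * p + c * q = D2 ->
  exists p' q', [/\ a' * p' + b' * q' = D1, b' * p' + c' * q' = D2 &
    p' * D1 + q' * D2 <= 2 * (p * D1 + q * D2)
      - (p ^+ 2 * a' + 2 * (p * q) * b' + q ^+ 2 * c') + 128 * (e ^+ 2 * B ^+ 4) / d].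
Proof.
move=> ac1 ac1e a0 c0 a0e c0e b1 b1e pB qB B0 d0 dM ep ed dA dB dC E1 E2.
have eB0 : 0 <= e * B by rewrite mulr_ge0 ?(ltW ep)//; lra.
pose det := a' * c' - b' ^+ 2.
(* The determinant moves by at most 8 e B, which explains the factor 16 in the hypothesis on e and
   d. *)
have detd : d / 2 <= det.
  have : `|(a' - a) * c'| <= 2 * (e * B) * 1 by rewrite normrM ler_pM// ger0_norm//; lra.
  have : `|a * (c' - c)| <= 1 * (2 * (e * B)) by rewrite normrM ler_pM// ger0_norm//; lra.
  have : `|(b' - b) * (b' + b)| <= 2 * (e * B) * 2.
    by rewrite normrM ler_pM// (le_trans (ler_normD _ _))//; lra.
  rewrite !ler_norml => /andP[l1 r1] /andP[l2 r2] /andP[l3 r3].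
  rewrite /det; lra.
have det0 : 0 < det by rewrite (lt_le_trans _ detd)// divr_gt0.
pose r1 := D1 - (a' * p + b' * q); pose r2 := D2 - (b' * p + c' * q).
have r1B : `|r1| <= 4 * (e * B ^+ 2).
  have -> : r1 = - ((a' - a) * p + (b' - b) * q) by rewrite /r1 -E1; ring.
  rewrite normrN (le_trans (ler_normD _ _))// !normrM.
  have : `|a' - a| * `|p| <= 2 * (e * B) * B by rewrite ler_pM.
  have : `|b' - b| * `|q| <= 2 * (e * B) * B by rewrite ler_pM.
  lra.
have r2B : `|r2| <= 4 * (e * B ^+ 2).
  have -> : r2 = - ((b' - b) * p + (c' - c) * q) by rewrite /r2 -E2; ring.
  rewrite normrN (le_trans (ler_normD _ _))// !normrM.
  have : `|b' - b| * `|p| <= 2 * (e * B) * B by rewrite ler_pM.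
  have : `|c' - c| * `|q| <= 2 * (e * B) * B by rewrite ler_pM.
  lra.
(* Cramer's rule for M' (q1, q2) = (r1, r2). *)
pose q1 := (c' * r1 - b' * r2) / det; pose q2 := (a' * r2 - b' * r1) / det.
have nz : det != 0 by rewrite gt_eqF.
have s1 : a' * q1 + b' * q2 = r1 by rewrite /q1 /q2; move: nz; rewrite /det => nz; field.
have s2 : b' * q1 + c' * q2 = r2 by rewrite /q1 /q2; move: nz; rewrite /det => nz; field.
have e1' : a' * p + b' * q + r1 = D1 by rewrite /r1; ring.
have e2' : b' * p + c' * q + r2 = D2 by rewrite /r2; ring.
(* The entries of M' are at most 1 in absolute value and |r1|, |r2| <= 4 e B^2, so the numerator is
   at most 64 e^2 B^4; dividing by det >= d / 2 doubles the constant. *)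
have qr : q1 * r1 + q2 * r2 <= 128 * (e ^+ 2 * B ^+ 4) / d.
  have -> : q1 * r1 + q2 * r2 = (c' * r1 ^+ 2 - 2 * b' * (r1 * r2) + a' * r2 ^+ 2) / det.
    by rewrite /q1 /q2; move: nz; rewrite /det => nz'; field.
  set r := 4 * (e * B ^+ 2) in r1B r2B.
  have r0 : 0 <= r := le_trans (normr_ge0 _) r1B.
  have h1 : r1 ^+ 2 <= r ^+ 2 by rewrite -(real_normK (num_real r1)) lerXn2r ?nnegrE.
  have h2 : r2 ^+ 2 <= r ^+ 2 by rewrite -(real_normK (num_real r2)) lerXn2r ?nnegrE.
  have : `|b' * (r1 * r2)| <= 1 * (r * r) by rewrite !normrM ler_pM ?mulr_ge0// ler_pM.
  rewrite ler_norml => /andP[h3 _].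
  have h4 : c' * r1 ^+ 2 <= 1 * r ^+ 2 by rewrite ler_pM ?sqr_ge0//; lra.
  have h5 : a' * r2 ^+ 2 <= 1 * r ^+ 2 by rewrite ler_pM ?sqr_ge0//; lra.
  have E : r ^+ 2 = 16 * (e ^+ 2 * B ^+ 4) by rewrite /r; ring.
  have h6 : c' * r1 ^+ 2 - 2 * b' * (r1 * r2) + a' * r2 ^+ 2 <= 64 * (e ^+ 2 * B ^+ 4).
    by have : r * r = r ^+ 2 by []; lra.
  rewrite ler_pdivrMr// (le_trans h6)//.
  have -> : 128 * (e ^+ 2 * B ^+ 4) / d * det = 64 * (e ^+ 2 * B ^+ 4) * (2 * det / d).
    by move: (gt_eqF d0) => /negbT dn; field.
  apply: ler_peMr; last by rewrite ler_pdivlMr//; lra.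
  by rewrite mulr_ge0// mulr_ge0 ?sqr_ge0 ?exprn_ge0.
exists (p + q1), (q + q2); split.
- by rewrite -{}e1' -s1; ring.
- by rewrite -{}e2' -s2; ring.
have -> : (p + q1) * D1 + (q + q2) * D2 =
    p * D1 + q * D2 + (r1 * p + r2 * q) + (q1 * r1 + q2 * r2).
  transitivity (p * D1 + q * D2 + (q1 * D1 + q2 * D2)); first by ring.
  have -> : q1 * D1 = q1 * (a' * p + b' * q + r1) by rewrite e1'.
  have -> : q2 * D2 = q2 * (b' * p + c' * q + r2) by rewrite e2'.
  have -> : r1 * p + r2 * q = (a' * q1 + b' * q2) * p + (b' * q1 + c' * q2) * q.
    by rewrite s1 s2.
  by move: r1 r2 q1 q2 {e1' e2' s1 s2 qr r1B r2B} => *; ring.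
have : r1 * p + r2 * q = p * D1 + q * D2 - (p ^+ 2 * a' + 2 * (p * q) * b' + q ^+ 2 * c').
  by rewrite /r1 /r2; ring.
lra.
Qed.

(* First variation in the direction of the solution [shot] of the Euler-Lagrange
   equation whose right-hand side is frozen along [th]: the first-order terms of
   the moment part of the energy cancel those of the integration by parts. *)
Lemma energy_gap th w Q S p q B d e : energy_lower_bound ->
  angle_curve th w Q S -> moment_eq th p q ->
  1 <= B -> `|p| <= B -> `|q| <= B ->
  (forall t, t \in `]0, 1[ -> `|th t - shot p q th t| <= B) ->
  0 < d -> d <= Ma th * Mc th - Mb th ^+ 2 -> 0 < e -> e <= 1 -> 16 * B * e <= d ->
  e * (gap_energy p q th Q 1 - gap_energy p q th Q 0) <=
  Q 1 - Q 0 + xi ^+ 2 * (p * D1 + q * D2) - m ^+ 2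
  + xi ^+ 2 * B ^+ 4 * (4 + 128 / d) * e ^+ 2.
Proof.
move=> LB [ct pt [e0 e1] cQ dS] [E1 E2] B1 pB qB kB d0 dM ep el1 ed.
pose W := shot p q th; pose V := shotv p q th; pose F := force p q th.
pose k t := th t - W t.
have cW : continuous W by exact: cont_shot.
have cV : continuous V by exact: cont_shotv.
have cF : continuous F by exact: cont_force.
have ck : continuous k by rewrite /k; conts.
have k0 : k 0 = 0 by rewrite /k /W shot0// subrr.
have k1 : k 1 = 0 by rewrite /k /W shot1 subrr.
(* A step of size e from [th] towards [W], that is [th] - e [k] with [k] vanishing at both ends. *)
pose the t := (1 - e) * th t + e * W t.
have theE t : the t = th t - e * k t by rewrite /the /k; ring.
have cte : continuous the by rewrite /the; conts.
pose K := gap_energy p q th Q.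
have cK : continuous K by exact: cont_gap_energy.
(* A primitive of (w - e (w - V))^2: write w (w - V) = (w - V)^2 + V (w - V) and integrate the last
   product by parts, with V' = - xi^2 F. *)
pose Qe t := Q t - 2 * e * K t - 2 * e * (V t * k t + xi ^+ 2 * prim (fun t => F t * k t) t)
  + e ^+ 2 * K t.
have cFk : continuous (fun t => F t * k t) by conts.
have cQe : continuous Qe by rewrite /Qe; conts; exact: prim_cont.
have ace : angle_curve the (fun t => (1 - e) * w t + e * V t) Qe S.
  have dW t : deriv1 W t (V t) by exact: deriv1_shot.
  split; [exact: cte|exact: (pwC1_lincomb (1 - e) e pt dW cV)| |exact: cQe|].
  - by rewrite !theE k0 k1 !mulr0 !subr0.
  - move=> t t01 tS; have [dt dQ] := dS t t01 tS.
    have {}dW := dW t.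
    split; first by rewrite /the; derivs; ring.
    have dK : deriv1 K t ((w t - V t) ^+ 2) by exact: deriv1_gap_energy.
    have dV : deriv1 V t (- (xi ^+ 2 * F t)) by exact: deriv1_shotv.
    have dk : deriv1 k t (w t - V t) by rewrite /k; derivs.
    have dP := prim_deriv t cFk.
    by rewrite /Qe; derivs; ring.
have Mdiff (f : R -> R) : continuous f -> (forall a b, `|f a - f b| <= 2 * `|a - b|) ->
    `|prim (fun t => f (the t)) 1 - prim (fun t => f (th t)) 1| <= 2 * (e * B).
  move=> cf lf; apply: prim_lip_diff; try exact: cont_comp.
  move=> t t01; apply: (le_trans (lf _ _)); rewrite ler_pM2l//.
  by rewrite theE addrAC subrr add0r normrN normrM gtr0_norm// ler_pM2l// kB.
have cc : continuous (@cos R) by exact: continuous_cos.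
have cs : continuous (@sin R) by exact: continuous_sin.
have dA : `|Ma the - Ma th| <= 2 * (e * B).
  by apply: (Mdiff (fun a => cos a ^+ 2)); [conts|exact: cos2_lip].
have dB : `|Mb the - Mb th| <= 2 * (e * B).
  by apply: (Mdiff (fun a => cos a * sin a)); [conts|exact: cossin_lip].
have dC : `|Mc the - Mc th| <= 2 * (e * B).
  by apply: (Mdiff (fun a => sin a ^+ 2)); [conts|exact: sin2_lip].
set I := prim (fun t => F t * k t) 1.
have QeE : Qe 1 - Qe 0 = Q 1 - Q 0 - 2 * e * (K 1 - K 0) - 2 * e * xi ^+ 2 * I
    + e ^+ 2 * (K 1 - K 0).
  by rewrite /Qe k0 k1 !prim0// -/I; ring.
have K0 : 0 <= K 1 - K 0.
  rewrite subr_ge0; apply: (le_of_deriv_ge0 (S := S)) => // t t01 tS.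
  exists ((w t - V t) ^+ 2); last exact: sqr_ge0.
  by have [dt dQ] := dS t t01 tS; exact: deriv1_gap_energy.
(* Since |p|, |q|, |k| <= B, the remainder 2 (p^2 + q^2) (e k)^2 of [pn_sqr_shift] is at most 4 B^4
   e^2. *)
have I1 : prim (fun t => pn p q (th t) ^+ 2) 1 - 2 * e * I
    - 4 * B ^+ 4 * e ^+ 2 <= prim (fun t => pn p q (the t) ^+ 2) 1.
  have -> : prim (fun t => pn p q (th t) ^+ 2) 1 - 2 * e * I
    - 4 * B ^+ 4 * e ^+ 2 = prim (fun t => pn p q (th t) ^+ 2 + (- (2 * e) * (F t * k t)
       + - (4 * B ^+ 4 * e ^+ 2))) 1.
    have ? := @cont_pn R p q th ct.
    by rewrite /I !primD ?primZ ?prim_cst//; [ring|conts..].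
  have ? := @cont_pn R p q th ct; have ? := @cont_pn R p q the cte.
  apply: prim_le => //; try by conts.
  move=> t t01; have := pn_sqr_shift p q (th t) (e * k t).
  rewrite -theE; apply: le_trans; rewrite /F /force -/(force _ _ _ _).
  have := kB t t01; rewrite -/(k t) => kt.
  have k2 : k t ^+ 2 <= B ^+ 2.
    by rewrite -(real_normK (num_real (k t))) lerXn2r ?nnegrE//; exact: le_trans kt.
  have p2 : p ^+ 2 <= B ^+ 2.
    by rewrite -(real_normK (num_real p)) lerXn2r ?nnegrE//; exact: le_trans pB.
  have q2 : q ^+ 2 <= B ^+ 2.
    by rewrite -(real_normK (num_real q)) lerXn2r ?nnegrE//; exact: le_trans qB.
  have : (p ^+ 2 + q ^+ 2) * k t ^+ 2 <= (B ^+ 2 + B ^+ 2) * B ^+ 2.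
    by rewrite ler_pM ?addr_ge0 ?sqr_ge0// lerD.
  move=> /(ler_wpM2l (sqr_ge0 e)) => H.
  have -> : 4 * B ^+ 4 * e ^+ 2 = 2 * (e ^+ 2 * ((B ^+ 2 + B ^+ 2) * B ^+ 2)) by ring.
  rewrite exprMn; lra.
rewrite !pn_prim// in I1.
have := LB the _ Qe S _ _ ace; rewrite QeE -/K.
have ac1 := Ma_Mc ct; have ac1e := Ma_Mc cte.
have [a0 c0 b1] := And3 (Ma_ge0 ct) (Mc_ge0 ct) (Mb_le1 ct).
have [a0e c0e b1e] := And3 (Ma_ge0 cte) (Mc_ge0 cte) (Mb_le1 cte).
have B0 : 0 <= B by lra.
have [p' [q' [F1 F2 F3]]] := @moment_perturbation _ _ _ _ _ _ p q B d e
  (Ma_Mc ct) (Ma_Mc cte) (Ma_ge0 ct) (Mc_ge0 ct) (Ma_ge0 cte) (Mc_ge0 cte)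
  (Mb_le1 ct) (Mb_le1 cte) pB qB B0 d0 dM ep ed dA dB dC E1 E2.
have EM : p * D1 + q * D2 = p ^+ 2 * Ma th + 2 * (p * q) * Mb th + q ^+ 2 * Mc th.
  by rewrite -E1 -E2; ring.
rewrite -EM in I1.
(* Multiplied by xi^2, the term 2 e I cancels the one of opposite sign in [QeE]. *)
have F4 : p' * D1 + q' * D2 <= (p * D1 + q * D2) + 2 * e * I + B ^+ 4 * (4 + 128 / d) * e ^+ 2.
  have -> : B ^+ 4 * (4 + 128 / d) * e ^+ 2 = 4 * B ^+ 4 * e ^+ 2 + 128 * (e ^+ 2 * B ^+ 4) / d.
    by ring.
  lra.
have {F4} := ler_wpM2l (sqr_ge0 xi) F4.
have := LB the _ Qe S p' q' ace (conj F1 F2); rewrite QeE -/K.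
(* As e <= 1, at least half of the gain 2 e (K 1 - K 0) survives. *)
have : e ^+ 2 * (K 1 - K 0) <= e * (K 1 - K 0) by rewrite ler_wpM2r// expr2 ler_piMl// ltW.
rewrite !mulrDr; lra.
Qed.

End Variational.

(** * Limits along an ultrafilter *)

Section UltraLimits.
Context {R : realType}.
Variable U : set_system nat.
Hypothesis UU : UltraFilter U.
Implicit Types (u v : nat -> R) (f g : nat -> R -> R) (F G : R -> R) (B C : R).

(** Compactness of [-B, B] gives a cluster point, and an ultrafilter converges to its cluster
    points. No subsequence is extracted, so the limits at all times can be taken simultaneously. *)
Lemma ultra_bounded_cvg u B : (\forall k \near U, `|u k| <= B) ->
  exists l : R, u k @[k --> U] --> l.
Proof.
move=> uB.
have FF : ProperFilter (u k @[k --> U]) by exact: fmap_proper_filter.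
have [|l [_ cl]] := @segment_compact R (- B) B (u k @[k --> U]) FF.
  by apply: filterS uB => k /=; rewrite in_itv/= ler_norml.
exists l => N Nl; have [//|NC] := in_ultra_setVsetC (u @^-1` N) UU.
have [|x []//] := cl (~` N) N _ Nl.
exact: NC.
Qed.

Lemma ulimD u v (a b : R) : u k @[k --> U] --> a -> v k @[k --> U] --> b ->
  u k + v k @[k --> U] --> a + b.
Proof. exact: cvgD. Qed.
Lemma ulimN u (a : R) : u k @[k --> U] --> a -> - u k @[k --> U] --> - a.
Proof. exact: cvgN. Qed.
Lemma ulimM u v (a b : R) : u k @[k --> U] --> a -> v k @[k --> U] --> b ->
  u k * v k @[k --> U] --> a * b.
Proof. exact: cvgM. Qed.
Lemma ulim_cst (a : R) : (fun _ : nat => a) k @[k --> U] --> a.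
Proof. exact: cvg_cst. Qed.
Lemma ulimV u (a : R) : a != 0 -> u k @[k --> U] --> a -> (u k)^-1 @[k --> U] --> a^-1.
Proof. exact: cvgV. Qed.
Lemma ulim_comp F u (a : R) : continuous F ->
  u k @[k --> U] --> a -> F (u k) @[k --> U] --> F a.
Proof. by move=> cF ua; apply: continuous_cvg => //; exact: cF. Qed.
Lemma ulim_norm u (a : R) : u k @[k --> U] --> a -> `|u k| @[k --> U] --> `|a|.
Proof. exact: cvg_norm. Qed.
Lemma ulim_le u v (a b : R) : u k @[k --> U] --> a -> v k @[k --> U] --> b ->
  (\forall k \near U, u k <= v k) -> a <= b.
Proof. exact: ler_cvg_to. Qed.
Lemma ulim_uniq u (a b : R) : u k @[k --> U] --> a -> u k @[k --> U] --> b -> a = b.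
Proof. by move=> ua ub; apply: (cvg_unique _ ua ub); exact: Rhausdorff. Qed.

Lemma ulim_bounded u (a : R) : u k @[k --> U] --> a ->
  exists2 B, 0 <= B & \forall k \near U, `|u k| <= B.
Proof.
move=> ua; exists (`|a| + 1); first by rewrite addr_ge0.
have /cvgr_norm_le : u k @[k --> U] --> a by [].
by apply; rewrite ltrDl.
Qed.

(** Cutting [0, t] into n equal steps bounds the increment by n C / n^2, which tends to 0. *)
Lemma quad_const F C : (forall s t : R, s \in `[0, 1] -> t \in `[0, 1] ->
    `|F t - F s| <= C * (t - s) ^+ 2) ->
  forall t : R, t \in `[0, 1] -> F t = F 0.
Proof.
move=> H t; rewrite in_itv/= => /andP[t0 t1].
have C0 : 0 <= C.
  have := H 0 1; rewrite !in_itv/= !lexx ler01 subr0 expr1n mulr1 => /(_ isT isT).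
  exact: le_trans.
apply/eqP; rewrite -subr_eq0 -normr_eq0 eq_le normr_ge0 andbT.
rewrite leNgt; apply/negP => e0; set e := `|_| in e0.
pose n := (Num.truncn (C / e)).+1.
have n0 : 0 < n%:R :> R by rewrite ltr0n.
have nC : C / e < n%:R by have /andP[] := truncn_itv (divr_ge0 C0 (ltW e0)).
have step i : (i <= n)%N -> `|F (i%:R / n%:R * t) - F 0| <= i%:R * (C / n%:R ^+ 2).
  elim: i => [_|i IH ni]; first by rewrite !mul0r subrr normr0.
  rewrite -(subrKA (F (i%:R / n%:R * t))) (le_trans (ler_normD _ _))//.
  rewrite -[in leRHS]natr1 mulrDl mul1r addrC lerD//; first exact/IH/ltnW.
  have itv j : (j <= n)%N -> j%:R / n%:R * t \in `[0, 1].
    move=> jn; rewrite in_itv/= mulr_ge0 ?divr_ge0 ?ler0n//= mulr_ile1 ?divr_ge0 ?ler0n//.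
    by rewrite ler_pdivrMr// mul1r ler_nat.
  apply: le_trans (H _ _ (itv _ (ltnW ni)) (itv _ ni)) _.
  rewrite ler_wpM2l// -natr1.
  have -> : (i%:R + 1) / n%:R * t - i%:R / n%:R * t = t / n%:R by ring.
  rewrite exprMn exprVn ler_piMl ?exprn_ge0 ?invr_ge0 ?exprn_ge0 ?ler0n//.
  by rewrite expr_le1.
have := step n (leqnn n); rewrite divff ?gt_eqF// mul1r -/e leNgt => /negP; apply.
have -> : n%:R * (C / n%:R ^+ 2) = C / n%:R by have := gt_eqF n0 => /negbT; move=> *; field.
by rewrite ltr_pdivrMr// mulrC -ltr_pdivrMr.
Qed.

Lemma prim_quad F B : continuous F ->
  (forall s t : R, s \in `[0, 1] -> t \in `[0, 1] -> `|F s - F t| <= B * `|s - t|) ->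
  forall s t : R, s \in `[0, 1] -> t \in `[0, 1] ->
  `|prim F t - prim F s - (t - s) * F s| <= B * (t - s) ^+ 2.
Proof.
move=> cF LF s t s01 t01.
have B0 : 0 <= B.
  have := LF 0 1; rewrite !in_itv/= !lexx ler01 sub0r normrN1 mulr1 => /(_ isT isT).
  exact: le_trans.
pose P r := prim F r - F s * r.
have cP : continuous P by rewrite /P; conts; exact: prim_cont.
have dP r : deriv1 P r (F r - F s).
  by have ? := prim_deriv r cF; rewrite /P; derivs; ring.
have -> : prim F t - prim F s - (t - s) * F s = P t - P s by rewrite /P; ring.
move: s01 t01; rewrite !in_itv/= => /andP[s0 s1] /andP[t0 t1].
have [st|/ltW ts] := leP s t.
  have -> : B * (t - s) ^+ 2 = B * (t - s) * (t - s) by ring.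
  apply: (lip_of_deriv (S := [::])) => // r; rewrite in_itv/= => /andP[sr rt] _.
  exists (F r - F s) => //; apply: le_trans (LF _ _ _ _) _.
  - by rewrite in_itv/= (le_trans s0 (ltW sr)) (le_trans (ltW rt)).
  - by rewrite in_itv/= s0.
  - by rewrite ler_wpM2l// gtr0_norm ?subr_gt0// lerD2r ltW.
have -> : B * (t - s) ^+ 2 = B * (s - t) * (s - t) by ring.
rewrite distrC; apply: (lip_of_deriv (S := [::])) => // r; rewrite in_itv/= => /andP[tr rs] _.
exists (F r - F s) => //; apply: le_trans (LF _ _ _ _) _.
- by rewrite in_itv/= (le_trans t0 (ltW tr)) (le_trans (ltW rs)).
- by rewrite in_itv/= s0.
- by rewrite ler_wpM2l// ltr0_norm ?subr_lt0// opprB lerD2l lerN2 ltW.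
Qed.

(** Uniform bounds make the class stable under products, uniform Lipschitz bounds make it stable
    under [prim]. They are asked only eventually, since the multipliers of the approximating angles
    are bounded only eventually. *)
Definition ulimf f F := [/\ forall k, continuous (f k), continuous F,
  (exists2 B : R, 0 <= B & \forall k \near U, forall t : R, t \in `[0, 1] -> `|f k t| <= B),
  (exists2 B : R, 0 <= B & \forall k \near U, forall s t : R, s \in `[0, 1] -> t \in `[0, 1] ->
     `|f k s - f k t| <= B * `|s - t|) &
  forall t : R, t \in `[0, 1] -> f k t @[k --> U] --> F t].

Lemma ulimfD f g F G : ulimf f F -> ulimf g G ->
  ulimf (fun k t => f k t + g k t) (fun t => F t + G t).
Proof.
move=> [cf cF [B B0 fB] [C C0 fC] fF] [cg cG [B' B'0 gB] [C' C'0 gC] gG]; split.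
- by move=> k; apply: contD.
- exact: contD.
- exists (B + B'); rewrite ?addr_ge0//; apply: filterS2 fB gB => k fk gk t t01.
  by rewrite (le_trans (ler_normD _ _))// lerD ?fk ?gk.
- exists (C + C'); rewrite ?addr_ge0//; apply: filterS2 fC gC => k fk gk s t s01 t01.
  have -> : f k s + g k s - (f k t + g k t) = (f k s - f k t) + (g k s - g k t) by ring.
  by rewrite (le_trans (ler_normD _ _))// mulrDl lerD ?fk ?gk.
- by move=> t t01; apply: ulimD; [exact: fF|exact: gG].
Qed.

Lemma ulimfM f g F G : ulimf f F -> ulimf g G ->
  ulimf (fun k t => f k t * g k t) (fun t => F t * G t).
Proof.
move=> [cf cF [B B0 fB] [C C0 fC] fF] [cg cG [B' B'0 gB] [C' C'0 gC] gG]; split.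
- by move=> k; apply: contM.
- exact: contM.
- exists (B * B'); rewrite ?mulr_ge0//; apply: filterS2 fB gB => k fk gk t t01.
  by rewrite normrM ler_pM ?fk ?gk.
- exists (B * C' + C * B'); rewrite ?addr_ge0 ?mulr_ge0//.
  apply: (filterS2 _ _ (filterI fB fC) (filterI gB gC)) => k [fk fk'] [gk gk'] s t s01 t01.
  have -> : f k s * g k s - f k t * g k t =
    f k s * (g k s - g k t) + (f k s - f k t) * g k t by ring.
  rewrite (le_trans (ler_normD _ _))// !normrM mulrDl lerD//.
    by rewrite -mulrA ler_pM ?fk ?gk'.
  by rewrite mulrAC ler_pM ?gk ?fk'.
- by move=> t t01; apply: ulimM; [exact: fF|exact: gG].
Qed.

Lemma ulimf_seq u (a : R) : u k @[k --> U] --> a -> ulimf (fun k _ => u k) (fun=> a).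
Proof.
move=> ua; have [B B0 uB] := ulim_bounded ua; split.
- by move=> k; conts.
- by conts.
- by exists B => //; apply: filterS uB.
- by exists 0 => //; apply: filterE => k s t _ _; rewrite subrr normr0 mul0r.
- by [].
Qed.

Lemma ulimf_cst (a : R) : ulimf (fun _ _ => a) (fun=> a).
Proof. by apply: (@ulimf_seq (fun=> a)); exact: ulim_cst. Qed.

Lemma ulimf_id : ulimf (fun _ t => t) (fun t => t).
Proof.
split.
- by move=> k; conts.
- by conts.
- by exists 1 => //; apply: filterE => k t; rewrite in_itv/= => /andP[? ?]; rewrite ger0_norm.
- by exists 1 => //; apply: filterE => k s t _ _; rewrite mul1r.
- by move=> t _; exact: ulim_cst.
Qed.

Lemma ulimfN f F : ulimf f F -> ulimf (fun k t => - f k t) (fun t => - F t).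
Proof.
move=> /(ulimfM (ulimf_cst (-1))) [c1 c2 b l h]; split.
- by move=> k; have := c1 k; under eq_fun do rewrite mulN1r.
- by have := c2; under eq_fun do rewrite mulN1r.
- by case: b => B B0 Bb; exists B => //; apply: filterS Bb => k bk t /bk; rewrite mulN1r.
- case: l => B B0 Bl; exists B => //; apply: filterS Bl => k bk s t s01 /(bk s t s01).
  by rewrite !mulN1r.
- move=> t /h; rewrite mulN1r; apply: cvg_trans.
  by apply: near_eq_cvg; apply: filterE => k; rewrite mulN1r.
Qed.

Lemma ulimf_lip1 (H : R -> R) f F : continuous H ->
  (forall a b, `|H a - H b| <= `|a - b|) -> ulimf f F ->
  ulimf (fun k t => H (f k t)) (fun t => H (F t)).
Proof.
move=> cH lH [cf cF [B B0 fB] [C C0 fC] fF]; split.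
- by move=> k; apply: cont_comp.
- exact: cont_comp.
- exists (`|H 0| + B); rewrite ?addr_ge0//; apply: filterS fB => k fk t t01.
  have -> : H (f k t) = H 0 + (H (f k t) - H 0) by ring.
  rewrite (le_trans (ler_normD _ _))// lerD2l (le_trans (lH _ _))// subr0.
  exact: fk.
- exists C => //; apply: filterS fC => k fk s t s01 t01.
  by rewrite (le_trans (lH _ _))// fk.
- by move=> t t01; apply: ulim_comp => //; exact: fF.
Qed.

Lemma ulimf_cos f F : ulimf f F -> ulimf (fun k t => cos (f k t)) (fun t => cos (F t)).
Proof. by apply: ulimf_lip1; [exact: continuous_cos|exact: cos_lip]. Qed.
Lemma ulimf_sin f F : ulimf f F -> ulimf (fun k t => sin (f k t)) (fun t => sin (F t)).
Proof. by apply: ulimf_lip1; [exact: continuous_sin|exact: sin_lip]. Qed.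
Lemma ulimf_norm f F : ulimf f F -> ulimf (fun k t => `|f k t|) (fun t => `|F t|).
Proof.
apply: ulimf_lip1; last by move=> a b; exact: ler_dist_dist.
by move=> t; apply: cvg_norm; exact: cvg_id.
Qed.

Lemma ulimfX f F n : ulimf f F -> ulimf (fun k t => f k t ^+ n.+1) (fun t => F t ^+ n.+1).
Proof.
move=> fF; elim: n => [//|n IH].
by under eq_fun do under eq_fun do rewrite exprS; under [X in ulimf _ X]eq_fun do rewrite exprS;
  exact: ulimfM.
Qed.

(** No convergence theorem for integrals is invoked: the limit of the primitives and [prim F] both
    satisfy the expansion of [prim_quad] with the same slope [F s], so their difference is constant
    by [quad_const]. *)
Lemma ulimf_prim f F : ulimf f F -> ulimf (fun k => prim (f k)) (prim F).
Proof.
move=> [cf cF [B B0 fB] [C C0 fC] fF].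
have pB : \forall k \near U, forall t : R, t \in `[0, 1] -> `|prim (f k) t| <= B.
  apply: filterS fB => k fk t; rewrite in_itv/= => /andP[t0 t1].
  apply: (@le_trans _ _ (B * t)); last by rewrite ler_piMr.
  apply: prim_bound => // s; rewrite in_itv/= => /andP[s0 st]; apply: fk.
  by rewrite in_itv/= (ltW s0) (le_trans (ltW st)).
split.
- by move=> k; exact: prim_cont.
- exact: prim_cont.
- by exists B.
- exists B => //; apply: filterS fB => k fk s t.
  wlog st : s t / s <= t => [H s01 t01|].
    by have [st|/ltW ts] := leP s t; [exact: H|rewrite distrC (distrC s); exact: H].
  rewrite !in_itv/= => /andP[s0 s1] /andP[t0 t1].
  rewrite distrC (distrC s) (ger0_norm (_ : 0 <= t - s)) ?subr_ge0//.
  apply: (lip_of_deriv (S := [::])) => //; first exact: prim_cont.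
  move=> r; rewrite in_itv/= => /andP[sr rt] _; exists (f k r); first exact: prim_deriv.
  by apply: fk; rewrite in_itv/= (le_trans s0 (ltW sr)) (le_trans (ltW rt)).
have /choice[h hP] (t : R) : exists l : R, t \in `[0, 1] -> prim (f k) t @[k --> U] --> l.
  have [t01|t01] := boolP (t \in `[0, 1]); last by exists 0.
  have [l ul] : exists l : R, (fun k => prim (f k) t) k @[k --> U] --> l.
    by apply: (ultra_bounded_cvg (B := B)); apply: filterS pB => k; exact.
  by exists l.
have LF s t : s \in `[0, 1] -> t \in `[0, 1] -> `|F s - F t| <= C * `|s - t|.
  move=> s01 t01.
  have := ulimD (fF s s01) (ulimN (fF t t01)).
  move=> /ulim_norm /ulim_le; apply.
    exact: ulim_cst.
  by apply: filterS fC => k; apply.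
have hF t : t \in `[0, 1] -> h t - prim F t = h 0 - prim F 0.
  apply: (@quad_const (fun t => h t - prim F t) (C + C)) => {}s {}t s01 t01.
  have -> : h t - prim F t - (h s - prim F s) =
     (h t - h s - (t - s) * F s) - (prim F t - prim F s - (t - s) * F s) by ring.
  rewrite (le_trans (ler_normB _ _))// [leRHS]mulrDl lerD//; last exact: prim_quad.
  have := ulimD (ulimD (hP t t01) (ulimN (hP s s01)))
    (ulimN (ulimM (@ulim_cst (t - s)) (fF s s01))).
  move=> /ulim_norm /ulim_le; apply.
    exact: ulim_cst.
  apply: filterS fC => k fk; exact: prim_quad.
move=> t t01.
have I0 : 0 \in `[0, 1 : R] by rewrite in_itv/= lexx ler01.
have h0 : h 0 = 0.
  apply: (ulim_uniq (hP 0 I0)).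
  apply: cvg_trans (@ulim_cst 0); apply: near_eq_cvg; apply: filterE => k.
  by rewrite prim0.
have := hF t t01; rewrite h0 prim0// subr0 => /eqP; rewrite subr_eq0 => /eqP <-.
exact: hP.
Qed.

End UltraLimits.

Ltac ulim_step :=
  lazymatch goal with
  | |- ulimf _ (fun k s => _ + _) _ => apply: ulimfD
  | |- ulimf _ (fun k s => - _) _ => apply: ulimfN
  | |- ulimf _ (fun k s => _ * _) _ => apply: ulimfM
  | |- ulimf _ (fun k s => _ ^+ _) _ => apply: ulimfX
  | |- ulimf _ (fun k s => cos _) _ => apply: ulimf_cos
  | |- ulimf _ (fun k s => sin _) _ => apply: ulimf_sin
  | |- ulimf _ (fun k s => `| _ |) _ => apply: ulimf_norm
  | |- ulimf _ (fun k => prim _) _ => apply: ulimf_prim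
  | |- ulimf _ (fun k s => prim _ s) _ => apply: ulimf_prim
  | |- ulimf _ (fun k s => s) _ => apply: ulimf_id
  | |- ulimf _ (fun k s => ?c) _ => first [apply: ulimf_cst | apply: ulimf_seq; solve [eauto]]
  | |- ulimf _ _ _ => solve [eauto]
  end.
Ltac ulims := repeat ulim_step.

(** * Limits of minimizing sequences *)

Section ControlledCurves.
Context {R : realType}.
Variables (xi m alpha beta D1 D2 : R).
Implicit Types (th w Q u x y E W V f g : R -> R) (S : seq R) (p q B d e : R).

(* Q and E are the angular and spatial energies up to time t. *)
Definition controlled th w Q u x y E S := [/\ angle_curve alpha beta th w Q S,
  [/\ continuous x, continuous y & continuous E],
  x 1 - x 0 = D1 /\ y 1 - y 0 = D2 &
  forall t, t \in `]0, 1[ -> t \notin S -> [/\ deriv1 x t (u t * cos (th t)),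
    deriv1 y t (u t * sin (th t)) & deriv1 E t (u t ^+ 2)]].

(** Young's inequality 2 u pn <= e u^2 + pn^2 / e, integrated. The free weight e is exploited when
    the integral of pn^2 tends to 0. *)
Lemma controlled_cauchy th w Q u x y E S p q e : controlled th w Q u x y E S -> 0 < e ->
  2 * (p * D1 + q * D2) <= e * (E 1 - E 0) + prim (fun t => pn p q (th t) ^+ 2) 1 / e.
Proof.
move=> [[ct _ _ _ _] [cx cy cE] [<- <-] H] e0.
have cp : continuous (fun t => pn p q (th t) ^+ 2) by apply: contX; exact: cont_pn.
pose P t := e * E t + e^-1 * prim (fun t => pn p q (th t) ^+ 2) t.
have := @le_deriv_le R (fun t => 2 * (p * x t + q * y t)) P S 0 1 ler01.
have -> : P 1 - P 0 = e * (E 1 - E 0) + prim (fun t => pn p q (th t) ^+ 2) 1 / e.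
  by rewrite /P prim0//; ring.
have -> : 2 * (p * x 1 + q * y 1) - 2 * (p * x 0 + q * y 0) =
  2 * (p * (x 1 - x 0) + q * (y 1 - y 0)) by ring.
apply.
- by conts.
- by rewrite /P; conts; exact: prim_cont.
move=> t t01 tS; have [dx dy dE] := H t t01 tS; have ? := prim_deriv t cp.
exists (2 * (u t * pn p q (th t))), (e * u t ^+ 2 + e^-1 * pn p q (th t) ^+ 2); split.
- by rewrite /pn; derivs; ring.
- by rewrite /P; derivs; ring.
have en : e != 0 by rewrite gt_eqF.
rewrite -subr_ge0 (_ : _ - _ = e^-1 * (e * u t - pn p q (th t)) ^+ 2); last by field.
by rewrite mulr_ge0 ?invr_ge0 ?sqr_ge0// ltW.
Qed.

Lemma moment_energy th p q : continuous th -> moment_eq D1 D2 th p q ->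
  prim (fun t => pn p q (th t) ^+ 2) 1 = p * D1 + q * D2.
Proof. by move=> ct [<- <-]; rewrite pn_prim//; ring. Qed.

(** The right-hand side is the integral of (u - pn)^2: the cross term is -2 (p D1 + q D2) because
    the displacement is (D1, D2), and pn^2 has integral p D1 + q D2. A continuous minorant [f] is
    used because u may jump. *)
Lemma control_gap th w Q u x y E S p q f : controlled th w Q u x y E S ->
  moment_eq D1 D2 th p q -> continuous f ->
  (forall t, t \in `]0, 1[ -> t \notin S -> f t <= (u t - pn p q (th t)) ^+ 2) ->
  prim f 1 <= E 1 - E 0 - (p * D1 + q * D2).
Proof.
move=> [[ct _ _ _ _] [cx cy cE] [e1 e2] H] me cf uf.
have cp : continuous (fun t => pn p q (th t) ^+ 2) by apply: contX; exact: cont_pn.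
pose P t := E t - 2 * (p * x t + q * y t) + prim (fun t => pn p q (th t) ^+ 2) t.
have := @le_deriv_le R (prim f) P S 0 1 ler01.
have -> : P 1 - P 0 = E 1 - E 0 - (p * D1 + q * D2).
  by rewrite /P prim0// moment_energy// -e1 -e2; ring.
rewrite prim0// subr0; apply; first exact: prim_cont.
  by rewrite /P; conts; exact: prim_cont.
move=> t t01 tS; have [dx dy dE] := H t t01 tS; have ? := prim_deriv t cp.
exists (f t), ((u t - pn p q (th t)) ^+ 2); split; [exact: prim_deriv| |exact: uf].
by rewrite /P; derivs; rewrite /pn; ring.
Qed.

Lemma control_gap_ge0 th w Q u x y E S p q : controlled th w Q u x y E S ->
  moment_eq D1 D2 th p q -> p * D1 + q * D2 <= E 1 - E 0.
Proof.
move=> Hc me; have := @control_gap th w Q u x y E S p q (fun=> 0) Hc me.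
rewrite prim_cst// mul0r subr_ge0; apply; first by conts.
by move=> *; exact: sqr_ge0.
Qed.

(** The difference k of [th] and [shot] vanishes at 0, and the gap energy integrates k'^2. In place
    of Cauchy-Schwarz, 2 c k' <= k'^2 + c^2 is integrated with the constant c = k t. *)
Lemma gap_energy_ge th w Q S p q t : angle_curve alpha beta th w Q S -> t \in `[0, 1] ->
  (th t - shot xi p q th t) ^+ 2 <= gap_energy xi p q th Q 1 - gap_energy xi p q th Q 0.
Proof.
move=> [ct pt _ cQ H]; rewrite in_itv/= => /andP[t0 t1].
set K := gap_energy xi p q th Q; pose k t := th t - shot xi p q th t.
have cK : continuous K by exact: cont_gap_energy.
have ck : continuous k by rewrite /k; conts; exact: cont_shot.
have dK s : s \in `]0, 1[ -> s \notin S ->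
    deriv1 K s ((w s - shotv xi p q th s) ^+ 2) /\ deriv1 k s (w s - shotv xi p q th s).
  move=> s01 sS; have [dt dQ] := H s s01 sS; have dW := @deriv1_shot R xi p q th s ct.
  by split; [exact: deriv1_gap_energy|rewrite /k; derivs].
have K01 : K t - K 0 <= K 1 - K 0.
  rewrite lerD2r; apply: (le_of_deriv_ge0 (S := S)) => // s.
  rewrite in_itv/= => /andP[ts s1] sS; exists ((w s - shotv xi p q th s) ^+ 2).
    by apply: (dK s _ sS).1; rewrite in_itv/= s1 (le_lt_trans t0).
  exact: sqr_ge0.
apply: le_trans K01; rewrite -/(k t).
have k0 : k 0 = 0 by rewrite /k shot0// subrr.
have H2 : 2 * k t ^+ 2 <= K t + k t ^+ 2 * t - (K 0 + k t ^+ 2 * 0) -> k t ^+ 2 <= K t - K 0.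
  have : k t ^+ 2 * t <= k t ^+ 2 by rewrite ler_piMr ?sqr_ge0.
  rewrite mulr0; lra.
apply: H2.
have := @le_deriv_le R (fun s => 2 * k t * k s) (fun s => K s + k t ^+ 2 * s) S 0 t t0.
rewrite (_ : 2 * k t * k t - 2 * k t * k 0 = 2 * k t ^+ 2); last by rewrite k0; ring.
apply; [by conts|by conts|] => s; rewrite in_itv/= => /andP[s0 st] sS.
have [|d1 d2] := dK s _ sS; first by rewrite in_itv/= s0 (lt_le_trans st).
exists (2 * k t * (w s - shotv xi p q th s)), ((w s - shotv xi p q th s) ^+ 2 + k t ^+ 2).
split; [by derivs; ring|by derivs; ring|].
have := sqr_ge0 (w s - shotv xi p q th s - k t); rewrite sqrrB; lra.
Qed.

Lemma eq0_closed_itv f (a b : R) : a < b -> continuous f ->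
  (forall t, t \in `]a, b[ -> f t = 0) -> forall t, t \in `[a, b] -> f t = 0.
Proof.
move=> ab cf f0.
have d0 t : t \in `]a, b[ -> deriv1 f t 0.
  move=> tab; apply: (@deriv1_itv R (fun=> 0) f a b) => //; last exact: deriv1_cst.
  by move=> s /f0.
have E t : t \in `[a, b] -> f a = f t.
  rewrite in_itv/= => /andP[at0 tb]; apply: (eq_of_deriv0 (S := [::])) => // s.
  by rewrite in_itv/= => /andP[s0 st] _; apply: d0; rewrite in_itv/= s0 (lt_le_trans st).
have hab : (a + b) / 2 \in `]a, b[ by rewrite in_itv/=; apply/andP; split; lra.
by move=> t /E <-; rewrite (E ((a + b) / 2)) ?f0//; exact: subset_itv_oo_cc.
Qed.

(** By the intermediate value theorem, a nonzero value of |f| would make sin vanish at a point of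
    ]0, 1]. *)
Lemma sin_eq0_const f : continuous f -> f 0 = 0 ->
  (forall t, t \in `[0, 1] -> sin (f t) = 0) -> forall t, t \in `[0, 1] -> f t = 0.
Proof.
move=> cf f0 sf t; rewrite in_itv/= => /andP[t0 t1]; apply/eqP; apply: contraT => ft0.
pose v := Num.min `|f t| 1.
have v0 : 0 < v by rewrite /v lt_min ltr01 normr_gt0 ft0.
have [||c c0t fc] := @IVT R (fun s => `|f s|) 0 t v t0.
- by apply: continuous_subspaceT; exact: cont_norm.
- rewrite f0 normr0 (min_idPl _)// (max_idPr _)// (ltW v0)/= /v ge_min lexx//.
have : sin v = 0.
  have := sf c; rewrite in_itv/=; move: c0t; rewrite in_itv/= => /andP[-> ct].
  rewrite (le_trans ct)// => /(_ isT) sc; rewrite -fc.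
  by have [h|h] := leP 0 (f c); rewrite ?(ger0_norm h) ?(ltr0_norm h) ?sinN sc ?oppr0.
have : 0 < sin v.
  by apply: sin2_gt0; rewrite v0/= gt_min (_ : 1 < 2) ?orbT// ltr1n.
by move=> + s0; rewrite s0 ltxx.
Qed.

End ControlledCurves.

Section Extremals.
Context {R : realType}.
Variables (xi m alpha beta D1 D2 : R).
Implicit Types (th w Q u x y E W V f g : R -> R) (S : seq R) (p q B d e : R).

(** The energy bound is an inequality because it comes from a limit; [extremal_geodesic] recovers
    equality from the minimality of m. *)
Definition extremal th V p q := [/\ forall t, deriv1 th t (V t), continuous V,
  forall t, t \in `[0, 1] -> deriv1 V t (- (xi ^+ 2 * force p q th t)),
  moment_eq D1 D2 th p q /\ (sin (th 0 - alpha) = 0 /\ sin (th 1 - beta) = 0) &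
  prim (fun t => V t ^+ 2) 1 + xi ^+ 2 * (p * D1 + q * D2) <= m ^+ 2].

(** For v in the kernel of the matrix, the square of [pn v1 v2] has integral 0, so the orientation
    stays orthogonal to v. *)
Lemma moment_singular th : continuous th -> Ma th * Mc th - Mb th ^+ 2 = 0 ->
  exists v1 v2 : R, [/\ (v1 != 0) || (v2 != 0),
    v1 ^+ 2 * Ma th + 2 * (v1 * v2) * Mb th + v2 ^+ 2 * Mc th = 0 &
    forall t, t \in `[0, 1] -> pn v1 v2 (th t) = 0].
Proof.
move=> cth det0.
have [v1 [v2 [vn vM]]] : exists v1 v2 : R, (v1 != 0) || (v2 != 0) /\
    v1 ^+ 2 * Ma th + 2 * (v1 * v2) * Mb th + v2 ^+ 2 * Mc th = 0.
  have [a0|a0] := eqVneq (Ma th) 0.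
    exists 1, 0; rewrite oner_neq0 a0; split => //; ring.
  (* The quadratic form takes at this vector the value Ma times the determinant. *)
  exists (- Mb th), (Ma th); rewrite a0 orbT; split => //.
  rewrite -[RHS](mulr0 (Ma th)) -det0; ring.
have cv : continuous (fun t => pn v1 v2 (th t)) by exact: cont_pn.
exists v1, v2; split => //; apply: (eq0_closed_itv ltr01 cv) => t t01.
apply/eqP; rewrite -sqrf_eq0; apply/eqP.
apply: (prim_eq0 (f := fun t => pn v1 v2 (th t) ^+ 2)) => //; first exact: contX.
  by move=> s _; exact: sqr_ge0.
by rewrite pn_prim.
Qed.

Lemma pn_zero_sin v1 v2 (a b : R) : (v1 != 0) || (v2 != 0) ->
  pn v1 v2 a = 0 -> pn v1 v2 b = 0 -> sin (a - b) = 0.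
Proof.
rewrite /pn sinB => vn a0 b0.
have h1 : v1 * (sin a * cos b - cos a * sin b) = 0.
  transitivity (sin a * (v1 * cos b + v2 * sin b) - sin b * (v1 * cos a + v2 * sin a)).
    by ring.
  by rewrite a0 b0; ring.
have h2 : v2 * (sin a * cos b - cos a * sin b) = 0.
  transitivity (cos b * (v1 * cos a + v2 * sin a) - cos a * (v1 * cos b + v2 * sin b)).
    by ring.
  by rewrite a0 b0; ring.
move: h1 h2 => /eqP + /eqP; rewrite !mulf_eq0 => /orP[/eqP v10|/eqP//] /orP[/eqP v20|/eqP//].
by move: vn; rewrite v10 v20 eqxx.
Qed.

Variables (U : set_system nat) (th w Q u x y E : nat -> R -> R) (S : nat -> seq R).
Variables (delta : nat -> R) (theta : R -> R).
Hypothesis UU : UltraFilter U.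
Hypothesis xi0 : 0 < xi.
Hypothesis LB : energy_lower_bound xi m alpha beta D1 D2.
Hypothesis Hc : forall k,
  controlled alpha beta D1 D2 (th k) (w k) (Q k) (u k) (x k) (y k) (E k) (S k).
Hypothesis HE : forall k,
  Q k 1 - Q k 0 + xi ^+ 2 * (E k 1 - E k 0) <= m ^+ 2 + delta k.
Hypothesis Hd : delta k @[k --> U] --> (0 : R).
Hypothesis Ht : ulimf U th theta.

Let ct k : continuous (th k). Proof. by have [[]] := Hc k. Qed.
Let cth : continuous theta. Proof. by case: Ht. Qed.
Let I0 : 0 \in `[0, 1 : R]. Proof. by rewrite in_itv/= lexx ler01. Qed.
Let I1 : 1 \in `[0, 1 : R]. Proof. by rewrite in_itv/= lexx ler01. Qed.

Let ulimf1 (f : nat -> R -> R) F : ulimf U f F -> f k 1 @[k --> U] --> F 1.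
Proof. by case=> _ _ _ _; apply. Qed.
Let ulimf0 (f : nat -> R -> R) F : ulimf U f F -> f k 0 @[k --> U] --> F 0.
Proof. by case=> _ _ _ _; apply. Qed.

Let endpoints : sin (theta 0 - alpha) = 0 /\ sin (theta 1 - beta) = 0.
Proof.
split.
  have h : ulimf U (fun k t => sin (th k t + - alpha)) (fun t => sin (theta t + - alpha)).
    by ulims.
  apply: (ulim_uniq _ (ulimf0 h)); apply: cvg_trans (@ulim_cst _ U _ 0).
  by apply: near_eq_cvg; apply: filterE => k; have [[_ _ [-> _] _ _]] := Hc k.
have h : ulimf U (fun k t => sin (th k t + - beta)) (fun t => sin (theta t + - beta)).
  by ulims.
apply: (ulim_uniq _ (ulimf1 h)); apply: cvg_trans (@ulim_cst _ U _ 0).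
by apply: near_eq_cvg; apply: filterE => k; have [[_ _ [_ ->] _ _]] := Hc k.
Qed.

Let Q_ge0 k : 0 <= Q k 1 - Q k 0.
Proof.
have [[_ _ _ cQ H] _ _ _] := Hc k; rewrite subr_ge0.
apply: (le_of_deriv_ge0 (S := S k)) => // t t01 tS; exists (w k t ^+ 2); last exact: sqr_ge0.
by have [] := H t t01 tS.
Qed.

Let E_le k : xi ^+ 2 * (E k 1 - E k 0) <= m ^+ 2 + delta k.
Proof. by have := HE k; have := Q_ge0 k; lra. Qed.

(** The limit orientation is constant, and the displacement must be parallel to it: otherwise
    orientations nearly orthogonal to some part of the displacement would need unbounded energy. The
    extremal is a straight segment with constant control [lam]. *)
Lemma extremal_singular : Ma theta * Mc theta - Mb theta ^+ 2 = 0 ->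
  exists p q, extremal (fun=> theta 0) (fun=> 0) p q /\
    forall t, t \in `[0, 1] -> theta t = theta 0.
Proof.
move=> det0.
have [v1 [v2 [vn vM pn0]]] := moment_singular cth det0.
have hlim : prim (fun t => pn v1 v2 (th k t) ^+ 2) 1 @[k --> U] --> (0 : R).
  have -> : 0 = prim (fun t => pn v1 v2 (theta t) ^+ 2) 1 by rewrite pn_prim.
  have h : ulimf U (fun k => prim (fun t => pn v1 v2 (th k t) ^+ 2))
    (prim (fun t => pn v1 v2 (theta t) ^+ 2)) by rewrite /pn; ulims.
  exact: (ulimf1 h).
have xi2 : 0 < xi ^+ 2 by rewrite exprn_gt0.
(* The moment integral tends to 0, so the last term of [controlled_cauchy] disappears in the limit
   for each fixed e. Letting e tend to 0, for v and for - v, gives v . D = 0. *)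
have key s1 s2 e : (forall k, prim (fun t => pn s1 s2 (th k t) ^+ 2) 1 =
    prim (fun t => pn v1 v2 (th k t) ^+ 2) 1) -> 0 < e ->
    2 * (s1 * D1 + s2 * D2) <= e * (m ^+ 2 / xi ^+ 2).
  move=> sv e0; rewrite -[leRHS]addr0.
  have -> : e * (m ^+ 2 / xi ^+ 2) + 0 = e * ((m ^+ 2 + 0) / xi ^+ 2) + 0 * e^-1 by ring.
  apply: (ulim_le _ (@ulim_cst _ U _ _)).
    apply: ulimD; last by apply: ulimM; [exact: hlim|exact: ulim_cst].
    apply: ulimM; first exact: ulim_cst.
    apply: ulimM; last exact: ulim_cst.
    by apply: ulimD; [exact: ulim_cst|exact: Hd].
  apply: filterE => k; have := controlled_cauchy s1 s2 (Hc k) e0; rewrite sv => /le_trans; apply.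
  by rewrite lerD2r ler_pM2l// ler_pdivlMr// mulrC.
have vD : v1 * D1 + v2 * D2 = 0.
  have sgn s1 s2 : (forall k, prim (fun t => pn s1 s2 (th k t) ^+ 2) 1 =
      prim (fun t => pn v1 v2 (th k t) ^+ 2) 1) -> s1 * D1 + s2 * D2 <= 0.
    move=> sv; rewrite leNgt; apply/negP => z0; set z := _ + _ in z0.
    have X0 : 0 <= m ^+ 2 / xi ^+ 2 by rewrite divr_ge0 ?sqr_ge0.
    have := key s1 s2 (z / (m ^+ 2 / xi ^+ 2 + 1)) sv.
    rewrite -/z; move: (m ^+ 2 / xi ^+ 2) X0 => X X0.
    have X1 : 0 < X + 1 by lra.
    move=> /(_ (divr_gt0 z0 X1)); rewrite mulrAC ler_pdivlMr//.
    by have := mulr_ge0 (ltW z0) X0; lra.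
  apply/eqP; rewrite eq_le sgn//= -oppr_le0 opprD -!mulNr sgn// => k.
  apply: eq_prim => //; try exact/contX/cont_pn.
  by move=> t _; rewrite /pn; ring.
set c := cos (theta 0); set s := sin (theta 0).
have n0 : v1 * c + v2 * s = 0 by exact: pn0.
have vkill z : v1 * z = 0 -> v2 * z = 0 -> z = 0.
  move=> /eqP + /eqP; rewrite !mulf_eq0 => /orP[/eqP v10|/eqP//] /orP[/eqP v20|/eqP//].
  by move: vn; rewrite v10 v20 eqxx.
have Dn : D1 * s - D2 * c = 0.
  apply: vkill.
    have -> : v1 * (D1 * s - D2 * c) = (v1 * D1 + v2 * D2) * s - D2 * (v1 * c + v2 * s) by ring.
    by rewrite vD n0; ring.
  have -> : v2 * (D1 * s - D2 * c) = D1 * (v1 * c + v2 * s) - (v1 * D1 + v2 * D2) * c by ring.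
  by rewrite vD n0; ring.
have cs : c ^+ 2 + s ^+ 2 = 1 by exact: cos2Dsin2.
pose lam := D1 * c + D2 * s.
have E1 : D1 = lam * c.
  rewrite -[LHS]mulr1 -cs (_ : _ * _ = lam * c + s * (D1 * s - D2 * c)); last by rewrite /lam; ring.
  by rewrite Dn mulr0 addr0.
have E2 : D2 = lam * s.
  rewrite -[LHS]mulr1 -cs (_ : _ * _ = lam * s - c * (D1 * s - D2 * c)); last by rewrite /lam; ring.
  by rewrite Dn mulr0 subr0.
have thc t : t \in `[0, 1] -> theta t = theta 0.
  move=> t01; apply/eqP; rewrite -subr_eq0; apply/eqP; move: t t01.
  apply: (@sin_eq0_const _ (fun t => theta t - theta 0)); [by conts|by rewrite subrr|].
  by move=> t /pn0 nt; exact: pn_zero_sin vn nt (pn0 0 I0).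
exists (lam * c), (lam * s); split; last exact: thc.
have MM : [/\ Ma (fun=> theta 0) = c ^+ 2, Mb (fun=> theta 0) = c * s &
    Mc (fun=> theta 0) = s ^+ 2].
  by rewrite /Ma /Mb /Mc !prim_cst// !mulr1.
split.
- by move=> t; exact: deriv1_cst.
- by conts.
- move=> t _; apply: (deriv1_eq (deriv1_cst 0 t)).
  by rewrite /force /pn /pq -/c -/s; ring.
- split; last by rewrite -{2}(thc 1).
  rewrite /moment_eq; case: MM => -> -> ->; split.
    by rewrite [RHS]E1 -[RHS]mulr1 -[in RHS]cs; ring.
  by rewrite [RHS]E2 -[RHS]mulr1 -[in RHS]cs; ring.
- rewrite (_ : (fun t => _) = fun=> 0); last by apply/funext => t; rewrite expr0n.
  rewrite prim_cst// mul0r add0r.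
  have -> : lam * c * D1 + lam * s * D2 = lam ^+ 2 by rewrite /lam; ring.
  rewrite -[leRHS]addr0.
  apply: (ulim_le _ (@ulim_cst _ U _ _) (ulimD _ (@ulim_cst _ U _ _) Hd)).
  apply: filterE => k; apply: le_trans (E_le k); rewrite ler_pM2l//.
  have := controlled_cauchy (lam * c) (lam * s) (Hc k) ltr01.
  have -> : lam * c * D1 + lam * s * D2 = lam ^+ 2 by rewrite /lam; ring.
  have : prim (fun t => pn (lam * c) (lam * s) (th k t) ^+ 2) 1 <= prim (fun=> lam ^+ 2) 1.
    apply: prim_le => //; [exact/contX/cont_pn|by conts|] => t _.
    have -> : pn (lam * c) (lam * s) (th k t) = lam * cos (th k t - theta 0).
      by rewrite /pn cosB -/c -/s; ring.
    have c1 : cos (th k t - theta 0) ^+ 2 <= 1.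
      by rewrite -[leRHS](cos2Dsin2 (th k t - theta 0)) lerDl sqr_ge0.
    by rewrite exprMn ler_piMr ?sqr_ge0.
  by rewrite prim_cst// divr1 !mulr1 mul1r; lra.
Qed.

(** Nearby matrices are invertible too, so Cramer's rule gives multipliers for [th k] that converge
    along [U]. Dividing [energy_gap] by e bounds the squared distance from [th k] to its [shot] by
    delta k / e + C e; first k, then e, goes to the limit. The extremal is stated for [shot], which
    is differentiable on the whole line. *)
Lemma extremal_regular : Ma theta * Mc theta - Mb theta ^+ 2 != 0 ->
  exists V p q, [/\ extremal (shot xi p q theta) V p q,
    forall t, t \in `[0, 1] -> theta t = shot xi p q theta t &
    (forall k t, t \in `]0, 1[ -> t \notin S k -> 0 <= u k t) ->
    forall t, t \in `]0, 1[ -> 0 <= pn p q (theta t)].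
Proof.
move=> det0.
have det_gt0 : 0 < Ma theta * Mc theta - Mb theta ^+ 2.
  rewrite lt_def det0/=.
  (* The quadratic form at two rows of the adjugate, up to sign, gives Ma and Mc times the
     determinant; the trace is 1. *)
  have h1 : 0 <= prim (fun t => pn (- Mb theta) (Ma theta) (theta t) ^+ 2) 1.
    by apply: prim_ge0 => // [|s _]; [exact/contX/cont_pn|exact: sqr_ge0].
  have h2 : 0 <= prim (fun t => pn (Mc theta) (- Mb theta) (theta t) ^+ 2) 1.
    by apply: prim_ge0 => // [|s _]; [exact/contX/cont_pn|exact: sqr_ge0].
  rewrite !pn_prim// in h1 h2.
  rewrite -[leRHS]mul1r -(Ma_Mc cth); apply: le_trans (addr_ge0 h1 h2) _.
  by rewrite le_eqVlt; apply/orP; left; apply/eqP; ring.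
have aL : Ma (th k) @[k --> U] --> Ma theta.
  have h : ulimf U (fun k => prim (fun t => cos (th k t) ^+ 2))
    (prim (fun t => cos (theta t) ^+ 2)) by ulims.
  exact: (ulimf1 h).
have bL : Mb (th k) @[k --> U] --> Mb theta.
  have h : ulimf U (fun k => prim (fun t => cos (th k t) * sin (th k t)))
    (prim (fun t => cos (theta t) * sin (theta t))) by ulims.
  exact: (ulimf1 h).
have cL : Mc (th k) @[k --> U] --> Mc theta.
  have h : ulimf U (fun k => prim (fun t => sin (th k t) ^+ 2))
    (prim (fun t => sin (theta t) ^+ 2)) by ulims.
  exact: (ulimf1 h).
pose dt (f : R -> R) := Ma f * Mc f - Mb f * Mb f.
pose P (f : R -> R) := (D1 * Mc f - D2 * Mb f) * (dt f)^-1.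
pose T (f : R -> R) := (D2 * Ma f - D1 * Mb f) * (dt f)^-1.
have me (f : R -> R) : dt f != 0 -> moment_eq D1 D2 f (P f) (T f).
  by rewrite /moment_eq /P /T /dt => h; split; field.
have dn : dt theta != 0 by rewrite /dt -expr2.
have dL : dt (th k) @[k --> U] --> dt theta.
  by apply: ulimD; [exact: ulimM|apply: ulimN; exact: ulimM].
have lin (a b : R) (v v' : nat -> R) (l l' : R) : v k @[k --> U] --> l ->
    v' k @[k --> U] --> l' -> a * v k - b * v' k @[k --> U] --> a * l - b * l'.
  move=> vl vl'; apply: ulimD; first by apply: ulimM => //; exact: ulim_cst.
  by apply: ulimN; apply: ulimM => //; exact: ulim_cst.
have pL : P (th k) @[k --> U] --> P theta.
  by apply: ulimM; [exact: lin|exact: ulimV].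
have qL : T (th k) @[k --> U] --> T theta.
  by apply: ulimM; [exact: lin|exact: ulimV].
set p := P theta in pL *; set q := T theta in qL *.
have FL : ulimf U (fun k => force (P (th k)) (T (th k)) (th k)) (force p q theta).
  by rewrite /force /pn /pq; ulims.
have GL := ulimf_prim UU (ulimf_prim UU FL).
have sL : th k 1 - th k 0 + xi ^+ 2 * prim (prim (force (P (th k)) (T (th k)) (th k))) 1
    @[k --> U] --> theta 1 - theta 0 + xi ^+ 2 * prim (prim (force p q theta)) 1.
  apply: ulimD; last by apply: ulimM; [exact: ulim_cst|exact: (ulimf1 GL)].
  by apply: ulimD; [exact: (ulimf1 Ht)|apply: ulimN; exact: (ulimf0 Ht)].
pose W k := shot xi (P (th k)) (T (th k)) (th k).
pose V k := shotv xi (P (th k)) (T (th k)) (th k).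
have cx := ulimf_cst UU (xi ^+ 2).
have WL : ulimf U W (shot xi p q theta).
  apply: (ulimfD UU _ (ulimfN UU (ulimfM UU cx GL))).
  exact: (ulimfD UU (ulimf_seq UU (ulimf0 Ht)) (ulimfM UU (ulimf_seq UU sL) (ulimf_id UU))).
have VL : ulimf U V (shotv xi p q theta).
  exact: (ulimfD UU (ulimf_seq UU sL) (ulimfN UU (ulimfM UU cx (ulimf_prim UU FL)))).
have kL : ulimf U (fun k t => th k t - W k t) (fun t => theta t - shot xi p q theta t).
  exact: (ulimfD UU Ht (ulimfN UU WL)).
have [_ _ [Bk Bk0 kB] _ kcvg] := kL.
have [Bp Bp0 pB] := ulim_bounded UU pL; have [Bq Bq0 qB] := ulim_bounded UU qL.
set d := (dt theta) / 2.
have dt0 : 0 < dt theta by rewrite /dt -expr2.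
have d0 : 0 < d by rewrite divr_gt0.
have dB : \forall k \near U, d <= dt (th k).
  by apply: (cvgr_ge _ dL); rewrite /d; lra.
pose B := 1 + Bp + Bq + Bk.
have B1 : 1 <= B by rewrite /B; lra.
have HU : \forall k \near U, moment_eq D1 D2 (th k) (P (th k)) (T (th k)).
  by apply: filterS dB => k dk; apply: me; rewrite gt_eqF// (lt_le_trans d0).
have gapU e : 0 < e -> e <= 1 -> 16 * B * e <= d -> \forall k \near U,
    forall t, t \in `[0, 1] -> e * (th k t - W k t) ^+ 2 <=
      delta k + xi ^+ 2 * B ^+ 4 * (4 + 128 / d) * e ^+ 2.
  move=> e0 e1 ed; 
  have h1 : \forall k \near U, d <= dt (th k) /\ moment_eq D1 D2 (th k) (P (th k)) (T (th k)).
    by apply: filterS2 dB HU.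
  have h2 : \forall k \near U, `|P (th k)| <= Bp /\ `|T (th k)| <= Bq.
    by apply: filterS2 pB qB.
  apply: filterS3 h1 h2 kB => k [dk mk] [pk qk] kk t t01.
  have [ac _ _ _] := Hc k.
  have := gap_energy_ge xi (P (th k)) (T (th k)) ac t01; rewrite -/(W k).
  move=> /(ler_wpM2l (ltW e0))/le_trans; apply.
  apply: (le_trans (energy_gap (B := B) (d := d) LB ac mk B1 _ _ _ d0 _ e0 e1 ed)).
  - by rewrite (le_trans pk)// /B; lra.
  - by rewrite (le_trans qk)// /B; lra.
  - by move=> s s01; rewrite (le_trans (kk s _))//; [exact: subset_itv_oo_cc|rewrite /B; lra].
  - by rewrite expr2.
  rewrite lerD2r lerBlDl; apply: le_trans (HE k); rewrite lerD2l ler_pM2l ?exprn_gt0//.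
  exact: control_gap_ge0 (Hc k) mk.
have thE t : t \in `[0, 1] -> theta t = shot xi p q theta t.
  move=> t01; apply/eqP; rewrite -subr_eq0 -sqrf_eq0; set g := _ ^+ 2.
  set C := xi ^+ 2 * B ^+ 4 * (4 + 128 / d) in gapU *.
  have gC e : 0 < e -> e <= 1 -> 16 * B * e <= d -> g <= C * e.
    move=> e0 e1 ed; rewrite -(ler_pM2l e0).
    have -> : e * (C * e) = 0 + C * e ^+ 2 by ring.
    apply: (ulim_le UU).
    - apply: ulimM; first exact: ulim_cst.
      by apply: (@ulim_comp _ _ UU (fun z => z ^+ 2)); [by conts|exact: kcvg].
    - by apply: ulimD; [exact: Hd|exact: ulim_cst].
    - by apply: filterS (gapU e e0 e1 ed) => k; exact.
  have C0 : 0 <= C.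
    have h : 0 <= 128 / d by apply: divr_ge0; [exact: ler0n|exact: ltW].
    have B0 : 0 <= B by lra.
    by apply: mulr_ge0; [rewrite mulr_ge0 ?sqr_ge0 ?exprn_ge0|lra].
  rewrite eq_le sqr_ge0 andbT leNgt; apply/negP => g0; rewrite -/g in g0.
  (* Small enough for [gC] to apply and for C e <= g / 2, which contradicts g <= C e. *)
  pose e := Num.min 1 (Num.min (d / (16 * B)) (g / (2 * (C + 1)))).
  have BB : 0 < 16 * B by lra.
  have CC : 0 < 2 * (C + 1) by lra.
  have e0 : 0 < e by rewrite !lt_min ltr01 !divr_gt0.
  have e1 : e <= 1 by rewrite ge_min lexx.
  have ed : e <= d / (16 * B) by rewrite !ge_min lexx ?orbT.
  have eg : e <= g / (2 * (C + 1)) by rewrite !ge_min lexx ?orbT.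
  have := gC e e0 e1; rewrite mulrC -ler_pdivlMr// => /(_ ed) gCe.
  move: eg; rewrite ler_pdivlMr//.
  by have := mulr_ge0 C0 (ltW e0); lra.
have cS : continuous (shot xi p q theta) by exact: cont_shot.
have cV : continuous (shotv xi p q theta) by exact: cont_shotv.
have cF : continuous (force p q theta) by exact: cont_force.
have oc t : t \in `]0, 1[ -> t \in `[0, 1 : R] by exact: subset_itv_oo_cc.
exists (shotv xi p q theta), p, q; split; [|exact: thE|].
- split.
  + by move=> t; exact: deriv1_shot.
  + exact: cV.
  + by move=> t t01; have := @deriv1_shotv _ xi p q theta t cth; rewrite /force -thE.
  + split; last by rewrite shot0// shot1; exact: endpoints.
    have := me theta dn; rewrite -/p -/q /moment_eq => -[<- <-].
    have ME g : continuous g ->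
        prim (fun t => g (shot xi p q theta t)) 1 = prim (fun t => g (theta t)) 1.
      move=> cg; apply: eq_prim => //; try exact: cont_comp.
      by move=> t t01; rewrite thE//; exact: oc.
    have cc : continuous (@cos R) by exact: continuous_cos.
    have cs : continuous (@sin R) by exact: continuous_sin.
    rewrite /Ma /Mb /Mc (ME (fun a => cos a ^+ 2)) ?(ME (fun a => cos a * sin a)) 
      ?(ME (fun a => sin a ^+ 2))//; by conts.
  (* Nonnegativity of the gap energy makes this a lower bound of the energy free of the velocity of
     [th k], hence stable under limits. At [theta], integration by parts turns it into the energy of
     the extremal. *)
  + pose X (th' V' F' : R -> R) p' q' :=
      2 * (th' 1 * V' 1 - th' 0 * V' 0 + xi ^+ 2 * prim (fun t => th' t * F' t) 1)
      - prim (fun t => V' t ^+ 2) 1 + xi ^+ 2 * (p' * D1 + q' * D2).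
    have XL : X (th k) (V k) (force (P (th k)) (T (th k)) (th k)) (P (th k)) (T (th k))
        @[k --> U] --> X theta (shotv xi p q theta) (force p q theta) p q.
      have tF := ulimf_prim UU (ulimfM UU Ht FL).
      have vv := ulimf_prim UU (ulimfX UU 1 VL).
      apply: ulimD.
        apply: ulimD; last by apply: ulimN; exact: (ulimf1 vv).
        apply: ulimM; first exact: ulim_cst.
        apply: ulimD; last by apply: ulimM; [exact: ulim_cst|exact: (ulimf1 tF)].
        apply: ulimD; first by apply: ulimM; [exact: (ulimf1 Ht)|exact: (ulimf1 VL)].
        by apply: ulimN; apply: ulimM; [exact: (ulimf0 Ht)|exact: (ulimf0 VL)].
      apply: ulimM; first exact: ulim_cst.
      by apply: ulimD; apply: ulimM => //; exact: ulim_cst.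
    have Xle : X theta (shotv xi p q theta) (force p q theta) p q <= m ^+ 2.
      rewrite -[leRHS]addr0; apply: (ulim_le UU XL (ulimD UU (@ulim_cst _ U UU _) Hd)).
      apply: filterS HU => k mk; apply: le_trans (HE k).
      have [ac _ _ _] := Hc k.
      have := le_trans (sqr_ge0 _) (gap_energy_ge xi (P (th k)) (T (th k)) ac I0).
      have := ler_wpM2l (sqr_ge0 xi) (control_gap_ge0 (Hc k) mk).
      rewrite /gap_energy /X /V !prim0//; first lra.
        exact/contX/cont_shotv.
      by apply: contM => //; exact: cont_force.
    apply: le_trans Xle; rewrite lerD2r /X.
    suff -> : prim (fun t => shotv xi p q theta t ^+ 2) 1 =
        theta 1 * shotv xi p q theta 1 - theta 0 * shotv xi p q theta 0 +
        xi ^+ 2 * prim (fun t => theta t * force p q theta t) 1 by lra.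
    have cSF : continuous (fun t => shot xi p q theta t * force p q theta t) by conts.
    rewrite (@eq_prim _ (fun t => theta t * force p q theta t)
      (fun t => shot xi p q theta t * force p q theta t)) //; first last.
    * by move=> t /oc /thE <-.
    * by conts.
    pose G t := shot xi p q theta t * shotv xi p q theta t +
      xi ^+ 2 * prim (fun t => shot xi p q theta t * force p q theta t) t.
    have cG : continuous G by rewrite /G; conts; exact: prim_cont.
    have dG t : t \in `]0, 1[ -> t \notin [::] -> deriv1 G t (shotv xi p q theta t ^+ 2).
      move=> _ _; have d1 := @deriv1_shot _ xi p q theta t cth.
      have d2 := @deriv1_shotv _ xi p q theta t cth.
      by have d3 := prim_deriv t cSF; rewrite /G; derivs; ring.
    have cV2 : continuous (fun t => shotv xi p q theta t ^+ 2) by exact: contX.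
    by rewrite (primE cV2 cG ler01 dG) /G (prim0 cSF) (shot0 _ _ _ cth) shot1; ring.
- move=> u0 t t01.
  (* The squared negative part of [pn]. For u >= 0 it is at most (u - pn)^2, and xi^2 times its
     integral is at most delta k. *)
  pose f p' q' (th' : R -> R) t := 4^-1 * (`|pn p' q' (th' t)| - pn p' q' (th' t)) ^+ 2.
  have cf p' q' (th' : R -> R) : continuous th' -> continuous (f p' q' th').
    by move=> ct'; have cp := @cont_pn _ p' q' _ ct'; rewrite /f; conts.
  have fL : ulimf U (fun k => prim (f (P (th k)) (T (th k)) (th k))) (prim (f p q theta)).
    by rewrite /f /pn; ulims.
  have f0 : prim (f p q theta) 1 = 0.
    apply/eqP; rewrite eq_le; apply/andP; split; last first.
      apply: prim_ge0 => //; first exact: cf.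
      by move=> s _; rewrite /f mulr_ge0 ?sqr_ge0// invr_ge0.
    rewrite -(ler_pM2l (exprn_gt0 2 xi0)) mulr0.
    apply: (ulim_le UU (ulimM UU (@ulim_cst _ U UU _) (ulimf1 fL)) Hd).
    apply: filterS HU => k mk.
    have [ac _ _ _] := Hc k.
    have := LB ac mk; have := HE k.
    have : prim (f (P (th k)) (T (th k)) (th k)) 1 <=
        E k 1 - E k 0 - (P (th k) * D1 + T (th k) * D2).
      apply: (control_gap (Hc k) mk); first exact: cf.
      move=> s s01 sS; rewrite /f; have := u0 k s s01 sS.
      move: (u k s) (pn _ _ _) => a b a0; have [b0|b0] := lerP 0 b.
        by rewrite ger0_norm// subrr expr0n mulr0 sqr_ge0.
      rewrite ltr0_norm//.
      have := mulr_ge0 a0 (_ : 0 <= - b); rewrite oppr_ge0 => /(_ (ltW b0)).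
      have -> : 4^-1 * (- b - b) ^+ 2 = b ^+ 2 by field.
      by have := sqr_ge0 a; rewrite sqrrB; lra.
    move=> h1 h2 h3; have : xi ^+ 2 * prim (f (P (th k)) (T (th k)) (th k)) 1 <=
        xi ^+ 2 * (E k 1 - E k 0 - (P (th k) * D1 + T (th k) * D2)).
      by rewrite ler_wpM2l ?sqr_ge0.
    by rewrite mulrBr; lra.
  have fp s : s \in `]0, 1[ -> 0 <= f p q theta s.
    by move=> _; rewrite /f mulr_ge0 ?sqr_ge0// invr_ge0.
  have := prim_eq0 (cf p q theta cth) fp f0 t01; rewrite /f => /eqP.
  rewrite mulf_eq0 invr_eq0 pnatr_eq0/= sqrf_eq0 subr_eq0 => /eqP <-.
  exact: normr_ge0.
Qed.

End Extremals.

Lemma lipschitz_continuous {R : realType} (h : R -> R) B :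
  (forall s t, `|h s - h t| <= B * `|s - t|) -> continuous h.
Proof.
move=> lh t; apply/cvgrPdist_lt => e e0.
have B0 : 0 <= B.
  by have := le_trans (normr_ge0 _) (lh 0 1); rewrite sub0r normrN1 mulr1.
have B1 : 0 < B + 1 by lra.
have ee : 0 < e / (B + 1) by exact: divr_gt0.
have : \forall s \near t, `|t - s| < e / (B + 1) by exact: (nbhsx_ballx t _ ee).
apply: filterS => s ts; apply: le_lt_trans (lh t s) _.
apply: (@le_lt_trans _ _ ((B + 1) * `|t - s|)); first by rewrite mulrDl mul1r lerDl.
by rewrite mulrC -ltr_pdivlMr.
Qed.

Section MinimizingSequences.
Context {R : realType}.
Variables (xi m alpha beta D1 D2 : R).

(** The angles are equi-Lipschitz, so their limit along an ultrafilter finer than [\oo] is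
    Lipschitz; [clamp] extends it to the line. In the singular case the sign of [pn] is not
    examined: V = 0 excludes cusps by itself, whence the second alternative. *)
Lemma extremal_of_minimizing_sequence (th w Q u x y E : nat -> R -> R)
    (S : nat -> seq R) (delta : nat -> R) (B : R) :
  0 < xi -> energy_lower_bound xi m alpha beta D1 D2 ->
  (forall k, controlled alpha beta D1 D2 (th k) (w k) (Q k) (u k) (x k) (y k) (E k) (S k)) ->
  (forall k, Q k 1 - Q k 0 + xi ^+ 2 * (E k 1 - E k 0) <= m ^+ 2 + delta k) ->
  delta k @[k --> \oo] --> (0 : R) ->
  (forall k, `|th k 0| <= B) ->
  (forall k t, t \in `]0, 1[ -> t \notin S k -> `|w k t| <= B) ->
  exists (U : set_system nat) (phi V : R -> R) (p q : R),
    [/\ UltraFilter U, extremal xi m alpha beta D1 D2 phi V p q,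
      forall t, t \in `[0, 1] -> th k t @[k --> U] --> phi t &
      (forall k t, t \in `]0, 1[ -> t \notin S k -> 0 <= u k t) ->
      (forall t, t \in `]0, 1[ -> 0 <= pn p q (phi t)) \/ (forall t, V t = 0)].
Proof.
move=> xi0 LB Hc HE Hd th0 wB.
have [U [UU ooU]] := ultraFilterLemma (eventually_filter : ProperFilter \oo).
have HdU : delta k @[k --> U] --> (0 : R).
  by apply: cvg_trans Hd; exact: cvg_app.
have B0 : 0 <= B by apply: le_trans (th0 0%N).
have ct k : continuous (th k) by have [[]] := Hc k.
have lip k (s t : R) : s \in `[0, 1] -> t \in `[0, 1] -> `|th k s - th k t| <= B * `|s - t|.
  wlog st : s t / s <= t => [H s01 t01|].
    by have [/H|/ltW /H] := leP s t; [exact|rewrite distrC (distrC s); exact].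
  rewrite !in_itv/= => /andP[s0 s1] /andP[t0 t1].
  rewrite distrC (distrC s) (ger0_norm (_ : 0 <= t - s)) ?subr_ge0//.
  apply: (lip_of_deriv (S := S k)) => // r; rewrite in_itv/= => /andP[sr rt] rS.
  have r01 : r \in `]0, 1[ by rewrite in_itv/= (le_lt_trans s0 sr) (lt_le_trans rt).
  exists (w k r); last exact: wB.
  by have [[_ _ _ _ H] _ _ _] := Hc k; have [] := H r r01 rS.
have bnd k (t : R) : t \in `[0, 1] -> `|th k t| <= B + B.
  move=> t01; have -> : th k t = th k 0 + (th k t - th k 0) by ring.
  rewrite (le_trans (ler_normD _ _))// lerD//.
  apply: le_trans (lip k t 0 t01 _) _; first by rewrite in_itv/= lexx ler01.
  move: t01; rewrite in_itv/= subr0 => /andP[t0 t1].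
  by rewrite ger0_norm// ler_piMr.
have /choice[h hP] (t : R) : exists l : R, th k (clamp 0 1 t) @[k --> U] --> l.
  have [l ul] : exists l : R, (fun k => th k (clamp 0 1 t)) k @[k --> U] --> l.
    apply: (ultra_bounded_cvg UU (B := B + B)); apply: filterE => k.
    by apply: bnd; exact: clamp_in.
  by exists l.
have clip (s t : R) : `|clamp 0 1 s - clamp 0 1 t| <= `|s - t|.
  rewrite /clamp; have [? ?] : True /\ True by [].
  rewrite /Num.max /Num.min; do !case: ifPn; rewrite -?leNgt => *;
  rewrite ?subrr ?normr0 ?normr_ge0// ler_norml; apply/andP; split;
  have := ler_norm (s - t); have := ler_norm (t - s); rewrite (distrC t); lra.
have lh (s t : R) : `|h s - h t| <= B * `|s - t|.
  apply: (ulim_le UU (ulim_norm UU (ulimD UU (hP s) (ulimN UU (hP t))))).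
    exact: ulim_cst.
  apply: filterE => k; apply: le_trans (lip k _ _ (clamp_in _ ler01) (clamp_in _ ler01)) _.
  by rewrite ler_wpM2l.
have ch : continuous h by exact: lipschitz_continuous lh.
have Ht : ulimf U th h.
  split.
  - exact: ct.
  - exact: ch.
  - by exists (B + B); [rewrite addr_ge0|apply: filterE => k t; exact: bnd].
  - by exists B => //; apply: filterE => k s t; exact: lip.
  - by move=> t t01; have := hP t; rewrite clamp_id.
have hcv t : t \in `[0, 1] -> th k t @[k --> U] --> h t by case: Ht => _ _ _ _; apply.
have [det0|det0] := eqVneq (Ma h * Mc h - Mb h ^+ 2) 0.
  have [p [q [ex hc]]] := extremal_singular UU xi0 Hc HE HdU Ht det0.
  exists U, (fun=> h 0), (fun=> 0), p, q; split => //; last by right.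
  by move=> t t01; rewrite -(hc t t01); exact: hcv.
have [V [p [q [ex hs sgn]]]] := extremal_regular UU xi0 LB Hc HE HdU Ht det0.
exists U, (shot xi p q h), V, p, q; split => //.
  by move=> t t01; rewrite -hs//; exact: hcv.
move=> /sgn u0; left => t t01; rewrite -hs; [exact: u0|exact: subset_itv_oo_cc].
Qed.

End MinimizingSequences.

(** * Horizontal curves and their angles *)

Section CircleAngle.
Context {R : realType}.
Implicit Types (a b c d t : R) (v : 'rV[R]_2).

Definition row2 a b : 'rV[R]_2 := \row_j (if j == 0 then a else b).

Lemma row20 a b : row2 a b 0 0 = a. Proof. by rewrite mxE. Qed.
Lemma row21 a b : row2 a b 0 1 = b. Proof. by rewrite mxE. Qed.

Lemma row2_eta v : row2 (v 0 0) (v 0 1) = v.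
Proof.
apply/rowP => j; rewrite mxE; case: (j =P 0) => [->//|/eqP j0].
by congr (v _ _); apply/val_inj; case: j j0 => -[|[|]].
Qed.

Lemma row2_inj a b c d : row2 a b = row2 c d -> a = c /\ b = d.
Proof. by move=> E; rewrite -(row20 a b) -{2}(row21 a b) E row20 row21. Qed.

Lemma dotvE v1 v2 : dotv v1 v2 = v1 0 0 * v2 0 0 + v1 0 1 * v2 0 1.
Proof.
rewrite /dotv mxE big_ord_recl big_ord1 !mxE.
by congr (_ + v1 _ _ * v2 _ _); exact/val_inj.
Qed.

Lemma dotv_row2 a b c d : dotv (row2 a b) (row2 c d) = a * c + b * d.
Proof. by rewrite dotvE !row20 !row21. Qed.

Lemma perp_row2 a b : perp (row2 a b) = row2 (- b) a.
Proof. by apply/rowP => j; rewrite /perp /row2 !mxE. Qed.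

Lemma row2N a b : - row2 a b = row2 (- a) (- b).
Proof. by apply/rowP => j; rewrite !mxE; case: ifP. Qed.

Lemma row2Z c a b : c *: row2 a b = row2 (c * a) (c * b).
Proof. by apply/rowP => j; rewrite !mxE; case: ifP. Qed.

Fact circ_subproof t : dotv (row2 (cos t) (sin t)) (row2 (cos t) (sin t)) == 1.
Proof. by rewrite dotv_row2 -!expr2 cos2Dsin2. Qed.

Definition circ t : circle R := Circle (circ_subproof t).

(** The bound on the angle keeps the initial angles of a minimizing sequence bounded. *)
Lemma circP (n : circle R) : exists2 t, n = circ t & `|t| <= pi.
Proof.
have := valP n; rewrite dotvE -!expr2 => /eqP; set a := val n 0 0; set b := val n 0 1 => ab.
have a1 : -1 <= a <= 1.
  by rewrite -ler_norml -(@expr_le1 _ 2)// real_normK ?num_real// -ab lerDl sqr_ge0.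
have sb : Num.sqrt (1 - a ^+ 2) = `|b| by rewrite -ab addrAC subrr add0r sqrtr_sqr.
have ac : `|acos a| <= pi by rewrite ger0_norm ?acos_ge0// acos_lepi.
have [b0|b0] := leP 0 b.
  exists (acos a) => //; apply: val_inj => /=.
  by rewrite acosK ?in_itv//= sin_acos// sb ger0_norm// row2_eta.
exists (- acos a); last by rewrite normrN.
apply: val_inj => /=.
by rewrite cosN sinN acosK ?in_itv//= sin_acos// sb ltr0_norm// opprK row2_eta.
Qed.

Lemma circ_eq a b : circ a = circ b <-> cos a = cos b /\ sin a = sin b.
Proof.
split=> [/(congr1 val)/row2_inj//|[h1 h2]].
by apply: val_inj; rewrite /= h1 h2.
Qed.

Lemma antipode_circ a b : circ a = antipode (circ b) <-> cos a = - cos b /\ sin a = - sin b.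
Proof.
split=> [/(congr1 val)/=|[h1 h2]]; first by rewrite row2N => /row2_inj.
by apply: val_inj; rewrite /= row2N h1 h2.
Qed.

Lemma sin_sub_eq0 a b : sin (a - b) = 0 ->
  (cos (a - b) = 1 /\ (cos a = cos b /\ sin a = sin b)) \/
  (cos (a - b) = -1 /\ (cos a = - cos b /\ sin a = - sin b)).
Proof.
move=> s0; have -> : cos a = cos (a - b + b) by rewrite subrK.
have -> : sin a = sin (a - b + b) by rewrite subrK.
rewrite (cosD (a - b) b) (sinD (a - b) b) s0 !mul0r subr0 add0r.
have := cos2Dsin2 (a - b); rewrite s0 expr0n addr0 => /eqP; rewrite sqrf_eq1.
by move=> /orP[/eqP ->|/eqP ->]; [left|right]; rewrite ?mul1r ?mulN1r.
Qed.

(** A single sine covers both the equal and the antipodal case. *)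
Lemma class_circ v1 v2 a b :
  class_of (v1, circ a) = class_of (v2, circ b) <-> v1 = v2 /\ sin (a - b) = 0.
Proof.
split.
  rewrite /class_of /= => -[-> /eqmodP]; rewrite /= /antipodal /= => /orP[]/eqP.
    by move=> /circ_eq[ca sa]; rewrite sinB ca sa; split => //; ring.
  by move=> /antipode_circ[ca sa]; rewrite sinB ca sa; split => //; ring.
move=> [-> /sin_sub_eq0 h]; rewrite /class_of /=; congr pair; apply/eqmodP => /=.
rewrite /antipodal /=; case: h => [[_ h]|[_ h]].
  by rewrite (circ_eq a b).2// eqxx.
by rewrite (antipode_circ a b).2// eqxx orbT.
Qed.

End CircleAngle.

Section C1Curves.
Context {R : realType}.
Implicit Types (a b t : R) (f g F G d : R -> R) (s : seq R).

Lemma derive1_row2 F G t (d e : R) : deriv1 F t d -> deriv1 G t e ->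
  derivable (fun t => row2 (F t) (G t)) t 1 /\
  derive1 (fun t => row2 (F t) (G t)) t = row2 d e.
Proof.
move=> [dF <-] [dG <-].
have dd : derivable (fun t => row2 (F t) (G t)) t 1.
  apply/derivable_mxP => i j; rewrite ord1.
  under eq_fun do rewrite mxE.
  by case: (j =P 0).
split => //; rewrite derive1E derive_mx//.
apply/rowP => j; rewrite !mxE; under eq_fun do rewrite mxE.
by case: (j =P 0).
Qed.

Lemma cont_row2 F G : continuous F -> continuous G -> continuous (fun t => row2 (F t) (G t)).
Proof.
move=> cF cG; have -> : (fun t => row2 (F t) (G t)) =
    (fun t => F t *: row2 1 0 + G t *: row2 0 1).
  by apply/funext => t; apply/rowP => j; rewrite !mxE; case: ifP; rewrite ?mulr0 ?mulr1 ?addr0 ?add0r.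
by move=> t; apply: cvgD; apply: cvgZr_tmp; [exact: cF|exact: cG].
Qed.

Lemma C1_onP a b (f : R -> 'rV[R]_2) : C1_on a b f <->
  C1_ext a b (fun t => f t 0 0) /\ C1_ext a b (fun t => f t 0 1).
Proof.
split=> [[F [dF cF fF]]|[[F [dF [hF cdF fF]]] [G [dG [hG cdG fG]]]]].
  have H (j : 'I_2) : C1_ext a b (fun t => f t 0 j).
    exists (fun t => F t 0 j), (fun t => derive1 F t 0 j); split.
    - move=> t; have Ft := dF t; have /derivable_mxP/(_ 0 j) Fj := Ft.
      apply: (deriv1_eq (derivable_deriv1 Fj)).
      by rewrite !derive1E derive_mx// mxE.
    - move=> t; apply: (@continuous_comp _ _ _ (derive1 F) (fun M => M 0 j)); first exact: cF.
      exact: coord_continuous.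
    - by move=> t tab; rewrite fF// inE.
  by split; exact: H.
exists (fun t => row2 (F t) (G t)).
have H t := derive1_row2 (hF t) (hG t).
split.
- by move=> t; have [] := H t.
- rewrite (_ : derive1 _ = fun t => row2 (dF t) (dG t)); first exact: cont_row2.
  by apply/funext => t; have [] := H t.
- by move=> t; rewrite inE /= => tab; rewrite -fF// -fG// row2_eta.
Qed.

Lemma partition_locate s a b t : itv_partition a b s -> t \in `]a, b[ -> t \notin s ->
  exists2 i, (i < size s)%N & t \in `]nth 0 (a :: s) i, nth 0 (a :: s) i.+1[.
Proof.
elim: s a => [a /itv_partition_nil ->|c s IH a ps].
  by rewrite in_itv/= => /andP[h1 h2]; have := lt_trans h1 h2; rewrite ltxx.
move=> tab; rewrite inE negb_or => /andP[tc ts].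
have [tltc|ctt|tE] := ltgtP t c; last by rewrite tE eqxx in tc.
  by exists 0%N => //=; move: tab; rewrite !in_itv/= tltc => /andP[-> _].
have tcb : t \in `]c, b[ by move: tab; rewrite !in_itv/= ctt => /andP[_ ->].
by have [i si ti] := IH c (itv_partition_cons ps) tcb ts; exists i.+1.
Qed.

Lemma partition_nth_in s i : itv_partition 0 1 s -> (i < size s)%N ->
  0 <= nth 0 (0 :: s) i :> R /\ nth 0 (0 :: s) i.+1 <= 1 :> R.
Proof.
move=> ps si; have l := itv_partition_nth_ge (ltnW si : (i < (size s).+1)%N) ps.
have r := itv_partition_nth_le (si : (i.+1 < (size s).+1)%N) ps.
have E j : (j <= size s)%N -> nth 0 (0 :: s) j = nth 1 (0 :: s) j :> R.
  by move=> h; exact: set_nth_default.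
by rewrite !E// ltnW.
Qed.

Lemma partition_nth_lt s i : itv_partition 0 1 s -> (i < size s)%N ->
  nth 0 (0 :: s) i < nth 0 (0 :: s) i.+1 :> R.
Proof. by move=> [/(pathP 0) + _] si => /(_ i si). Qed.

Lemma pieces_deriv s f t : pieces s (fun a b => C1_ext a b f) -> t \in `]0, 1[ -> t \notin s ->
  deriv1 f t (derive1 f t) /\ {for t, continuous (derive1 f)}.
Proof.
move=> [ps H] t01 ts; have [i si ti] := partition_locate ps t01 ts.
have [F [d [dF cd fF]]] := H i si; set c := nth _ _ _ in ti fF; set e := nth _ _ _ in ti fF.
have df r : r \in `]c, e[ -> deriv1 f r (d r).
  move=> rce; apply: (@deriv1_itv _ F f c e) => // r' /subset_itv_oo_cc/fF.
  by move=> ->.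
split; first by rewrite (deriv1_val (df t ti)); exact: df.
rewrite /prop_for /continuous_at (deriv1_val (df t ti)).
apply: cvg_trans (cd t); apply: near_eq_cvg.
have : \forall r \near t, r \in `]c, e[ by exact: near_in_itvoo.
by apply: filterS => r /df /deriv1_val ->.
Qed.

Lemma bounded_family (P : nat -> R -> Prop) n :
  (forall i B B', B <= B' -> P i B -> P i B') ->
  (forall i, (i < n)%N -> exists B, P i B) -> exists B, forall i, (i < n)%N -> P i B.
Proof.
move=> mono; elim: n => [_|n IH H]; first by exists 0.
have [B HB] := IH (fun i ni => H i (ltnW ni)); have [B' HB'] := H n (ltnSn n).
exists (Num.max B B') => i; rewrite ltnS leq_eqVlt => /predU1P[->|ni].
  by apply: mono HB'; rewrite le_max lexx orbT.
by apply: mono (HB i ni); rewrite le_max lexx.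
Qed.

Lemma pieces_bounded s f : pieces s (fun a b => C1_ext a b f) ->
  exists B, forall t, t \in `]0, 1[ -> t \notin s -> `|derive1 f t| <= B.
Proof.
move=> [ps H].
have [|i si|B HB] := @bounded_family (fun i B => forall t,
    t \in `]nth 0 (0 :: s) i, nth 0 (0 :: s) i.+1[ -> `|derive1 f t| <= B) (size s).
- by move=> i B B' BB' h t /h/le_trans; apply.
- have [F [d [dF cd fF]]] := H i si.
  have [B HB] := bounded_itv (nth 0 (0 :: s) i) (nth 0 (0 :: s) i.+1) cd.
  exists B => t ti; rewrite (_ : derive1 f t = d t); first exact/HB/subset_itv_oo_cc.
  apply/deriv1_val/(@deriv1_itv _ F f _ _ t _ ti) => // r' /subset_itv_oo_cc/fF.
  by move=> ->.
- exists B => t t01 ts; have [i si ti] := partition_locate ps t01 ts.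
  exact: HB ti.
Qed.

(** Written as a sum, a function glued at c is continuous as soon as its pieces are, without a case
    analysis at the junction. *)
Lemma clamp_split a b c f t : a <= c -> c <= b ->
  f (clamp a b t) = f (clamp a c t) + f (clamp c b t) - f c.
Proof.
move=> ac cb; have [tc|/ltW ct] := leP t c.
  have -> : clamp c b t = c by rewrite /clamp max_l// ge_min tc orbT.
  by rewrite addrK /clamp (min_idPr (le_trans tc cb)) (min_idPr tc).
have -> : clamp a c t = c by rewrite /clamp (min_idPl ct) max_r.
rewrite addrAC subrr add0r /clamp.
have h : c <= Num.min b t by rewrite le_min cb.
by rewrite (max_r h) max_r// (le_trans ac).
Qed.

Lemma pieces_clamp_cont s a b f : itv_partition a b s ->
  (forall i, (i < size s)%N -> exists2 F, continuous F &
     forall t, t \in `[nth 0 (a :: s) i, nth 0 (a :: s) i.+1] -> f t = F t) ->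
  continuous (fun t => f (clamp a b t)).
Proof.
elim: s a => [a /itv_partition_nil <- _|c s IH a ps H].
  have -> : (fun t => f (clamp a a t)) = fun=> f a; last by conts.
  apply/funext => t; congr f; have := @clamp_in R a a t (lexx a).
  by rewrite in_itv/= -eq_le => /eqP.
have [ac cb] : a <= c /\ c <= b.
  split; last exact: itv_partition_le (itv_partition_cons ps).
  by case: ps => /= /andP[/ltW].
have -> : (fun t => f (clamp a b t)) = fun t => f (clamp a c t) + f (clamp c b t) - f c.
  by apply/funext => t; exact: clamp_split.
have c1 : continuous (fun t => f (clamp c b t)).
  by apply: IH (itv_partition_cons ps) _ => i si; exact: (H i.+1).
have [F cF fF] := H 0%N isT.
have c2 : continuous (fun t => f (clamp a c t)).
  have -> : (fun t => f (clamp a c t)) = fun t => F (clamp a c t).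
    by apply/funext => t; rewrite fF// clamp_in.
  by apply: cont_comp => //; exact: clamp_cont.
by conts.
Qed.

End C1Curves.

Section LiftedCurves.
Context {R : realType}.
Implicit Types (x y th f g : R -> R) (s : seq R) (a b c t : R).
Notation mu := (@lebesgue_measure R).

Definition ctl x y th t := derive1 x t * cos (th t) + derive1 y t * sin (th t).

Definition lifted s x y th := [/\ [/\ continuous x, continuous y & continuous th],
  [/\ pieces s (fun a b => C1_ext a b x), pieces s (fun a b => C1_ext a b y) &
      pieces s (fun a b => C1_ext a b th)] &
  forall t, t \in `]0, 1[ -> t \notin s ->
    derive1 x t * sin (th t) = derive1 y t * cos (th t)].

Definition curve_of x y th : R -> R2S1 R := fun t => (row2 (x t) (y t), circ (th t)).

Lemma lifted_deriv s x y th t : lifted s x y th -> t \in `]0, 1[ -> t \notin s ->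
  [/\ deriv1 x t (ctl x y th t * cos (th t)), deriv1 y t (ctl x y th t * sin (th t)) &
      deriv1 th t (derive1 th t)].
Proof.
move=> [_ [px py pt] h] t01 ts; have E := h t t01 ts; have cs := cos2Dsin2 (th t).
have [dx _] := pieces_deriv px t01 ts; have [dy _] := pieces_deriv py t01 ts.
split; last by have [] := pieces_deriv pt t01 ts.
  apply: (deriv1_eq dx); rewrite /ctl mulrDl -[LHS]mulr1 -cs.
  rewrite -mulrA mulrDr !expr2 [derive1 x t * (sin _ * _)]mulrA E; ring.
apply: (deriv1_eq dy); rewrite /ctl mulrDl -[LHS]mulr1 -cs.
rewrite -[derive1 x t * _ * _]mulrA [cos _ * sin _]mulrC mulrA E mulrDr; ring.
Qed.

Lemma lifted_cont s x y th t : lifted s x y th -> t \in `]0, 1[ -> t \notin s ->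
  {for t, continuous (ctl x y th)} /\ {for t, continuous (derive1 th)}.
Proof.
move=> [[cx cy ct] [px py pt] h] t01 ts.
have [_ c1] := pieces_deriv px t01 ts; have [_ c2] := pieces_deriv py t01 ts.
split; last by have [] := pieces_deriv pt t01 ts.
have cc : {for t, continuous (fun t => cos (th t))} by exact: cont_cos.
have cs : {for t, continuous (fun t => sin (th t))} by exact: cont_sin.
by apply: cvgD; apply: cvgM.
Qed.

Lemma lifted_bounded s x y th : lifted s x y th ->
  exists B, forall t, t \in `]0, 1[ -> t \notin s ->
    `|ctl x y th t| <= B /\ `|derive1 th t| <= B.
Proof.
move=> [_ [px py pt] _].
have [B1 H1] := pieces_bounded px; have [B2 H2] := pieces_bounded py.
have [B3 H3] := pieces_bounded pt.
exists (Num.max (B1 + B2) B3) => t t01 ts; split; last first.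
  by rewrite le_max H3// orbT.
rewrite le_max; apply/orP; left; rewrite /ctl (le_trans (ler_normD _ _))// !normrM.
have h1 := H1 t t01 ts; have h2 := H2 t t01 ts.
by apply: lerD; [rewrite -[leRHS]mulr1 ler_pM ?cos_max|rewrite -[leRHS]mulr1 ler_pM ?sin_max].
Qed.

Lemma C1_ext_cos a b th : C1_ext a b th -> C1_ext a b (fun t => cos (th t)).
Proof.
move=> [F [d [dF cd fF]]]; have cF : continuous F by move=> t; exact: deriv1_continuous (dF t).
exists (fun t => cos (F t)), (fun t => - sin (F t) * d t); split.
- by move=> t; exact: deriv1_cos.
- by conts.
- by move=> t /fF ->.
Qed.

Lemma C1_ext_sin a b th : C1_ext a b th -> C1_ext a b (fun t => sin (th t)).
Proof.
move=> [F [d [dF cd fF]]]; have cF : continuous F by move=> t; exact: deriv1_continuous (dF t).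
exists (fun t => sin (F t)), (fun t => cos (F t) * d t); split.
- by move=> t; exact: deriv1_sin.
- by conts.
- by move=> t /fF ->.
Qed.

Lemma ae01_off s (P : R -> Prop) :
  (forall t, t \in `]0, 1[ -> t \notin s -> P t) -> ae01 P.
Proof.
move=> H; rewrite /ae01; exists [set` 0 :: 1 :: s]; split.
- by apply: (@seq_measurable _ _ (0 :: 1 :: s)).
- by apply: (@seq_mu0 _ _ (0 :: 1 :: s)).
- move=> t /= /not_implyP[]; rewrite inE /= => t01 nP; rewrite !inE.
  have [//|t0] := eqVneq t 0; have [//|t1] := eqVneq t 1 => /=.
  apply: contrapT => /negP ts; apply: nP; apply: H => //.
  by move: t01; rewrite !in_itv/= !lt_def t0 (eq_sym 1) t1.
Qed.

(** Were g negative at t, it would be so on an interval of positive measure contained in the null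
    set where P fails. This makes almost-everywhere conditions pointwise off the breakpoints. *)
Lemma ae01_at (P : R -> Prop) g t : ae01 P -> (forall r, P r -> 0 <= g r) ->
  t \in `]0, 1[ -> {for t, continuous g} -> 0 <= g t.
Proof.
move=> [N [mN N0 PN]] Pg t01 cg; rewrite leNgt; apply/negP => gt0.
have h1 : \forall r \near t, r \in `]0, 1[ by exact: near_in_itvoo.
have h2 : \forall r \near t, g r < 0 by apply: (cvgr_lt _ cg).
have [e /= e0 He] := (@nbhs_ballP R R t _).1 (filterI h1 h2).
have sub : `](t - e), (t + e)[ `<=` N.
  move=> r rte; apply: PN => /= Pr.
  have [|r01 gr] := He r.
    rewrite /ball /= distrC ltr_norml; move: rte; rewrite /= in_itv/= => /andP[l r'].
    by apply/andP; split; lra.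
  have r1 : r \in `[0, 1]%classic by rewrite inE; exact: subset_itv_oo_cc.
  by have := Pg r (Pr r1); rewrite leNgt gr.
have : (mu `](t - e)%R, (t + e)%R[%classic <= mu N)%E by apply: le_measure; rewrite ?inE.
rewrite N0 lebesgue_measure_itv/= lte_fin ifT; last by lra.
by rewrite -EFinB lee_fin leNgt; apply/negP/negPn; lra.
Qed.

Lemma curve_near (gamma : R -> R2S1 R) x y th t :
  (forall t, t \in `[0, 1] -> gamma t = curve_of x y th t) -> t \in `]0, 1[ ->
  \forall r \near t, gamma r = curve_of x y th r.
Proof.
move=> gE t01; have h1 : \forall r \near t, r \in `]0, 1[ by exact: near_in_itvoo.
by apply: filterS h1 => r /subset_itv_oo_cc /gE.
Qed.

Lemma lifted_controls (gamma : R -> R2S1 R) s x y th t : lifted s x y th ->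
  (forall t, t \in `[0, 1] -> gamma t = curve_of x y th t) ->
  t \in `]0, 1[ -> t \notin s ->
  [/\ derive1 (position gamma) t = ctl x y th t *: orientation gamma t,
    u1 gamma t = ctl x y th t & u3 gamma t = derive1 th t].
Proof.
move=> L gE t01 ts; have [dx dy dt] := lifted_deriv L t01 ts.
have gt : gamma t = curve_of x y th t by apply: gE; exact: subset_itv_oo_cc.
have ot : orientation gamma t = row2 (cos (th t)) (sin (th t)) by rewrite /orientation gt.
have dp : derive1 (position gamma) t =
    row2 (ctl x y th t * cos (th t)) (ctl x y th t * sin (th t)).
  have [_ <-] := derive1_row2 dx dy; rewrite !derive1E; apply: near_eq_derive.
  by apply: filterS (curve_near gE t01) => r gr; rewrite /position gr.
have dn : derive1 (orientation gamma) t =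
    row2 (- sin (th t) * derive1 th t) (cos (th t) * derive1 th t).
  have [_ <-] := derive1_row2 (deriv1_cos dt) (deriv1_sin dt); rewrite !derive1E.
  apply: near_eq_derive.
  by apply: filterS (curve_near gE t01) => r gr; rewrite /orientation gr.
have cs := cos2Dsin2 (th t); split.
- by rewrite dp ot row2Z.
- rewrite /u1 dp ot dotv_row2 -[RHS]mulr1 -cs; ring.
- rewrite /u3 dn ot perp_row2 dotv_row2 -[RHS]mulr1 -cs; ring.
Qed.

Definition speed xi x y th t :=
  Num.sqrt (xi ^+ 2 * `|ctl x y th t| ^+ 2 + `|derive1 th t| ^+ 2).

Lemma speed_cont xi s x y th t : lifted s x y th -> t \in `]0, 1[ -> t \notin s ->
  {for t, continuous (speed xi x y th)}.
Proof.
move=> L t01 ts; have [c1 c2] := lifted_cont L t01 ts.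
apply: (@continuous_comp _ _ _ _ Num.sqrt); last exact: sqrt_continuous.
have sq (f : R -> R) : {for t, continuous f} -> {for t, continuous (fun r => `|f r| ^+ 2)}.
  by move=> cf; apply: cvgM; apply: cvg_norm.
by apply: cvgD; [apply: cvgM; [exact: cvg_cst|exact: sq]|exact: sq].
Qed.

Lemma speed_bounded xi s x y th : lifted s x y th ->
  exists B, forall t, t \in `]0, 1[ -> t \notin s -> `|speed xi x y th t| <= B.
Proof.
move=> L; have [B HB] := lifted_bounded L.
exists (Num.sqrt (xi ^+ 2 * B ^+ 2 + B ^+ 2)) => t t01 ts.
have [h1 h2] := HB t t01 ts.
have B0 : 0 <= B by exact: le_trans h1.
rewrite ger0_norm ?sqrtr_ge0// ler_wsqrtr// lerD ?lerXn2r ?nnegrE//.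
by rewrite ler_wpM2l ?sqr_ge0// lerXn2r ?nnegrE.
Qed.

Lemma lifted_length xi (gamma : R -> R2S1 R) s x y th : lifted s x y th ->
  (forall t, t \in `[0, 1] -> gamma t = curve_of x y th t) ->
  exists Lam : R -> R, [/\ continuous Lam,
    forall t, t \in `]0, 1[ -> t \notin s -> deriv1 Lam t (speed xi x y th t) &
    curve_length xi gamma = (Lam 1 - Lam 0)%:E].
Proof.
move=> L gE; have [B HB] := speed_bounded xi L.
pose f t := Num.sqrt (xi ^+ 2 * `|u1 gamma t| ^+ 2 + `|u3 gamma t| ^+ 2).
have fE t : t \in `]0, 1[ -> t \notin s -> f t = speed xi x y th t.
  by move=> t01 ts; rewrite /f /speed; have [_ -> ->] := lifted_controls L gE t01 ts.
have H t : t \in `]0, 1[ -> t \notin s -> {for t, continuous f} /\ `|f t| <= B.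
  move=> t01 ts; split; last by rewrite fE//; exact: HB.
  have sc : speed xi x y th r @[r --> t] --> speed xi x y th t by exact: speed_cont L t01 ts.
  rewrite /prop_for /continuous_at fE//; apply: cvg_trans sc; apply: near_eq_cvg.
  have : nbhs t [set r : R | (r \in `]0, 1[) /\ (r \notin s)].
    by apply: open_nbhs_nbhs; split => //; exact: open_itv_minus_seq.
  by apply: filterS => r [r01 rs]; rewrite fE.
have [G [cG dG IG]] := piecewise_primitive ltr01 H.
exists G; split; first exact: cG.
  by move=> t t01 ts; rewrite -fE//; exact: dG.
by rewrite /curve_length -IG; congr integral; apply/seteqP; split => t /=; rewrite inE.
Qed.

Lemma lifted_Gamma0 s x y th : lifted s x y th ->
  Gamma0 (curve_of x y th 0) (curve_of x y th 1) (curve_of x y th).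
Proof.
move=> L; have [_ [[ps px] [_ py] [_ pt]] _] := L; split => //.
  exists s; split => // i si; split; apply/C1_onP; rewrite /position /orientation /=.
    split.
      by under eq_fun do rewrite row20; exact: px.
    by under eq_fun do rewrite row21; exact: py.
  split.
    by under eq_fun do rewrite row20; exact/C1_ext_cos/pt.
  by under eq_fun do rewrite row21; exact/C1_ext_sin/pt.
apply: (@ae01_off s) => t t01 ts; exists (ctl x y th t).
by have [] := lifted_controls L (fun _ _ => erefl) t01 ts.
Qed.

Lemma lifted_Gamma0_plus s x y th : lifted s x y th ->
  (forall t, t \in `]0, 1[ -> t \notin s -> 0 <= ctl x y th t) ->
  Gamma0_plus (curve_of x y th 0) (curve_of x y th 1) (curve_of x y th).
Proof.
move=> L u0; split; first exact: lifted_Gamma0 L.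
apply: (@ae01_off s) => t t01 ts.
have [_ + _] := lifted_controls L (fun _ _ => erefl) t01 ts.
by rewrite /u1 => ->; exact: u0.
Qed.

End LiftedCurves.

Section Lifting.
Context {R : realType}.
Implicit Types (x y th f g : R -> R) (s : seq R) (a b c t : R).

Lemma pieces_ext s f g : (forall t, t \in `[0, 1] -> f t = g t) ->
  pieces s (fun a b => C1_ext a b f) -> pieces s (fun a b => C1_ext a b g).
Proof.
move=> fg [ps H]; split => // i si; have [F [d [dF cd fF]]] := H i si.
exists F, d; split => // t tab; rewrite -fF// fg//.
have [l r] := partition_nth_in ps si; move: tab; rewrite !in_itv/= => /andP[tl tr].
by rewrite (le_trans l tl) (le_trans tr r).
Qed.

Lemma pieces_cont s f : pieces s (fun a b => C1_ext a b f) ->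
  continuous (fun t => f (clamp 0 1 t)).
Proof.
move=> [ps H]; apply: (pieces_clamp_cont ps) => i si.
have [F [d [dF cd fF]]] := H i si; exists F => //.
by move=> t; exact: deriv1_continuous (dF t).
Qed.

Lemma near_off s t : t \in `]0, 1[ -> t \notin s ->
  \forall r \near t, (r \in `]0, 1[) /\ (r \notin s).
Proof.
by move=> t01 ts; apply: open_nbhs_nbhs; split => //; exact: open_itv_minus_seq.
Qed.

(** The scalar product of (x, y) and (cos th, sin th) starts at 1 and has zero derivative, because
    (x, y) is orthogonal to its own derivative. Unit vectors with scalar product 1 are equal. *)
Lemma unit_angle x y th s : continuous x -> continuous y -> continuous th ->
  (forall t, x t ^+ 2 + y t ^+ 2 = 1) -> x 0 = cos (th 0) -> y 0 = sin (th 0) ->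
  (forall t, t \in `]0, 1[ -> t \notin s -> exists d e,
    [/\ deriv1 x t d, deriv1 y t e & deriv1 th t (x t * e - y t * d)]) ->
  forall t, t \in `[0, 1] -> x t = cos (th t) /\ y t = sin (th t).
Proof.
move=> cx cy ct n1 x0 y0 H t t01.
pose c t := x t * cos (th t) + y t * sin (th t).
have ctE : c t = 1.
  have <- : c 0 = 1 by rewrite /c -x0 -y0 -!expr2.
  apply/esym; apply: (eq_of_deriv0 (S := s)).
  - by move: t01; rewrite in_itv/= => /andP[].
  - by rewrite /c; conts.
  move=> r; rewrite in_itv/= => /andP[r0 rt] rs.
  have r01 : r \in `]0, 1[.
    by rewrite in_itv/= r0 (lt_le_trans rt)//; move: t01; rewrite in_itv/= => /andP[].
  have [d [e [dx dy dt]]] := H r r01 rs.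
  have E : x r * d + y r * e = 0.
    have : deriv1 (fun t => x t ^+ 2 + y t ^+ 2) r (2 * (x r * d + y r * e)).
      by derivs; ring.
    have -> : (fun t => x t ^+ 2 + y t ^+ 2) = fun=> 1 by apply/funext.
    move=> /deriv1_uniq/(_ (deriv1_cst _ _)) /eqP.
    by rewrite mulf_eq0 pnatr_eq0/= => /eqP.
  have dE : d = - (x r * e - y r * d) * y r.
    transitivity (d * (x r ^+ 2 + y r ^+ 2)); first by rewrite n1 mulr1.
    transitivity (x r * (x r * d + y r * e) - (x r * e - y r * d) * y r); first by ring.
    by rewrite E mulr0 add0r mulNr.
  have eE : e = (x r * e - y r * d) * x r.
    transitivity (e * (x r ^+ 2 + y r ^+ 2)); first by rewrite n1 mulr1.
    transitivity (y r * (x r * d + y r * e) + (x r * e - y r * d) * x r); first by ring.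
    by rewrite E mulr0 add0r.
  move: (x r * e - y r * d) dt dE eE => w dt dE eE; rewrite {}dE in dx; rewrite {}eE in dy.
  by rewrite /c; derivs; ring.
have : (x t - cos (th t)) ^+ 2 + (y t - sin (th t)) ^+ 2 = 0.
  transitivity ((x t ^+ 2 + y t ^+ 2) + (cos (th t) ^+ 2 + sin (th t) ^+ 2) - 2 * c t).
    by rewrite /c; ring.
  by rewrite n1 cos2Dsin2 ctE; ring.
move=> /eqP; rewrite paddr_eq0 ?sqr_ge0// !sqrf_eq0 !subr_eq0.
by move=> /andP[/eqP -> /eqP ->].
Qed.

(** The angle is obtained by integrating the angular velocity M N' - N M' of the orientation from an
    initial angle, with no appeal to covering spaces. *)
Lemma Gamma0_lift (gamma : R -> R2S1 R) q0 q1 : Gamma0 q0 q1 gamma ->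
  exists s x y th, [/\ lifted s x y th,
    forall t, t \in `[0, 1] -> gamma t = curve_of x y th t & `|th 0| <= pi].
Proof.
move=> [[s [ps H]] g0 g1 hor].
pose X t := position gamma (clamp 0 1 t) 0 0; pose Y t := position gamma (clamp 0 1 t) 0 1.
pose M t := orientation gamma (clamp 0 1 t) 0 0.
pose N t := orientation gamma (clamp 0 1 t) 0 1.
have ext (f : R -> R) : pieces s (fun a b => C1_ext a b f) ->
    pieces s (fun a b => C1_ext a b (fun t => f (clamp 0 1 t))).
  by apply: pieces_ext => t t01; rewrite clamp_id.
have pX' : pieces s (fun a b => C1_ext a b (fun t => position gamma t 0 0)).
  by split => // i si; have [/C1_onP[] h _ _] := H i si; exact: h.
have pY' : pieces s (fun a b => C1_ext a b (fun t => position gamma t 0 1)).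
  by split => // i si; have [/C1_onP[] _ h _] := H i si; exact: h.
have pM' : pieces s (fun a b => C1_ext a b (fun t => orientation gamma t 0 0)).
  by split => // i si; have [_ /C1_onP[] h _] := H i si; exact: h.
have pN' : pieces s (fun a b => C1_ext a b (fun t => orientation gamma t 0 1)).
  by split => // i si; have [_ /C1_onP[] _ h] := H i si; exact: h.
have [cX cY] : continuous X /\ continuous Y.
  by split; [exact: pieces_cont pX'|exact: pieces_cont pY'].
have [cM cN] : continuous M /\ continuous N.
  by split; [exact: pieces_cont pM'|exact: pieces_cont pN'].
have [pX pY] : pieces s (fun a b => C1_ext a b X) /\ pieces s (fun a b => C1_ext a b Y).
  by split; [exact: ext pX'|exact: ext pY'].
have [pM pN] : pieces s (fun a b => C1_ext a b M) /\ pieces s (fun a b => C1_ext a b N).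
  by split; [exact: ext pM'|exact: ext pN'].
have n1 t : M t ^+ 2 + N t ^+ 2 = 1.
  have /eqP := valP (gamma (clamp 0 1 t)).2; rewrite dotvE !expr2; exact.
have [th0 E0 th0pi] := circP (gamma 0).2.
pose w t := M t * derive1 N t - N t * derive1 M t.
have [B1 HB1] := pieces_bounded pM; have [B2 HB2] := pieces_bounded pN.
have M1 t : `|M t| <= 1.
  by rewrite -(@expr_le1 _ 2)// real_normK ?num_real// -(n1 t) lerDl sqr_ge0.
have N1 t : `|N t| <= 1.
  by rewrite -(@expr_le1 _ 2)// real_normK ?num_real// -(n1 t) lerDr sqr_ge0.
have Hw t : t \in `]0, 1[ -> t \notin s -> {for t, continuous w} /\ `|w t| <= B2 + B1.
  move=> t01 ts; have [_ c1] := pieces_deriv pM t01 ts; have [_ c2] := pieces_deriv pN t01 ts.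
  split; last first.
    rewrite (le_trans (ler_normB _ _))// !normrM; apply: lerD.
      by rewrite -[leRHS]mul1r ler_pM// HB2.
    by rewrite -[leRHS]mul1r ler_pM// HB1.
  by apply: cvgB; apply: cvgM => //; [exact: cM|exact: cN].
have [G [cG dG _]] := piecewise_primitive ltr01 Hw.
pose th t := th0 + (G t - G 0).
have ct : continuous th by rewrite /th; conts.
have dth t : t \in `]0, 1[ -> t \notin s -> deriv1 th t (w t).
  by move=> t01 ts; have ? := dG t t01 ts; rewrite /th; derivs; ring.
have c01 : clamp 0 1 0 = 0 :> R by rewrite clamp_id// in_itv/= lexx ler01.
have thE t : t \in `[0, 1] -> M t = cos (th t) /\ N t = sin (th t).
  apply: (@unit_angle M N th s) => //.
  - by rewrite /th subrr addr0 /M c01 /orientation E0 /= row20.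
  - by rewrite /th subrr addr0 /N c01 /orientation E0 /= row21.
  move=> r r01 rs; exists (derive1 M r), (derive1 N r).
  have [d1 _] := pieces_deriv pM r01 rs; have [d2 _] := pieces_deriv pN r01 rs.
  by split => //; exact: dth.
(* On each piece [th] is a primitive of the continuous function [om] built from the C1 extensions of
   the orientation, hence C1 up to the breakpoints. *)
have pth : pieces s (fun a b => C1_ext a b th).
  split => // i si; have [l r] := partition_nth_in ps si.
  have [F [d [dF cd FE]]] := pM.2 i si; have [K [e [dK ce KE]]] := pN.2 i si.
  move: l r FE KE; set a := nth _ _ _; set b := nth _ _ _ => l r FE KE.
  have cF : continuous F by move=> t; exact: deriv1_continuous (dF t).
  have cK : continuous K by move=> t; exact: deriv1_continuous (dK t).
  pose om t := F t * e t - K t * d t.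
  have com : continuous om by rewrite /om; conts.
  exists (fun t => th a + (prim om t - prim om a)), om; split => //.
    by move=> t; have ? := prim_deriv t com; derivs; ring.
  move=> t; rewrite in_itv/= => /andP[ta tb].
  suff -> : prim om t - prim om a = th t - th a by ring.
  apply: (eq_deriv_eq (S := s)) => //; first exact: prim_cont.
  move=> u; rewrite in_itv/= => /andP[ua ut] us; exists (om u); first exact: prim_deriv.
  have u01 : u \in `]0, 1[.
    by rewrite in_itv/= (le_lt_trans l ua) (lt_le_trans ut)// (le_trans tb).
  have uab : u \in `]a, b[ by rewrite in_itv/= ua (lt_le_trans ut).
  apply: (deriv1_eq (dth u u01 us)); rewrite /w /om FE ?KE; try exact: subset_itv_oo_cc.
  congr (_ * _ - _ * _); apply: deriv1_val.
    by apply: (@deriv1_itv _ K _ a b) => // v /subset_itv_oo_cc/KE ->.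
  by apply: (@deriv1_itv _ F _ a b) => // v /subset_itv_oo_cc/FE ->.
have gE t : t \in `[0, 1] -> gamma t = curve_of X Y th t.
  move=> t01; have [h1 h2] := thE t t01.
  rewrite [LHS]surjective_pairing /curve_of; congr pair.
    by rewrite /X /Y clamp_id// row2_eta.
  apply: val_inj => /=; rewrite -h1 -h2 /M /N clamp_id//; exact/esym/row2_eta.
exists s, X, Y, th; split => //; last by rewrite /th subrr addr0.
split => // t t01 ts.
have dpos r : r \in `]0, 1[ -> r \notin s ->
    derive1 (position gamma) r = row2 (derive1 X r) (derive1 Y r).
  move=> r01 rs; have [dx _] := pieces_deriv pX r01 rs; have [dy _] := pieces_deriv pY r01 rs.
  have [_ <-] := derive1_row2 dx dy; rewrite !derive1E; apply: near_eq_derive.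
  by apply: filterS (curve_near gE r01) => v gv; rewrite /position gv.
(* A multiple of the cross product of velocity and orientation, which vanishes almost everywhere; e
   = 1 and e = -1 give both inequalities at t. *)
pose g e r := e * (derive1 (position gamma) r 0 0 * orientation gamma r 0 1
                   - derive1 (position gamma) r 0 1 * orientation gamma r 0 0).
have gE' e r : r \in `]0, 1[ -> r \notin s ->
    g e r = e * (derive1 X r * sin (th r) - derive1 Y r * cos (th r)).
  move=> r01 rs; rewrite /g dpos// row20 row21 /orientation gE ?row20 ?row21//.
  exact: subset_itv_oo_cc.
have cg e : {for t, continuous (g e)}.
  have [_ c1] := pieces_deriv pX t01 ts; have [_ c2] := pieces_deriv pY t01 ts.
  have cc : {for t, continuous (fun t => cos (th t))} by exact: cont_cos.
  have cs : {for t, continuous (fun t => sin (th t))} by exact: cont_sin.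
  have : e * (derive1 X r * sin (th r) - derive1 Y r * cos (th r)) @[r --> t] -->
         e * (derive1 X t * sin (th t) - derive1 Y t * cos (th t)).
    by apply: cvgM; [exact: cvg_cst|apply: cvgB; apply: cvgM].
  rewrite /prop_for /continuous_at gE'//; apply: cvg_trans; apply: near_eq_cvg.
  by apply: filterS (near_off t01 ts) => r [r01 rs]; rewrite gE'.
have g0' e : 0 <= g e t.
  apply: (ae01_at hor _ t01 (cg e)) => r [c E]; rewrite /g E !mxE.
  by rewrite (_ : _ - _ = 0) ?mulr0//; ring.
apply/eqP; rewrite -subr_eq0 eq_le; apply/andP; split.
  by have := g0' (-1); rewrite gE'// mulN1r oppr_ge0.
by have := g0' 1; rewrite gE'// mul1r.
Qed.

Lemma Gamma0_plus_ctl (gamma : R -> R2S1 R) q0 q1 s x y th : lifted s x y th ->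
  (forall t, t \in `[0, 1] -> gamma t = curve_of x y th t) -> Gamma0_plus q0 q1 gamma ->
  forall t, t \in `]0, 1[ -> t \notin s -> 0 <= ctl x y th t.
Proof.
move=> L gE [_ hp] t t01 ts; have [_ <- _] := lifted_controls L gE t01 ts.
apply: (ae01_at hp) => //.
have [c _] := lifted_cont L t01 ts.
have [_ E _] := lifted_controls L gE t01 ts.
have {}c : ctl x y th r @[r --> t] --> ctl x y th t by exact: c.
rewrite /prop_for /continuous_at E; apply: cvg_trans c; apply: near_eq_cvg.
by apply: filterS (near_off t01 ts) => r [r01 rs]; have [_ ->] := lifted_controls L gE r01 rs.
Qed.

Lemma constant_speed_off xi (gamma : R -> R2S1 R) s x y th : lifted s x y th ->
  (forall t, t \in `[0, 1] -> gamma t = curve_of x y th t) -> constant_speed xi gamma ->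
  exists c, forall t, t \in `]0, 1[ -> t \notin s -> speed xi x y th t = c.
Proof.
move=> L gE [c hc]; exists (Num.sqrt c) => t t01 ts.
pose g e r := e * (Num.sqrt (xi ^+ 2 * `|u1 gamma r| ^+ 2 + `|u3 gamma r| ^+ 2) - Num.sqrt c).
have gE' e r : r \in `]0, 1[ -> r \notin s -> g e r = e * (speed xi x y th r - Num.sqrt c).
  by move=> r01 rs; rewrite /g /speed; have [_ -> ->] := lifted_controls L gE r01 rs.
have cg e : {for t, continuous (g e)}.
  have : e * (speed xi x y th r - Num.sqrt c) @[r --> t] -->
         e * (speed xi x y th t - Num.sqrt c).
    apply: cvgM; first exact: cvg_cst.
    have sc : speed xi x y th r @[r --> t] --> speed xi x y th t by exact: speed_cont L t01 ts.
    by apply: cvgB; [exact: sc|exact: cvg_cst].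
  rewrite /prop_for /continuous_at gE'//; apply: cvg_trans; apply: near_eq_cvg.
  by apply: filterS (near_off t01 ts) => r [r01 rs]; rewrite gE'.
have g0' e : 0 <= g e t.
  by apply: (ae01_at hc _ t01 (cg e)) => r E; rewrite /g E subrr mulr0.
apply/eqP; rewrite -subr_eq0 eq_le; apply/andP; split.
  by have := g0' (-1); rewrite gE'// mulN1r oppr_ge0.
by have := g0' 1; rewrite gE'// mul1r.
Qed.

End Lifting.

(** * Reparametrization at nearly constant speed *)

Section Reparametrization.
Context {R : realType}.
Implicit Types (x y th f g sg tau : R -> R) (s : seq R) (a b c t : R).

(** A slope bounded below by c makes [sg] onto and its inverse Lipschitz with constant 1 / c. *)
Lemma increasing_inverse sg c : 0 < c -> continuous sg ->
  (forall r t, r <= t -> c * (t - r) <= sg t - sg r) ->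
  exists tau, [/\ continuous tau, forall z, sg (tau z) = z & forall t, tau (sg t) = t].
Proof.
move=> c0 cs inc.
have /choice[tau tauP] (z : R) : exists t, sg t = z.
  pose N := (`|z| + `|sg 0|) / c.
  have N0 : 0 <= N by rewrite divr_ge0 ?addr_ge0// ltW.
  have cN : c * N = `|z| + `|sg 0| by rewrite /N mulrC divfK// gt_eqF.
  have h1 : sg (- N) <= z.
    have := inc (- N) 0; rewrite oppr_le0 sub0r opprK cN => /(_ N0).
    have := ler_norm (sg 0); have := ler_norm (- z); rewrite normrN; lra.
  have h2 : z <= sg N.
    have := inc 0 N N0; rewrite subr0 cN.
    have := ler_norm (- sg 0); have := ler_norm z; rewrite normrN; lra.
  have NN : - N <= N by lra.
  have [|t _ tz] := IVT NN (continuous_subspaceT cs) (_ : _ <= z <= _); last by exists t.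
  by rewrite ge_min h1 le_max h2 orbT.
have tauK t : tau (sg t) = t.
  have E := tauP (sg t); have [h|/ltW h] := leP t (tau (sg t)).
    have := inc _ _ h; rewrite E subrr pmulr_rle0// subr_le0 => h'.
    by apply/eqP; rewrite eq_le h h'.
  have := inc _ _ h; rewrite E subrr pmulr_rle0// subr_le0 => h'.
  by apply/eqP; rewrite eq_le h h'.
exists tau; split => //.
apply: (@lipschitz_continuous _ _ c^-1) => r t.
wlog rt : r t / tau r <= tau t => [H|].
  have [/H//|/ltW/H] := leP (tau r) (tau t).
  by rewrite distrC (distrC t).
rewrite mulrC ler_pdivlMr// mulrC distrC ger0_norm ?subr_ge0//.
by apply: le_trans (inc _ _ rt) _; rewrite !tauP distrC ler_norm.
Qed.

Lemma partition_map s a b sg : (forall r t, r < t -> sg r < sg t) ->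
  itv_partition a b s -> itv_partition (sg a) (sg b) (map sg s).
Proof.
move=> inc [ps /eqP <-]; split; last by rewrite last_map.
by elim: s a ps => //= c s IH a /andP[ac cs]; rewrite inc//= IH.
Qed.

Lemma inverse_deriv sg tau t d : (forall z, sg (tau z) = z) -> (forall t, tau (sg t) = t) ->
  continuous sg -> deriv1 sg t d -> d != 0 -> deriv1 tau (sg t) d^-1.
Proof.
move=> K1 K2 cs ds d0; apply: (@is_derive_inverse R sg tau d t) => //.
  by near=> r; exact: K2.
by near=> r; exact: cs.
Unshelve. all: by end_near. Qed.

(** The new parameter is proportional to arc length plus eta t. The added term keeps it invertible
    where the curve stands still, at the price of a speed that is bounded by ell + eta instead of
    constant. *)
Lemma reparam xi s x y th Lam ell eta : lifted s x y th -> continuous Lam ->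
  (forall t, t \in `]0, 1[ -> t \notin s -> deriv1 Lam t (speed xi x y th t)) ->
  Lam 1 - Lam 0 = ell -> 0 < eta ->
  exists s' x' y' th', [/\ lifted s' x' y' th',
    curve_of x' y' th' 0 = curve_of x y th 0 /\ curve_of x' y' th' 1 = curve_of x y th 1,
    th' 0 = th 0,
    forall t, t \in `]0, 1[ -> t \notin s' -> speed xi x' y' th' t <= ell + eta &
    (forall t, t \in `]0, 1[ -> t \notin s -> 0 <= ctl x y th t) ->
    forall t, t \in `]0, 1[ -> t \notin s' -> 0 <= ctl x' y' th' t].
Proof.
move=> L cLam dLam ellE eta0.
have [[cx cy cth] [px py pth] hor] := L.
have mono a b : 0 <= a -> a <= b -> b <= 1 -> Lam a <= Lam b.
  move=> a0 ab b1; apply: (le_of_deriv_ge0 (S := s)) => // t; rewrite in_itv/= => /andP[ta tb] ts.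
  exists (speed xi x y th t); last exact: sqrtr_ge0.
  by apply: dLam => //; rewrite in_itv/= (le_lt_trans a0 ta) (lt_le_trans tb).
have ell0 : 0 <= ell by rewrite -ellE subr_ge0 mono.
set T := ell + eta; have T0 : 0 < T by rewrite /T; lra.
have Tn : T != 0 by rewrite gt_eqF.
pose sg t := (Lam (clamp 0 1 t) - Lam 0 + eta * t) / T.
have csg : continuous sg.
  have cl : continuous (fun t => Lam (clamp 0 1 t)) by apply: cont_comp => //; exact: clamp_cont.
  by rewrite /sg; conts.
have c0 : 0 < eta / T by exact: divr_gt0.
have inc r t : r <= t -> eta / T * (t - r) <= sg t - sg r.
  move=> rt; rewrite /sg -mulrBl mulrAC ler_pM2r ?invr_gt0//.
  suff : Lam (clamp 0 1 r) <= Lam (clamp 0 1 t) by lra.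
  have := @clamp_in R 0 1 r ler01; have := @clamp_in R 0 1 t ler01.
  rewrite !in_itv/= => /andP[_ h1] /andP[h2 _]; apply: mono => //.
  by rewrite /clamp ge_max !le_max lexx/= le_min !ge_min lexx rt !orbT.
have sgE t : t \in `[0, 1] -> sg t = (Lam t - Lam 0 + eta * t) / T.
  by move=> t01; rewrite /sg clamp_id.
have I0 : 0 \in `[0, 1 : R] by rewrite in_itv/= lexx ler01.
have I1 : 1 \in `[0, 1 : R] by rewrite in_itv/= lexx ler01.
have sg0 : sg 0 = 0 by rewrite sgE// subrr mulr0 addr0 mul0r.
have sg1 : sg 1 = 1 by rewrite sgE// ellE mulr1 divff.
have [tau [ctau K1 K2]] := increasing_inverse c0 csg inc.
have lt_sg r t : r < t -> sg r < sg t.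
  by move=> rt; rewrite -subr_gt0; apply: lt_le_trans (inc _ _ (ltW rt)); rewrite mulr_gt0 ?subr_gt0.
have lt_sgE r t : (sg r < sg t) = (r < t).
  have [rt|tr|->] := ltgtP r t; [exact: lt_sg| |exact: ltxx].
  by apply/negbTE; rewrite -leNgt ltW// lt_sg.
have le_sgE r t : (sg r <= sg t) = (r <= t) by rewrite !leNgt lt_sgE.
have tau0 : tau 0 = 0 by rewrite -{1}sg0 K2.
have tau1 : tau 1 = 1 by rewrite -{1}sg1 K2.
have tau_oo z : z \in `]0, 1[ -> tau z \in `]0, 1[.
  by rewrite !in_itv/= -{1}sg0 -{1}sg1 -{1 2}(K1 z) !lt_sgE.
have tau_s z : z \notin map sg s -> tau z \notin s.
  by apply: contraNN => h; rewrite -(K1 z) map_f.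
have dsg t : t \in `]0, 1[ -> t \notin s -> deriv1 sg t ((speed xi x y th t + eta) / T).
  move=> t01 ts; apply: (@deriv1_itv _ (fun t => (Lam t - Lam 0 + eta * t) / T) _ 0 1) => //.
    by move=> r /subset_itv_oo_cc/sgE.
  by have ? := dLam t t01 ts; derivs; ring.
have sp0 t : 0 < speed xi x y th t + eta.
  by rewrite (lt_le_trans eta0)// lerDr sqrtr_ge0.
have sgn0 t : (speed xi x y th t + eta) / T != 0 by rewrite gt_eqF// divr_gt0.
have dtau z : z \in `]0, 1[ -> z \notin map sg s ->
    deriv1 tau z ((speed xi x y th (tau z) + eta) / T)^-1.
  move=> z01 zs; have := @inverse_deriv sg tau (tau z) _ K1 K2 csg.
  by rewrite K1; apply => //; apply: dsg; [exact: tau_oo|exact: tau_s].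
have ps' : itv_partition 0 1 (map sg s).
  by have := partition_map lt_sg px.1; rewrite sg0 sg1.
have nthE i : (i <= size s)%N -> nth 0 (0 :: map sg s) i = sg (nth 0 (0 :: s) i).
  move=> si; have -> : 0 :: map sg s = map sg (0 :: s) by rewrite /= sg0.
  by rewrite (nth_map 0).
(* C1 extensions of the coordinates on a piece give a change of parameter [Sg] on the line that
   agrees there with [sg]; composing with its inverse [Tt] yields the required C1 extension. *)
have piece f : pieces s (fun a b => C1_ext a b f) ->
    pieces (map sg s) (fun a b => C1_ext a b (fun z => f (tau z))).
  move=> [_ Hf]; split; first exact: ps'.
  move=> i; rewrite size_map => si; rewrite !nthE//; last exact: ltnW.
  have [F [dF [hF cdF FE]]] := Hf i si.
  have [X [dX [hX cdX XE]]] := px.2 i si; have [Y [dY [hY cdY YE]]] := py.2 i si.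
  have [H [dH [hH cdH HE]]] := pth.2 i si.
  have [l r] := partition_nth_in px.1 si; have ab := partition_nth_lt px.1 si.
  move: l r ab FE XE YE HE; set a := nth _ _ _; set b := nth _ _ _ => l r ab FE XE YE HE.
  have cH : continuous H by move=> t; exact: deriv1_continuous (hH t).
  pose sp t := Num.sqrt (xi ^+ 2 * `|dX t * cos (H t) + dY t * sin (H t)| ^+ 2 + `|dH t| ^+ 2).
  have csp : continuous sp.
    apply: (@cont_comp _ _ Num.sqrt); first exact: sqrt_continuous.
    by conts.
  pose Sg t := sg a + (prim sp t - prim sp a + eta * (t - a)) / T.
  have dSg t : deriv1 Sg t ((sp t + eta) / T).
    by have ? := prim_deriv t csp; rewrite /Sg; derivs; ring.
  have cSg : continuous Sg by move=> t; exact: deriv1_continuous (dSg t).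
  have incS u t : u <= t -> eta / T * (t - u) <= Sg t - Sg u.
    move=> ut; have := @le_deriv_le R (fun t => eta / T * t) Sg [::] u t ut.
    rewrite -mulrBr; apply => //; first by conts.
    move=> v _ _; exists (eta / T), ((sp v + eta) / T); split => //; first by derivs; ring.
    by rewrite ler_pM2r ?invr_gt0// lerDr sqrtr_ge0.
  have [Tt [cT KT1 KT2]] := increasing_inverse c0 cSg incS.
  have itv u : u \in `]a, b[ -> u \in `]0, 1[.
    by rewrite !in_itv/= => /andP[au ub]; rewrite (le_lt_trans l au) (lt_le_trans ub).
  have SgE t : t \in `[a, b] -> sg t = Sg t.
    rewrite in_itv/= => /andP[at1 tb].
    have a01 : a \in `[0, 1] by rewrite in_itv/= l (le_trans (ltW ab)).
    have t01 : t \in `[0, 1] by rewrite in_itv/= (le_trans l at1) (le_trans tb).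
    have E : Lam t - Lam a = prim sp t - prim sp a.
      apply: (eq_deriv_eq (S := s)) => //; first exact: prim_cont.
      move=> u; rewrite in_itv/= => /andP[au ut] us.
      have uab : u \in `]a, b[ by rewrite in_itv/= au (lt_le_trans ut).
      exists (speed xi x y th u); first by apply: dLam => //; exact: itv.
      have dE (g G dG : R -> R) : (forall t, deriv1 G t (dG t)) ->
          (forall t, t \in `[a, b] -> g t = G t) -> derive1 g u = dG u.
        move=> hG gG; apply: deriv1_val; apply: (@deriv1_itv _ G g a b) => //.
        by move=> v /subset_itv_oo_cc/gG ->.
      apply: (deriv1_eq (prim_deriv u csp)).
      rewrite /sp /speed /ctl (dE x X dX)// (dE y Y dY)// (dE th H dH)// HE//.
      exact: subset_itv_oo_cc.
    by rewrite /Sg !sgE// -E; ring.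
  have dT z : deriv1 Tt z ((sp (Tt z) + eta) / T)^-1.
    have := @inverse_deriv Sg Tt (Tt z) _ KT1 KT2 cSg (dSg (Tt z)); rewrite KT1; apply.
    by rewrite gt_eqF// divr_gt0// (lt_le_trans eta0)// lerDr sqrtr_ge0.
  exists (fun z => F (Tt z)), (fun z => dF (Tt z) * ((sp (Tt z) + eta) / T)^-1); split.
  - by move=> z; exact: deriv1_comp (hF (Tt z)) (dT z).
  - apply: contM; first exact: cont_comp.
    have cg : continuous (fun z => (sp (Tt z) + eta) / T).
      by conts; apply: (@cont_comp _ _ sp Tt).
    move=> z; apply: cvgV; last exact: cg.
    by rewrite gt_eqF// divr_gt0// (lt_le_trans eta0)// lerDr sqrtr_ge0.
  - move=> z; rewrite in_itv/= -{1 2}(K1 z) !le_sgE => zab.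
    rewrite FE ?in_itv//=; congr F; rewrite -[LHS]KT2; congr Tt.
    by rewrite -SgE ?in_itv// K1.
have dcomp f z : pieces s (fun a b => C1_ext a b f) -> z \in `]0, 1[ -> z \notin map sg s ->
    derive1 (fun z => f (tau z)) z =
    derive1 f (tau z) * ((speed xi x y th (tau z) + eta) / T)^-1.
  move=> pf z01 zs; apply: deriv1_val; apply: deriv1_comp; last exact: dtau.
  by have [] := pieces_deriv pf (tau_oo _ z01) (tau_s _ zs).
exists (map sg s), (fun z => x (tau z)), (fun z => y (tau z)), (fun z => th (tau z)).
have ctlE z : z \in `]0, 1[ -> z \notin map sg s ->
    ctl (fun z => x (tau z)) (fun z => y (tau z)) (fun z => th (tau z)) z =
    ctl x y th (tau z) * ((speed xi x y th (tau z) + eta) / T)^-1.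
  by move=> z01 zs; rewrite /ctl !dcomp//; ring.
have si0 t : 0 < ((speed xi x y th t + eta) / T)^-1 by rewrite invr_gt0 divr_gt0.
split.
- split.
  + by split; apply: cont_comp.
  + by split; apply: piece.
  + move=> z z01 zs; rewrite !dcomp// -!mulrA.
    rewrite [X in derive1 x _ * X]mulrC [X in derive1 y _ * X]mulrC !mulrA hor//.
      exact: tau_oo.
    exact: tau_s.
- by rewrite /curve_of tau0 tau1.
- by rewrite tau0.
(* The new speed is T v / (v + eta), with v the old one, hence at most T. *)
- move=> z z01 zs; rewrite {1}/speed ctlE// dcomp//.
  move: (tau z) => t; rewrite !normrM !exprMn mulrA -mulrDl sqrtrM; last first.
    by apply: addr_ge0; [apply: mulr_ge0|]; exact: sqr_ge0.
  rewrite sqrtr_sqr normr_id (gtr0_norm (si0 t)) -/(speed xi x y th t) invf_div.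
  rewrite mulrA ler_pdivrMr// mulrC ler_pM2l//.
  by rewrite lerDl ltW.
- move=> u0 z z01 zs; rewrite ctlE// mulr_ge0//; last exact: ltW.
  by apply: u0; [exact: tau_oo|exact: tau_s].
Qed.

End Reparametrization.

(** * Distances *)

Section Distances.
Context {R : realType}.
Variable xi : R.
Implicit Types (x y th f g X Y V W Th Lam : R -> R) (s S : seq R) (a b c t : R).
Implicit Types (P Q : R2P1 R) (gamma : R -> R2S1 R).

Definition joins x y th P Q :=
  class_of (curve_of x y th 0) = P /\ class_of (curve_of x y th 1) = Q.

Lemma R2P1_angle P : exists a b c, P = class_of (row2 a b, circ c).
Proof.
case: P => v n; have [c E _] := circP (repr n).
by exists (v 0 0), (v 0 1), c; rewrite /class_of /= row2_eta -E reprK.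
Qed.

Lemma lifted_curve_length s x y th Lam S : lifted s x y th -> continuous Lam ->
  (forall t, t \in `]0, 1[ -> t \notin S -> deriv1 Lam t (speed xi x y th t)) ->
  curve_length xi (curve_of x y th) = (Lam 1 - Lam 0)%:E.
Proof.
move=> L cLam dLam; have [G [cG dG ->]] := lifted_length xi L (fun _ _ => erefl).
congr EFin; apply: (@eq_deriv_eq _ _ _ (s ++ S)) => // t t01.
rewrite mem_cat negb_or => /andP[ts tS]; exists (speed xi x y th t); first exact: dG.
exact: dLam.
Qed.

Lemma min_lifts_le (d : R2S1 R -> R2S1 R -> \bar R) (p q : R2S1 R) :
  (min_lifts d (class_of p) (class_of q) <= d p q)%E.
Proof. by apply: ereal_inf_lbound; exists p => //; exists q. Qed.

Lemma d_proj_le s x y th Lam S P Q : lifted s x y th -> joins x y th P Q ->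
  continuous Lam ->
  (forall t, t \in `]0, 1[ -> t \notin S -> deriv1 Lam t (speed xi x y th t)) ->
  (d_proj xi P Q <= (Lam 1 - Lam 0)%:E)%E.
Proof.
move=> L [<- <-] cLam dLam; apply: le_trans (min_lifts_le _ _ _) _.
rewrite -(lifted_curve_length L cLam dLam); apply: ereal_inf_lbound.
by exists (curve_of x y th) => //; exact: lifted_Gamma0 L.
Qed.

Lemma d_c_le s x y th Lam S P Q : lifted s x y th -> joins x y th P Q ->
  (forall t, t \in `]0, 1[ -> t \notin s -> 0 <= ctl x y th t) ->
  continuous Lam ->
  (forall t, t \in `]0, 1[ -> t \notin S -> deriv1 Lam t (speed xi x y th t)) ->
  (d_c xi P Q <= (Lam 1 - Lam 0)%:E)%E.
Proof.
move=> L [<- <-] u0 cLam dLam; apply: le_trans (min_lifts_le _ _ _) _.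
rewrite -(lifted_curve_length L cLam dLam); apply: ereal_inf_lbound.
by exists (curve_of x y th) => //; exact: lifted_Gamma0_plus L u0.
Qed.

Lemma min_lifts_lt (d : R2S1 R -> R2S1 R -> \bar R) P Q (r : \bar R) :
  (min_lifts d P Q < r)%E -> exists q0 q1, [/\ lifts P q0, lifts Q q1 & (d q0 q1 < r)%E].
Proof. by move=> /ereal_inf_lt[_ [q0 q0P [q1 q1Q <-]]]; exists q0, q1. Qed.

Lemma lift_joins gamma q0 q1 x y th P Q : lifts P q0 -> lifts Q q1 -> Gamma0 q0 q1 gamma ->
  (forall t, t \in `[0, 1] -> gamma t = curve_of x y th t) -> joins x y th P Q.
Proof.
move=> <- <- [_ <- <- _] gE; split; rewrite gE// in_itv/= lexx ler01//.
Qed.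

Lemma d_proj_lt P Q (r : R) : (d_proj xi P Q < r%:E)%E ->
  exists s x y th Lam, [/\ lifted s x y th /\ joins x y th P Q, `|th 0| <= pi,
    continuous Lam,
    forall t, t \in `]0, 1[ -> t \notin s -> deriv1 Lam t (speed xi x y th t) &
    Lam 1 - Lam 0 < r].
Proof.
move=> /min_lifts_lt[q0 [q1 [Pq0 Qq1 /ereal_inf_lt[_ [gamma Gg <-] lr]]]].
have [s [x [y [th [L gE thpi]]]]] := Gamma0_lift Gg.
have [Lam [cL dL lE]] := lifted_length xi L gE.
exists s, x, y, th, Lam; split => //; last by move: lr; rewrite lE lte_fin.
by split => //; exact: lift_joins Pq0 Qq1 Gg gE.
Qed.

Lemma d_c_lt P Q (r : R) : (d_c xi P Q < r%:E)%E ->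
  exists s x y th Lam, [/\ lifted s x y th /\ joins x y th P Q,
    (forall t, t \in `]0, 1[ -> t \notin s -> 0 <= ctl x y th t) /\ `|th 0| <= pi,
    continuous Lam,
    forall t, t \in `]0, 1[ -> t \notin s -> deriv1 Lam t (speed xi x y th t) &
    Lam 1 - Lam 0 < r].
Proof.
move=> /min_lifts_lt[q0 [q1 [Pq0 Qq1 /ereal_inf_lt[_ [gamma Gg <-] lr]]]].
have [s [x [y [th [L gE thpi]]]]] := Gamma0_lift Gg.1.
have [Lam [cL dL lE]] := lifted_length xi L gE.
exists s, x, y, th, Lam; split => //; last by move: lr; rewrite lE lte_fin.
  by split => //; exact: lift_joins Pq0 Qq1 Gg.1 gE.
by split => //; exact: Gamma0_plus_ctl L gE Gg.
Qed.

Lemma curve_length_ge0 gamma : (0 <= curve_length xi gamma)%E.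
Proof. by apply: integral_ge0 => t _; rewrite lee_fin sqrtr_ge0. Qed.

Lemma d_proj_ge0 P Q : (0 <= d_proj xi P Q)%E.
Proof.
apply: le_ereal_inf_tmp => _ [q0 _ [q1 _ <-]].
by apply: le_ereal_inf_tmp => _ [gamma _ <-]; exact: curve_length_ge0.
Qed.

Lemma d_proj_le_d_c P Q : (d_proj xi P Q <= d_c xi P Q)%E.
Proof.
apply: le_ereal_inf_tmp => _ [q0 Pq0 [q1 Qq1 <-]].
apply: le_ereal_inf_tmp => _ [gamma [Gg _] <-].
apply: (@le_trans _ _ (d_F0 xi q0 q1)).
  by apply: ereal_inf_lbound; exists q0 => //; exists q1.
by apply: ereal_inf_lbound; exists gamma.
Qed.

Lemma smooth_C1 f d s : (forall t, deriv1 f t (d t)) -> continuous d ->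
  itv_partition 0 1 s -> pieces s (fun a b => C1_ext a b f).
Proof. by move=> df cd ps; split => // i _; exists f, d. Qed.

Lemma partition1 : itv_partition 0 1 [:: 1 : R].
Proof. exact: itv_partition1. Qed.

Lemma angle_lifted s X Y Th W : continuous Th -> pieces s (fun a b => C1_ext a b Th) ->
  continuous W -> (forall t, deriv1 X t (W t * cos (Th t))) ->
  (forall t, deriv1 Y t (W t * sin (Th t))) ->
  lifted s X Y Th /\ forall t, ctl X Y Th t = W t.
Proof.
move=> cTh pTh cW dX dY; have ps := pTh.1.
have cX : continuous X by move=> t; exact: deriv1_continuous (dX t).
have cY : continuous Y by move=> t; exact: deriv1_continuous (dY t).
split; last first.
  move=> t; rewrite /ctl (deriv1_val (dX t)) (deriv1_val (dY t)).
  by rewrite -[RHS]mulr1 -(cos2Dsin2 (Th t)); ring.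
split => //.
  split => //; first by apply: (smooth_C1 dX) => //; conts.
  by apply: (smooth_C1 dY) => //; conts.
by move=> t _ _; rewrite (deriv1_val (dX t)) (deriv1_val (dY t)); ring.
Qed.

Lemma joins_angles x y th a b al a' b' be :
  joins x y th (class_of (row2 a b, circ al)) (class_of (row2 a' b', circ be)) <->
  [/\ x 0 = a, y 0 = b & sin (th 0 - al) = 0] /\ [/\ x 1 = a', y 1 = b' & sin (th 1 - be) = 0].
Proof.
rewrite /joins /curve_of; split.
  by move=> [/class_circ[/row2_inj[-> ->] ->] /class_circ[/row2_inj[-> ->] ->]].
by move=> [[-> -> h1] [-> -> h2]]; split; apply/class_circ.
Qed.

End Distances.

(** * Geodesics *)

Section Minimizers.
Context {R : realType}.
Variable xi : R.
Hypothesis xi0 : 0 < xi.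
Implicit Types (x y th f g X Y V W Th Lam : R -> R) (s S : seq R) (a b c t p q m : R).
Implicit Types (P Q : R2P1 R) (gamma : R -> R2S1 R).

(** The moment equations say exactly that the control [pn p q th], integrated along [th], produces
    the required displacement. *)
Lemma angle_joins s th p q a b al a' b' be : continuous th ->
  pieces s (fun a b => C1_ext a b th) ->
  sin (th 0 - al) = 0 -> sin (th 1 - be) = 0 -> moment_eq (a' - a) (b' - b) th p q ->
  exists X Y, [/\ lifted s X Y th, forall t, ctl X Y th t = pn p q (th t),
    forall t, deriv1 X t (pn p q (th t) * cos (th t)) /\
              deriv1 Y t (pn p q (th t) * sin (th t)) &
    joins X Y th (class_of (row2 a b, circ al)) (class_of (row2 a' b', circ be))].
Proof.
move=> ct pt h0 h1 [e1 e2].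
have cp : continuous (fun t => pn p q (th t)) by exact: cont_pn.
have cc : continuous (fun t => pn p q (th t) * cos (th t)) by conts.
have cs : continuous (fun t => pn p q (th t) * sin (th t)) by conts.
pose X t := a + prim (fun t => pn p q (th t) * cos (th t)) t.
pose Y t := b + prim (fun t => pn p q (th t) * sin (th t)) t.
have dX t : deriv1 X t (pn p q (th t) * cos (th t)).
  by have ? := prim_deriv t cc; rewrite /X; derivs; rewrite add0r.
have dY t : deriv1 Y t (pn p q (th t) * sin (th t)).
  by have ? := prim_deriv t cs; rewrite /Y; derivs; rewrite add0r.
have [L ctlE] := angle_lifted ct pt cp dX dY.
exists X, Y; split => //; apply/joins_angles.
have [X1 Y1] := prim_moment p q ct; rewrite e1 in X1; rewrite e2 in Y1.
by split; split => //; rewrite /X /Y ?prim0 ?addr0// ?X1 ?Y1 addrC subrK.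
Qed.

Lemma speed_sqr x y th t :
  speed xi x y th t ^+ 2 = xi ^+ 2 * ctl x y th t ^+ 2 + derive1 th t ^+ 2.
Proof.
rewrite /speed sqr_sqrtr ?real_normK ?num_real//.
by apply: addr_ge0; [apply: mulr_ge0|]; exact: sqr_ge0.
Qed.

(** The curve that [angle_joins] attaches to [th] has length l >= m, and its energy is at least l^2:
    integrate 2 l v <= v^2 + l^2 for the speed v. *)
Lemma d_proj_lower_bound m a b al a' b' be : 0 <= m ->
  (m%:E <= d_proj xi (class_of (row2 a b, circ al)) (class_of (row2 a' b', circ be)))%E ->
  energy_lower_bound xi m al be (a' - a) (b' - b).
Proof.
move=> m0 md th w Qf S p q [ct [s pt] [h0 h1] cQ dQ] me.
have [X [Y [L ctlE _ J]]] := angle_joins ct pt h0 h1 me.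
have [Lam [cL dL _]] := lifted_length xi L (fun _ _ => erefl).
have := le_trans md (d_proj_le L J cL dL); rewrite lee_fin; set l := Lam 1 - Lam 0 => ml.
apply: (@le_trans _ _ (l ^+ 2)); first by rewrite lerXn2r ?nnegrE// (le_trans m0).
have cp : continuous (fun t => pn p q (th t) ^+ 2) by apply: contX; exact: cont_pn.
rewrite -(moment_energy ct me).
pose G t := Qf t + xi ^+ 2 * prim (fun t => pn p q (th t) ^+ 2) t + l ^+ 2 * t.
have cG : continuous G by rewrite /G; conts; exact: prim_cont.
have c2 : continuous (fun t => 2 * l * Lam t) by conts.
have := @le_deriv_le R (fun t => 2 * l * Lam t) G (s ++ S) 0 1 ler01 c2 cG.
rewrite -mulrBr -/l /G prim0// => h; suff : 2 * l * l <= Qf 1 +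
  xi ^+ 2 * prim (fun t => pn p q (th t) ^+ 2) 1 + l ^+ 2 * 1 - (Qf 0 + xi ^+ 2 * 0 + l ^+ 2 * 0).
  by rewrite expr2; lra.
apply: h => t t01; rewrite mem_cat negb_or => /andP[ts tS].
have [dt dq] := dQ t t01 tS; have d1 := dL t t01 ts; have d2 := prim_deriv t cp.
exists (2 * l * speed xi X Y th t), (speed xi X Y th t ^+ 2 + l ^+ 2); split.
- by derivs; ring.
- by rewrite /G speed_sqr ctlE (deriv1_val dt); derivs; ring.
- by have := sqr_ge0 (speed xi X Y th t - l); rewrite sqrrB; lra.
Qed.

(** A nonconstant affine angle has an invertible moment matrix, so it can be completed to a curve
    with any given displacement. *)
Lemma d_proj_fin P Q : exists2 m, 0 <= m & d_proj xi P Q = m%:E.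
Proof.
suff [r dr] : exists r : R, (d_proj xi P Q <= r%:E)%E.
  have := d_proj_ge0 xi P Q; move: dr; case: (d_proj xi P Q) => // m _.
  by rewrite lee_fin => m0; exists m.
have [a [b [al ->]]] := R2P1_angle P; have [a' [b' [be ->]]] := R2P1_angle Q.
(* When the two angles are equal, half a turn makes the affine angle nonconstant without changing
   the end point in the projective line. *)
pose be' := if be == al then be + pi else be.
have bb : be' - al != 0.
  rewrite /be'; have [->|nb] := eqVneq be al; last by rewrite subr_eq0.
  by rewrite addrAC subrr add0r gt_eqF// pi_gt0.
have sb : sin (be' - be) = 0.
  rewrite /be'; have [->|nb] := eqVneq be al; last by rewrite subrr sin0.
  by rewrite addrAC subrr add0r sinpi.
pose th t := al + (be' - al) * t.
have dth t : deriv1 th t (be' - al) by rewrite /th; derivs; ring.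
have ct : continuous th by move=> t; exact: deriv1_continuous (dth t).
have pt : pieces [:: 1] (fun a b => C1_ext a b th).
  by apply: (smooth_C1 dth); [by conts|exact: partition1].
have det0 : Ma th * Mc th - Mb th * Mb th != 0.
  apply/eqP => det0; rewrite -expr2 in det0.
  have [v1 [v2 [vn _ pn0]]] := moment_singular ct det0.
  have I0 : 0 \in `[0, 1 : R] by rewrite in_itv/= lexx ler01.
  have I1 : 1 \in `[0, 1 : R] by rewrite in_itv/= lexx ler01.
  have := @sin_eq0_const R (fun t => th t - th 0) _ _ _ 1 I1.
  rewrite subrr /th mulr0 mulr1 addr0 addrAC subrr add0r => E.
  move/eqP: bb; apply; apply: E => //.
    by conts.
  move=> t t01; have := pn_zero_sin vn (pn0 t t01) (pn0 0 I0).
  by rewrite /th mulr0 addr0.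
pose d := Ma th * Mc th - Mb th * Mb th.
have me : moment_eq (a' - a) (b' - b) th
    (((a' - a) * Mc th - (b' - b) * Mb th) / d) (((b' - b) * Ma th - (a' - a) * Mb th) / d).
  by move: det0; rewrite /moment_eq /d => h; split; field.
have [||X [Y [L ctlE _ J]]] := angle_joins (al := al) (be := be) ct pt _ _ me.
- by rewrite /th mulr0 addr0 subrr sin0.
- by have -> : th 1 - be = be' - be by rewrite /th; ring.
have [Lam [cL dL _]] := lifted_length xi L (fun _ _ => erefl).
by exists (Lam 1 - Lam 0); exact: d_proj_le L J cL dL.
Qed.

Lemma lifted_controlled s x y th a b al a' b' be : lifted s x y th ->
  joins x y th (class_of (row2 a b, circ al)) (class_of (row2 a' b', circ be)) ->
  exists Qf E, controlled al be (a' - a) (b' - b) th (derive1 th) Qf (ctl x y th) x y E s /\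
    forall c, (forall t, t \in `]0, 1[ -> t \notin s -> speed xi x y th t <= c) ->
      Qf 1 - Qf 0 + xi ^+ 2 * (E 1 - E 0) <= c ^+ 2.
Proof.
move=> L /joins_angles[[x0 y0 t0] [x1 y1 t1]].
have [B HB] := lifted_bounded L.
have sq (f : R -> R) : (forall t, t \in `]0, 1[ -> t \notin s ->
      {for t, continuous f} /\ `|f t| <= B) ->
    exists G, continuous G /\ forall t, t \in `]0, 1[ -> t \notin s -> deriv1 G t (f t ^+ 2).
  move=> H; have [|G [cG dG _]] := @piecewise_primitive R (fun t => f t ^+ 2) s (B ^+ 2) _ _ ltr01.
    move=> t t01 ts; have [cf fB] := H t t01 ts; split; first by apply: cvgM.
    by rewrite normrX lerXn2r ?nnegrE// (le_trans _ fB).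
  by exists G.
have [|Qf [cQ dQ]] := sq (derive1 th).
  by move=> t t01 ts; have [_ c2] := lifted_cont L t01 ts; have [_ b2] := HB t t01 ts.
have [|E [cE dE]] := sq (ctl x y th).
  by move=> t t01 ts; have [c1 _] := lifted_cont L t01 ts; have [b1 _] := HB t t01 ts.
have [[cx cy ct] [_ _ pt] _] := L.
exists Qf, E; split.
  split.
  - split => //; first by exists s.
    by move=> t t01 ts; have [_ _ dt] := lifted_deriv L t01 ts; split => //; exact: dQ.
  - by [].
  - by rewrite x0 x1 y0 y1.
  - by move=> t t01 ts; have [dx dy _] := lifted_deriv L t01 ts; split => //; exact: dE.
move=> c sc; pose G t := Qf t + xi ^+ 2 * E t.
have := @le_deriv_le R G (fun t => c ^+ 2 * t) s 0 1 ler01.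
rewrite mulr1 mulr0 subr0 (_ : G 1 - G 0 = Qf 1 - Qf 0 + xi ^+ 2 * (E 1 - E 0)); last first.
  by rewrite /G; ring.
apply; [by rewrite /G; conts|by conts|] => t t01 ts.
have h1 := dQ t t01 ts; have h2 := dE t t01 ts.
exists (speed xi x y th t ^+ 2), (c ^+ 2); split.
- by rewrite speed_sqr /G; derivs; ring.
- by derivs; ring.
- have := sc t t01 ts; have : 0 <= speed xi x y th t by exact: sqrtr_ge0.
  by move=> h h'; rewrite lerXn2r ?nnegrE// (le_trans h).
Qed.

(** The last equation says that the squared speed is m^2. Breakpoints have disappeared: position and
    angle are differentiable on the line, and only the dynamics is confined to [0, 1]. *)
Definition geodesic m p q X Y Th V := [/\ forall t, deriv1 Th t (V t), continuous V,
  forall t, deriv1 X t (pn p q (Th t) * cos (Th t)) /\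
            deriv1 Y t (pn p q (Th t) * sin (Th t)) &
  forall t, t \in `[0, 1] ->
    deriv1 V t (- (xi ^+ 2 * force p q Th t)) /\
    V t ^+ 2 + xi ^+ 2 * pn p q (Th t) ^+ 2 = m ^+ 2].

(** The squared speed is a first integral of the equation, so it equals the total energy, which is
    at most m^2 by extremality and at least m^2 by [d_proj_lower_bound]. *)
Lemma extremal_geodesic m a b al a' b' be Th V p q : 0 <= m ->
  (m%:E <= d_proj xi (class_of (row2 a b, circ al)) (class_of (row2 a' b', circ be)))%E ->
  extremal xi m al be (a' - a) (b' - b) Th V p q ->
  exists X Y, geodesic m p q X Y Th V /\
    joins X Y Th (class_of (row2 a b, circ al)) (class_of (row2 a' b', circ be)).
Proof.
move=> m0 md [dTh cV dV [me [h0 h1]] Em].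
have cTh : continuous Th by move=> t; exact: deriv1_continuous (dTh t).
have pT : pieces [:: 1] (fun a b => C1_ext a b Th) by exact: smooth_C1 dTh cV partition1.
have [X [Y [_ _ dXY J]]] := angle_joins cTh pT h0 h1 me.
exists X, Y; split => //; split => // t t01; split; first exact: dV.
pose H t := V t ^+ 2 + xi ^+ 2 * pn p q (Th t) ^+ 2.
have cp : continuous (fun t => pn p q (Th t)) by exact: cont_pn.
have cH : continuous H by rewrite /H; conts.
have dH r : r \in `]0, 1[ -> r \notin [::] -> deriv1 H r 0.
  move=> r01 _; have d1 := dV r (subset_itv_oo_cc r01).
  have d2 := deriv1_pn p q (dTh r).
  apply: deriv1_eq (deriv1D (deriv1X 1 d1) (deriv1M (deriv1_cst (xi ^+ 2) r) (deriv1X 1 d2))) _.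
  by rewrite /force; ring.
have HE r : r \in `[0, 1] -> H r = H 0.
  rewrite in_itv/= => /andP[r0 r1]; apply/esym; apply: (eq_of_deriv0 (S := [::])) => // v.
  by rewrite in_itv/= => /andP[v0 vr] vS; apply: dH => //; rewrite in_itv/= v0 (lt_le_trans vr).
have cV2 : continuous (fun t => V t ^+ 2) by conts.
have cp2 : continuous (fun t => pn p q (Th t) ^+ 2) by conts.
have tot : prim (fun t => V t ^+ 2) 1 + xi ^+ 2 * (p * (a' - a) + q * (b' - b)) = H 0.
  rewrite -(moment_energy cTh me) -primZ// -primD//; last by conts.
  rewrite -[RHS]mulr1 -(@prim_cst R (H 0) 1)//; apply: eq_prim => //; first by conts.
  by move=> r r01; rewrite -[RHS](HE r)//; exact: subset_itv_oo_cc.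
rewrite -/(H t) HE//; apply/eqP; rewrite eq_le -{1}tot Em/=.
have := d_proj_lower_bound m0 md (w := V) (Q := prim (fun t => V t ^+ 2)) (S := [::]) (th := Th).
move=> /(_ p q); rewrite prim0// subr0 tot; apply => //.
split => //; [by exists [:: 1]|exact: prim_cont|] => r _ _.
by split; [exact: dTh|exact: prim_deriv].
Qed.

End Minimizers.

Section Geodesics.
Context {R : realType}.
Variable xi : R.
Hypothesis xi0 : 0 < xi.
Implicit Types (x y th f g X Y V W Th Lam : R -> R) (s S : seq R) (a b c t p q m : R).
Implicit Types (P Q : R2P1 R) (gamma : R -> R2S1 R).

Lemma derive1_le_speed x y th t : `|derive1 th t| <= speed xi x y th t.
Proof.
rewrite -sqrtr_sqr -(real_normK (num_real (derive1 th t))) /speed ler_wsqrtr// lerDr.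
by apply: mulr_ge0; exact: sqr_ge0.
Qed.

Lemma geodesic_of_sequence m P Q (s : nat -> seq R) (x y th : nat -> R -> R) (B : R) :
  0 <= m -> d_proj xi P Q = m%:E ->
  (forall k, lifted (s k) (x k) (y k) (th k) /\ joins (x k) (y k) (th k) P Q) ->
  (forall k t, t \in `]0, 1[ -> t \notin s k ->
    speed xi (x k) (y k) (th k) t <= m + 2 * k.+1%:R^-1) ->
  (forall k, `|th k 0| <= B) ->
  exists (U : set_system nat) (X Y Th V : R -> R) (p q : R),
    [/\ UltraFilter U, geodesic xi m p q X Y Th V, joins X Y Th P Q,
      forall t, t \in `[0, 1] -> th k t @[k --> U] --> Th t &
      (forall k t, t \in `]0, 1[ -> t \notin s k -> 0 <= ctl (x k) (y k) (th k) t) ->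
      (forall t, t \in `]0, 1[ -> 0 <= pn p q (Th t)) \/ (forall t, V t = 0)].
Proof.
have [a [b [al ->]]] := R2P1_angle P; have [a' [b' [be ->]]] := R2P1_angle Q.
move=> m0 md L Hs Hth.
have /choice[QE HQ] k : exists QE : (R -> R) * (R -> R),
    controlled al be (a' - a) (b' - b) (th k) (derive1 (th k)) QE.1
      (ctl (x k) (y k) (th k)) (x k) (y k) QE.2 (s k) /\
    QE.1 1 - QE.1 0 + xi ^+ 2 * (QE.2 1 - QE.2 0) <=
      m ^+ 2 + ((m + 2 * k.+1%:R^-1) ^+ 2 - m ^+ 2).
  have [Qf [E [HC HE]]] := lifted_controlled xi (L k).1 (L k).2.
  exists (Qf, E); split => //=; rewrite [leRHS]addrC subrK; apply: HE; exact: Hs.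
have md' : (m%:E <= d_proj xi (class_of (row2 a b, circ al)) (class_of (row2 a' b', circ be)))%E.
  by rewrite md lexx.
have LB := d_proj_lower_bound m0 md'.
have Hd : (fun k => (m + 2 * k.+1%:R^-1) ^+ 2 - m ^+ 2 : R) k @[k --> \oo] --> (0 : R).
  have h : (fun k => m + 2 * k.+1%:R^-1 : R) k @[k --> \oo] --> m.
    rewrite -[X in _ --> X]addr0 -[X in _ --> _ + X](mulr0 2).
    apply: cvgD; first exact: cvg_cst.
    by apply: cvgM; [exact: cvg_cst|exact: cvg_harmonic].
  rewrite -[X in _ --> X](subrr (m ^+ 2)).
  by apply: cvgB; [rewrite !expr2; under eq_fun do rewrite expr2; exact: cvgM|exact: cvg_cst].
have Hw k t : t \in `]0, 1[ -> t \notin s k -> `|derive1 (th k) t| <= Num.max B (m + 2).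
  move=> t01 ts; apply: le_trans (derive1_le_speed (x k) (y k) (th k) t) _.
  apply: le_trans (Hs k t t01 ts) _; rewrite le_max; apply/orP; right.
  by rewrite lerD2l ler_piMr// invf_le1// ler1n.
have Hth' k : `|th k 0| <= Num.max B (m + 2) by rewrite le_max Hth.
have [U [phi [V [p [q [UU ex hphi sgn]]]]]] :=
  extremal_of_minimizing_sequence xi0 LB (fun k => (HQ k).1) (fun k => (HQ k).2) Hd Hth' Hw.
have [X [Y [G J]]] := extremal_geodesic m0 md' ex.
by exists U, X, Y, phi, V, p, q.
Qed.

(** The proposition [pos] lets one proof serve both distances: it is [False] for [d_proj] and [True]
    for [d_c]. *)
Lemma geodesic_of_infimum m P Q (pos : Prop) : 0 <= m -> d_proj xi P Q = m%:E ->
  (forall r, m < r -> exists s x y th Lam, [/\ lifted s x y th /\ joins x y th P Q,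
    pos -> (forall t, t \in `]0, 1[ -> t \notin s -> 0 <= ctl x y th t), `|th 0| <= pi,
    continuous Lam /\
    forall t, t \in `]0, 1[ -> t \notin s -> deriv1 Lam t (speed xi x y th t) &
    Lam 1 - Lam 0 < r]) ->
  exists X Y Th V p q, [/\ geodesic xi m p q X Y Th V, joins X Y Th P Q &
    pos -> (forall t, t \in `]0, 1[ -> 0 <= pn p q (Th t)) \/ (forall t, V t = 0)].
Proof.
move=> m0 md H.
have /choice[z Hz] k : exists z : seq R * (R -> R) * (R -> R) * (R -> R), let: (s, x, y, th) := z in
    [/\ lifted s x y th /\ joins x y th P Q, `|th 0| <= pi,
      forall t, t \in `]0, 1[ -> t \notin s -> speed xi x y th t <= m + 2 * k.+1%:R^-1 &
      pos -> forall t, t \in `]0, 1[ -> t \notin s -> 0 <= ctl x y th t].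
  have k0 : 0 < k.+1%:R^-1 :> R by rewrite invr_gt0.
  (* One half of the excess 2 / (k + 1) pays for the length, the other half is the eta of
     [reparam]. *)
  have [|s [x [y [th [Lam [[L J] u0 thpi [cL dL] lr]]]]]] := H (m + k.+1%:R^-1).
    by rewrite ltrDl.
  have [s' [x' [y' [th' [L' [E0 E1] th0 sp u']]]]] := reparam L cL dL (erefl _) k0.
  exists (s', x', y', th'); split.
  - by split => //; move: J; rewrite /joins E0 E1.
  - by rewrite th0.
  - move=> t t01 ts; apply: le_trans (sp t t01 ts) _.
    by rewrite mulr_natl mulr2n addrA lerD2r ltW.
  - by move=> hp; apply: u'; exact: u0.
have Hz' k : let: (s, x, y, th) := z k in z k = (s, x, y, th) by case: (z k) => [[[]]].
pose s k := (z k).1.1.1; pose x k := (z k).1.1.2; pose y k := (z k).1.2; pose th k := (z k).2.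
have HH k : [/\ lifted (s k) (x k) (y k) (th k) /\ joins (x k) (y k) (th k) P Q, `|th k 0| <= pi,
      forall t, t \in `]0, 1[ -> t \notin s k -> speed xi (x k) (y k) (th k) t <= m + 2 * k.+1%:R^-1 &
      pos -> forall t, t \in `]0, 1[ -> t \notin s k -> 0 <= ctl (x k) (y k) (th k) t].
  by have := Hz k; rewrite /s /x /y /th; case: (z k) => [[[? ?] ?] ?].
have [||U [X [Y [Th [V [p [q [_ G J _ sgn]]]]]]]] :=
  @geodesic_of_sequence m P Q s x y th pi m0 md (fun k => let: And4 h _ _ _ := HH k in h).
- by move=> k; have [] := HH k.
- by move=> k; have [] := HH k.
exists X, Y, Th, V, p, q; split => // hp; apply: sgn => k.
by have [_ _ _ h] := HH k; exact: h.
Qed.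

Lemma geodesic_exists m P Q : 0 <= m -> d_proj xi P Q = m%:E ->
  exists X Y Th V p q, geodesic xi m p q X Y Th V /\ joins X Y Th P Q.
Proof.
move=> m0 md; have [|X [Y [Th [V [p [q [G J _]]]]]]] := @geodesic_of_infimum m P Q False m0 md.
  move=> r mr; have [|s [x [y [th [Lam [L thpi cL dL lr]]]]]] := @d_proj_lt R xi P Q r.
    by rewrite md lte_fin.
  by exists s, x, y, th, Lam.
by exists X, Y, Th, V, p, q.
Qed.

Lemma geodesic_exists_plus m P Q : 0 <= m -> d_proj xi P Q = m%:E -> d_c xi P Q = m%:E ->
  exists X Y Th V p q, [/\ geodesic xi m p q X Y Th V, joins X Y Th P Q &
    (forall t, t \in `]0, 1[ -> 0 <= pn p q (Th t)) \/ (forall t, V t = 0)].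
Proof.
move=> m0 md mc; have [|X [Y [Th [V [p [q [G J sgn]]]]]]] := @geodesic_of_infimum m P Q True m0 md.
  move=> r mr; have [|s [x [y [th [Lam [L [u0 thpi] cL dL lr]]]]]] := @d_c_lt R xi P Q r.
    by rewrite mc lte_fin.
  by exists s, x, y, th, Lam.
by exists X, Y, Th, V, p, q; split => //; exact: sgn.
Qed.

End Geodesics.

Lemma constant_sign {R : realType} (f : R -> R) (a b : R) : continuous f -> (forall t : R, t \in `]a, b[ -> f t != 0) ->
  (forall t : R, t \in `]a, b[ -> 0 <= f t) \/ (forall t : R, t \in `]a, b[ -> f t <= 0).
Proof.
move=> cf f0; have [[s [sab fs]]|] := pselect (exists s, (s \in `]a, b[) /\ f s < 0); last first.
  move=> h; left => t tab; rewrite leNgt; apply/negP => ft; apply: h; by exists t.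
right => t tab; rewrite leNgt; apply/negP => ft.
suff [c cst fc] : exists2 c, c \in `[Num.min s t, Num.max s t] & f c = 0.
  move/eqP: fc; apply/negP; apply: f0; move: sab tab cst; rewrite !in_itv/=.
  move=> /andP[? ?] /andP[? ?] /andP[h1 h2].
  by rewrite (lt_le_trans _ h1) ?lt_min ?(le_lt_trans h2) ?gt_max//; apply/andP.
have [st|ts] := leP s t.
  apply: IVT => //; first exact: continuous_subspaceT.
  by rewrite ge_min le_max (ltW fs) (ltW ft) orbT.
apply: IVT; [exact: ltW|exact: continuous_subspaceT|].
by rewrite ge_min le_max (ltW fs) (ltW ft) !orbT.
Qed.

Section GeodesicProperties.
Context {R : realType}.
Variables (xi m p q : R) (X Y Th V : R -> R).
Hypothesis xi0 : 0 < xi.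
Hypothesis m0 : 0 <= m.
Hypothesis G : geodesic xi m p q X Y Th V.
Implicit Types (a b c t : R) (P Q : R2P1 R) (gamma : R -> R2S1 R).

Lemma geodesic_cont : [/\ continuous X, continuous Y, continuous Th & continuous V].
Proof.
have [dTh cV dXY _] := G; split; [| | |exact: cV] => t.
- exact: deriv1_continuous (dXY t).1.
- exact: deriv1_continuous (dXY t).2.
- exact: deriv1_continuous (dTh t).
Qed.

Lemma geodesic_pn_cont : continuous (fun t => pn p q (Th t)).
Proof. by have [_ _ ct _] := geodesic_cont; exact: cont_pn. Qed.

Lemma geodesic_lifted :
  lifted [:: 1] X Y Th /\ forall t, ctl X Y Th t = pn p q (Th t).
Proof.
have [dTh cV dXY _] := G; have [_ _ ct _] := geodesic_cont.
have pT : pieces [:: 1] (fun a b => C1_ext a b Th) by exact: smooth_C1 dTh cV partition1.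
exact: angle_lifted ct pT geodesic_pn_cont (fun t => (dXY t).1) (fun t => (dXY t).2).
Qed.

Lemma geodesic_speed t : t \in `[0, 1] -> speed xi X Y Th t = m.
Proof.
have [dTh _ _ H] := G; have [_ ctlE] := geodesic_lifted => t01.
apply/eqP; rewrite -(@eqrXn2 _ 2)// ?sqrtr_ge0//; apply/eqP.
by rewrite speed_sqr ctlE (deriv1_val (dTh t)) addrC; have [_] := H t t01.
Qed.

Lemma geodesic_moment : moment_eq (X 1 - X 0) (Y 1 - Y 0) Th p q.
Proof.
have [_ _ dXY _] := G; have [cX cY ct _] := geodesic_cont.
have cp := geodesic_pn_cont.
have cc : continuous (fun t => pn p q (Th t) * cos (Th t)) by conts.
have cs : continuous (fun t => pn p q (Th t) * sin (Th t)) by conts.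
rewrite -(primE (S := [::]) cc cX ler01 (fun t _ _ => (dXY t).1)).
rewrite -(primE (S := [::]) cs cY ler01 (fun t _ _ => (dXY t).2)).
by have [-> ->] := prim_moment p q ct.
Qed.

Lemma geodesic_energy :
  prim (fun t => V t ^+ 2) 1 + xi ^+ 2 * (p * (X 1 - X 0) + q * (Y 1 - Y 0)) = m ^+ 2.
Proof.
have [_ _ _ H] := G; have [_ _ ct cV] := geodesic_cont; have cp := geodesic_pn_cont.
have cV2 : continuous (fun t => V t ^+ 2) by conts.
have cp2 : continuous (fun t => pn p q (Th t) ^+ 2) by conts.
rewrite -(moment_energy ct geodesic_moment) -primZ// -primD//; last by conts.
rewrite -[RHS]mulr1 -(@prim_cst R (m ^+ 2) 1)//; apply: eq_prim => //; [by conts|by conts|].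
by move=> t t01; have [] := H t (subset_itv_oo_cc t01).
Qed.

Lemma geodesic_curve_length : curve_length xi (curve_of X Y Th) = m%:E.
Proof.
have [L _] := geodesic_lifted.
have cm : continuous (fun t => m * t) by conts.
rewrite (lifted_curve_length (S := [::]) L cm); first by congr EFin; rewrite mulr0 subr0 mulr1.
by move=> t t01 _; rewrite geodesic_speed ?subset_itv_oo_cc//; derivs; ring.
Qed.

Lemma geodesic_u1 t : t \in `]0, 1[ -> u1 (curve_of X Y Th) t = pn p q (Th t).
Proof.
move=> t01; have [L ctlE] := geodesic_lifted; rewrite -ctlE.
have t1 : t \notin [:: 1 : R].
  by rewrite inE lt_eqF//; move: t01; rewrite in_itv/= => /andP[].
by have [_ ->] := lifted_controls L (fun _ _ => erefl) t01 t1.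
Qed.

Lemma geodesic_minimizing P Q : d_proj xi P Q = m%:E -> joins X Y Th P Q ->
  minimizing_geodesic xi P Q (curve_of X Y Th).
Proof.
move=> md [J0 J1]; have [L ctlE] := geodesic_lifted.
exists (curve_of X Y Th 0), (curve_of X Y Th 1); split => //.
- exact: lifted_Gamma0 L.
- by rewrite md geodesic_curve_length.
- exists (m ^+ 2); apply: (ae01_off (s := [:: 1])) => t t01 ts.
  have [_ -> ->] := lifted_controls L (fun _ _ => erefl) t01 ts.
  rewrite -(geodesic_speed (subset_itv_oo_cc t01)) /speed sqr_sqrtr//.
  by apply: addr_ge0; [apply: mulr_ge0|]; exact: sqr_ge0.
Qed.

(** Where the control is nonpositive, adding pi to the angle reverses its sign without changing the
    classes of the points. The shift [c], equal to 0 or pi, treats both signs at once; the arc is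
    run at speed (b - a) m. *)
Lemma d_c_piece a b : 0 <= a -> a < b -> b <= 1 ->
  (forall t, t \in `]a, b[ -> 0 <= pn p q (Th t)) \/
  (forall t, t \in `]a, b[ -> pn p q (Th t) <= 0) ->
  (d_c xi (class_of (curve_of X Y Th a)) (class_of (curve_of X Y Th b)) <=
    ((b - a) * m)%:E)%E.
Proof.
move=> a0 ab b1 sgn; have [dTh cV dXY H] := G; have [cX cY cTh _] := geodesic_cont.
have cp := geodesic_pn_cont.
pose l t := a + (b - a) * t.
have dl t : deriv1 l t (b - a) by rewrite /l; derivs; ring.
have cl : continuous l by move=> t; exact: deriv1_continuous (dl t).
have lab t : t \in `]0, 1[ -> l t \in `]a, b[.
  rewrite !in_itv/= /l => /andP[t0 t1]; rewrite ltrDl mulr_gt0 ?subr_gt0//=.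
  by rewrite -ltrBrDl gtr_pMr// subr_gt0.
have l0 : l 0 = a by rewrite /l mulr0 addr0.
have l1 : l 1 = b by rewrite /l mulr1 addrC subrK.
have [c [sc c1 u0]] : exists c, [/\ sin c = 0, cos c ^+ 2 = 1 &
    forall t, t \in `]0, 1[ -> 0 <= (b - a) * (cos c * pn p q (Th (l t)))].
  have ba : 0 <= b - a by rewrite subr_ge0 ltW.
  case: sgn => sgn.
    exists 0; rewrite sin0 cos0 expr1n; split => // t t01.
    by rewrite mul1r mulr_ge0// sgn// lab.
  exists pi; rewrite sinpi cospi sqrrN expr1n; split => // t t01.
  by rewrite mulN1r mulr_ge0// oppr_ge0 sgn// lab.
pose th t := Th (l t) + c; pose W t := (b - a) * (cos c * pn p q (Th (l t))).
have dth t : deriv1 th t (V (l t) * (b - a)).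
  by apply: deriv1_eq (deriv1D (deriv1_comp (dTh (l t)) (dl t)) (deriv1_cst c t)) _; rewrite addr0.
have cth : continuous th by move=> t; exact: deriv1_continuous (dth t).
have cVl : continuous (fun t => V (l t) * (b - a)).
  apply: contM; last exact: cont_cst.
  by move=> t; apply: continuous_comp; [exact: cl|exact: cV].
have cThl : continuous (fun t => Th (l t)).
  by move=> t; apply: continuous_comp; [exact: cl|exact: cTh].
have cW : continuous W.
  by apply: contM; [exact: cont_cst|apply: contM; [exact: cont_cst|exact: cont_pn]].
have pth : pieces [:: 1] (fun a b => C1_ext a b th) by exact: smooth_C1 dth cVl partition1.
have dX t : deriv1 (fun t => X (l t)) t (W t * cos (th t)).
  apply: deriv1_eq (deriv1_comp (dXY (l t)).1 (dl t)) _.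
  rewrite /W /th cosD sc mulr0 subr0.
  transitivity ((b - a) * (pn p q (Th (l t)) * cos (Th (l t))) * cos c ^+ 2); last by ring.
  by rewrite c1; ring.
have dY t : deriv1 (fun t => Y (l t)) t (W t * sin (th t)).
  apply: deriv1_eq (deriv1_comp (dXY (l t)).2 (dl t)) _.
  rewrite /W /th sinD sc mulr0 addr0.
  transitivity ((b - a) * (pn p q (Th (l t)) * sin (Th (l t))) * cos c ^+ 2); last by ring.
  by rewrite c1; ring.
have [L ctlE] := angle_lifted cth pth cW dX dY.
have J : joins (fun t => X (l t)) (fun t => Y (l t)) th
    (class_of (curve_of X Y Th a)) (class_of (curve_of X Y Th b)).
  by apply/joins_angles; rewrite /th l0 l1 ![_ + c]addrC !addrK sc.
have cm : continuous (fun t => (b - a) * m * t) by conts.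
have := d_c_le (S := [::]) L J _ cm _; rewrite mulr0 subr0 mulr1; apply.
  by move=> t t01 _; rewrite ctlE; exact: u0.
move=> t t01 _; have -> : speed xi (fun t => X (l t)) (fun t => Y (l t)) th t = (b - a) * m.
  apply/eqP; rewrite -(@eqrXn2 _ 2)// ?sqrtr_ge0//; last by rewrite mulr_ge0// subr_ge0 ltW.
  rewrite speed_sqr ctlE (deriv1_val (dth t)); apply/eqP; rewrite [RHS]exprMn.
  have [|_ <-] := H (l t).
    move: (lab t t01); rewrite !in_itv/= => /andP[al lb].
    by rewrite (le_trans a0 (ltW al)) (le_trans (ltW lb)).
  rewrite /W; transitivity ((b - a) ^+ 2 * (V (l t) ^+ 2 +
    xi ^+ 2 * pn p q (Th (l t)) ^+ 2 * cos c ^+ 2)); first by ring.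
  by rewrite c1 mulr1.
by derivs; ring.
Qed.

Section Cusps.
Variable gamma : R -> R2S1 R.
Hypothesis uE : forall t : R, t \in `]0, 1[ -> u1 gamma t = pn p q (Th t).

Lemma geodesic_deriv_u1 t : t \in `]0, 1[ -> deriv1 (u1 gamma) t (pq p q (Th t) * V t).
Proof.
move=> t01; have [dTh _ _ _] := G; apply: deriv1_itv t01 _ (deriv1_pn p q (dTh t)).
by move=> r /uE.
Qed.

(** Where [pn] vanishes, the other component of the nonzero vector (p, q) does not, and V^2 = m^2 >
    0; so the derivative [pq] V of the control is nonzero. *)
Lemma zero_cusp t : 0 < m -> (p != 0) || (q != 0) -> t \in `]0, 1[ ->
  pn p q (Th t) = 0 -> cusp gamma t.
Proof.
move=> mp pq0 t01 pn0; have d := geodesic_deriv_u1 t01; split => //.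
- by rewrite inE.
- by rewrite uE.
- by case: d.
have [_ _ _ H] := G; have [_ Vm] := H t (subset_itv_oo_cc t01).
rewrite (deriv1_val d) mulf_neq0//.
  apply/eqP => e; have : p ^+ 2 + q ^+ 2 = 0.
    transitivity (pn p q (Th t) ^+ 2 + pq p q (Th t) ^+ 2); last by rewrite pn0 e expr0n addr0.
    rewrite /pn /pq -[LHS]mulr1 -(cos2Dsin2 (Th t)); ring.
  by move/eqP; rewrite paddr_eq0 ?sqr_ge0// !sqrf_eq0 => /andP[/eqP p0 /eqP q0];
    move: pq0; rewrite p0 q0 eqxx.
apply/eqP => V0; move: Vm; rewrite V0 pn0 expr0n mulr0 addr0 => /esym/eqP.
by rewrite sqrf_eq0 gt_eqF.
Qed.

(** A zero of a nonnegative control is an interior minimum, where the derivative vanishes; if V = 0,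
    the derivative [pq] V vanishes anyway. *)
Lemma cusp_free_sign :
  (forall t, t \in `]0, 1[ -> 0 <= pn p q (Th t)) \/ (forall t, V t = 0) -> cusp_free gamma.
Proof.
move=> sgn t [/[!inE] t01 u0 _ /eqP]; have d := geodesic_deriv_u1 t01.
rewrite (deriv1_val d); apply; case: sgn => [pos|->]; last by rewrite mulr0.
have [dTh _ _ _] := G; have d' := deriv1_pn p q (dTh t).
apply: deriv1_uniq d' _; apply: (@derive1_at_min _ _ 0 1) => //.
  by move=> r _; have [] := deriv1_pn p q (dTh r).
by move=> r r01; rewrite -(uE t01) u0; exact: pos.
Qed.

End Cusps.

End GeodesicProperties.

(** * Every minimizer is a geodesic *)

Section Minimizing.
Context {R : realType}.
Variable xi : R.
Hypothesis xi0 : 0 < xi.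
Implicit Types (x y th f g X Y V W Th Lam : R -> R) (s S : seq R) (a b c t p q m : R).
Implicit Types (P Q : R2P1 R) (gamma : R -> R2S1 R).

(** The limit of a constant sequence is the given angle itself, which thus inherits the regularity
    of limits. *)
Lemma geodesic_of_minimal_speed m P Q s x y th : 0 <= m -> d_proj xi P Q = m%:E ->
  lifted s x y th -> joins x y th P Q ->
  (forall t, t \in `]0, 1[ -> t \notin s -> speed xi x y th t = m) ->
  exists X Y Th V p q, [/\ geodesic xi m p q X Y Th V, joins X Y Th P Q &
    forall t, t \in `[0, 1] -> th t = Th t].
Proof.
move=> m0 md L J sp; have [|U [X [Y [Th [V [p [q [UU G J' cv _]]]]]]]] :=
  @geodesic_of_sequence R xi xi0 m P Q (fun=> s) (fun=> x) (fun=> y) (fun=> th) `|th 0|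
    m0 md (fun=> conj L J) _ (fun=> lexx _).
  by move=> k t t01 ts; rewrite sp// lerDl mulr_ge0// invr_ge0.
exists X, Y, Th, V, p, q; split => // t t01.
by apply: (ulim_uniq UU _ (cv t t01)); exact: cvg_cst.
Qed.

Lemma minimizing_geodesic_lift m P Q gamma : 0 <= m -> d_proj xi P Q = m%:E ->
  minimizing_geodesic xi P Q gamma ->
  exists s x y th, [/\ lifted s x y th, joins x y th P Q,
    (forall t, t \in `[0, 1] -> gamma t = curve_of x y th t) &
    forall t, t \in `]0, 1[ -> t \notin s -> speed xi x y th t = m].
Proof.
move=> m0 md [q0 [q1 [Pq0 Qq1 Gg len cs]]].
have [s [x [y [th [L gE thpi]]]]] := Gamma0_lift Gg.
have [c cE] := constant_speed_off L gE cs.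
have [Lam [cLam dLam lenE]] := lifted_length xi L gE.
exists s, x, y, th; split => //; first exact: lift_joins Pq0 Qq1 Gg gE.
move=> t t01 ts; rewrite cE//.
have cc : continuous (fun t => c * t) by conts.
have : Lam 1 - Lam 0 = c * 1 - c * 0.
  apply: (@eq_deriv_eq _ _ (fun t => c * t) s _ _ ler01 cLam cc) => r r01 rs.
  by exists c; [rewrite -(cE r)//; exact: dLam|derivs; ring].
by rewrite mulr1 mulr0 subr0 => <-; apply: EFin_inj; rewrite -lenE len md.
Qed.

(** Given the angle, [pn p q Th] is the only control that reaches the displacement with minimal
    energy. The energy balance forces the increments of [D], whose derivative is the squared
    difference of the controls, to vanish. *)
Lemma minimizing_positions m P Q s x y X Y Th V p q : 0 <= m ->
  geodesic xi m p q X Y Th V -> joins X Y Th P Q -> lifted s x y Th -> joins x y Th P Q ->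
  (forall t, t \in `]0, 1[ -> t \notin s -> speed xi x y Th t = m) ->
  forall t, t \in `[0, 1] -> x t = X t /\ y t = Y t.
Proof.
have [a [b [al ->]]] := R2P1_angle P; have [a' [b' [be ->]]] := R2P1_angle Q.
move=> m0 G J' L J sp.
have [Qf [E [HC /(_ m) HE]]] := lifted_controlled xi L J.
have {}HE : Qf 1 - Qf 0 + xi ^+ 2 * (E 1 - E 0) <= m ^+ 2.
  by apply: HE => t t01 ts; rewrite sp.
move: J J' => /joins_angles[[x0 y0 _] [x1 y1 _]] /joins_angles[[X0 Y0 _] [X1 Y1 _]].
have [dTh cV dXY _] := G; have [cX cY ct _] := geodesic_cont G.
have me := geodesic_moment G; have en := geodesic_energy G.
rewrite X0 X1 Y0 Y1 in me en.
have [[_ _ _ cQ dQ] [cx cy cE] _ dC] := HC.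
have cV2 : continuous (fun t => V t ^+ 2) by conts.
have QfE : prim (fun t => V t ^+ 2) 1 = Qf 1 - Qf 0.
  apply: (primE (S := s)) => // t t01 ts; have [d1 d2] := dQ t t01 ts.
  by rewrite -(deriv1_val (dTh t)).
have gap : E 1 - E 0 <= p * (a' - a) + q * (b' - b).
  by rewrite -(@ler_pM2l _ (xi ^+ 2)) ?exprn_gt0//; move: HE; rewrite -QfE -en lerD2l.
have cp : continuous (fun t => pn p q (Th t) ^+ 2) by apply: contX; exact: cont_pn.
pose D t := E t - 2 * (p * x t + q * y t) + prim (fun t => pn p q (Th t) ^+ 2) t.
have cD : continuous D by rewrite /D; conts; exact: prim_cont.
have dD t : t \in `]0, 1[ -> t \notin s -> deriv1 D t ((ctl x y Th t - pn p q (Th t)) ^+ 2).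
  move=> t01 ts; have [dx dy dE] := dC t t01 ts; have ? := prim_deriv t cp.
  by rewrite /D; derivs; rewrite /pn; ring.
have D10 t : t \in `[0, 1] -> D t - D 0 <= 0.
  rewrite in_itv/= => /andP[t0 t1]; apply: (@le_trans _ _ (D 1 - D 0)).
    rewrite lerB//; apply: (le_of_deriv_ge0 (S := s)) => // r; rewrite in_itv/= => /andP[tr r1] rs.
    exists ((ctl x y Th r - pn p q (Th r)) ^+ 2); last exact: sqr_ge0.
    by apply: dD => //; rewrite in_itv/= (le_lt_trans t0 tr).
  rewrite /D prim0// (moment_energy ct me) x0 x1 y0 y1; move: gap; lra.
(* With d = z t - Z t and e the difference of the controls, integrating 2 d e k <= d^2 + e^2, where
   |k| <= 1, gives 2 d^2 <= d^2 t + D t - D 0 <= d^2. *)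
have key z Z (k : R -> R) : continuous z -> continuous Z -> (forall t, `|k t| <= 1) ->
    (forall t, t \in `]0, 1[ -> t \notin s ->
      deriv1 z t (ctl x y Th t * k t) /\ deriv1 Z t (pn p q (Th t) * k t)) ->
    z 0 = Z 0 -> forall t, t \in `[0, 1] -> z t = Z t.
  move=> cz cZ k1 dz z0 t t01; pose d := z t - Z t.
  move: (t01); rewrite in_itv/= => /andP[t0 t1].
  have c1 : continuous (fun r => 2 * d * (z r - Z r)) by conts.
  have c2 : continuous (fun r => d ^+ 2 * r + D r) by conts.
  have := @le_deriv_le R _ _ s 0 t t0 c1 c2.
  rewrite z0 subrr mulr0 subr0 mulr0 add0r -/d => h.
  have {h} : 2 * d * d <= d ^+ 2 * t + D t - D 0.
    apply: h => r; rewrite in_itv/= => /andP[r0 rt] rs.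
    have r01 : r \in `]0, 1[ by rewrite in_itv/= r0 (lt_le_trans rt).
    have [d1 d2] := dz r r01 rs; have d3 := dD r r01 rs.
    set e := ctl x y Th r - pn p q (Th r) in d3.
    exists (2 * d * (e * k r)), (d ^+ 2 + e ^+ 2); split.
    - by derivs; rewrite /e; ring.
    - by derivs; ring.
    have k2 : k r ^+ 2 <= 1 by rewrite -(real_normK (num_real (k r))) exprn_ile1.
    have : 0 <= (d - e * k r) ^+ 2 + e ^+ 2 * (1 - k r ^+ 2).
      by apply: addr_ge0; [exact: sqr_ge0|rewrite mulr_ge0 ?sqr_ge0// subr_ge0].
    by rewrite sqrrB exprMn mulrBr; lra.
  have := D10 t t01; have : d ^+ 2 * t <= d ^+ 2 by rewrite ler_piMr// sqr_ge0.
  move=> h1 h2 h3; have : d ^+ 2 <= 0 by move: h1 h2 h3; rewrite expr2; lra.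
  by rewrite le_eqVlt ltNge sqr_ge0 orbF sqrf_eq0 subr_eq0 => /eqP.
have kc := key x X (fun t => cos (Th t)) cx cX (fun t => cos_max (Th t)).
have ks := key y Y (fun t => sin (Th t)) cy cY (fun t => sin_max (Th t)).
move=> t t01; split; [apply: kc t01|apply: ks t01]; rewrite ?x0 ?y0 ?X0 ?Y0 //.
  by move=> r r01 rs; have [? _ _] := dC r r01 rs; have [? _] := dXY r.
by move=> r r01 rs; have [_ ? _] := dC r r01 rs; have [_ ?] := dXY r.
Qed.

Lemma lifted_angle_ext s x y th Th dTh : (forall t, deriv1 Th t (dTh t)) ->
  (forall t, t \in `[0, 1] -> th t = Th t) -> lifted s x y th -> lifted s x y Th.
Proof.
move=> dT E [[cx cy _] [px py pt] H]; split.
- by split => //; move=> t; exact: deriv1_continuous (dT t).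
- by split => //; exact: pieces_ext pt.
- by move=> t t01 ts; rewrite -E ?subset_itv_oo_cc//; exact: H.
Qed.

(** The formula holds at breakpoints too, as the curve coincides on [0, 1] with a continuously
    differentiable one. This matters because a cusp depends on the values of [u1] at every time. *)
Lemma minimizing_geodesic_u1 m P Q gamma : 0 <= m -> d_proj xi P Q = m%:E ->
  minimizing_geodesic xi P Q gamma ->
  exists X Y Th V p q, [/\ geodesic xi m p q X Y Th V, joins X Y Th P Q &
    forall t : R, t \in `]0, 1[ -> u1 gamma t = pn p q (Th t)].
Proof.
move=> m0 md /(minimizing_geodesic_lift m0 md)[s [x [y [th [L J gE sp]]]]].
have [X [Y [Th [V [p [q [G J' thE]]]]]]] := geodesic_of_minimal_speed m0 md L J sp.
exists X, Y, Th, V, p, q; split => //.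
have [dTh _ _ _] := G.
have I0 : 0 \in `[0, 1 : R] by rewrite in_itv/= lexx ler01.
have I1 : 1 \in `[0, 1 : R] by rewrite in_itv/= lexx ler01.
have L' := lifted_angle_ext dTh thE L.
have J2 : joins x y Th P Q by move: J; rewrite /joins /curve_of !thE.
have sp' t : t \in `]0, 1[ -> t \notin s -> speed xi x y Th t = m.
  move=> t01 ts; rewrite -(sp t t01 ts) /speed /ctl thE ?subset_itv_oo_cc//.
  have [_ _ dth] := lifted_deriv L t01 ts.
  suff -> : derive1 Th t = derive1 th t by [].
  apply: deriv1_val; apply: deriv1_itv t01 _ dth => r r01; apply: thE.
  exact: subset_itv_oo_cc.
have xyE := minimizing_positions m0 G J' L' J2 sp'.
have [L2 ctlE] := geodesic_lifted G.
have gE' t : t \in `[0, 1] -> gamma t = curve_of X Y Th t.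
  by move=> t01; rewrite gE// /curve_of thE//; have [-> ->] := xyE t t01.
move=> t t01; rewrite -ctlE.
have t1 : t \notin [:: 1 : R].
  by rewrite inE lt_eqF//; move: t01; rewrite in_itv/= => /andP[].
by have [_ ->] := lifted_controls L2 gE' t01 t1.
Qed.

End Minimizing.

(** * Concatenation and reversal of minimizers *)

Section Splice.
Context {R : realType}.
Implicit Types (f g : R -> R) (s : seq R) (a b c d t : R).

Definition splice c f g t := if t <= c then f t else g t.

Lemma splice_cont c f g : continuous f -> continuous g -> f c = g c -> continuous (splice c f g).
Proof.
move=> cf cg fg.
rewrite (_ : splice c f g = fun t => f (Num.min t c) + g (Num.max t c) - f c); last first.
  apply/funext => t; rewrite /splice; have [tc|tc] := leP t c.
    by rewrite fg addrK.
  by rewrite [f c + _]addrC addrK.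
have cmin : continuous (fun t => f (Num.min t c)).
  move=> t; apply: continuous_comp; last exact: cf.
  by apply: continuous_min; [exact: cvg_id|exact: cvg_cst].
have cmax : continuous (fun t => g (Num.max t c)).
  move=> t; apply: continuous_comp; last exact: cg.
  by apply: continuous_max; [exact: cvg_id|exact: cvg_cst].
by conts.
Qed.

Lemma splice_le c f g t : t <= c -> splice c f g t = f t.
Proof. by rewrite /splice => ->. Qed.

Lemma splice_ge c f g t : f c = g c -> c <= t -> splice c f g t = g t.
Proof.
by rewrite /splice le_eqVlt => fg /predU1P[<-|ct]; [rewrite lexx|rewrite leNgt ct].
Qed.

Lemma splice_gt c f g t : c < t -> splice c f g t = g t.
Proof. by rewrite /splice leNgt => ->. Qed.

Lemma splice_derivl c f g t d : t < c -> deriv1 f t d -> deriv1 (splice c f g) t d.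
Proof.
move=> tc; apply: (@deriv1_itv _ _ _ (t - 1) c).
  by rewrite in_itv/= tc gtrBl ltr01.
by move=> r; rewrite in_itv/= => /andP[_ rc]; rewrite splice_le// ltW.
Qed.

Lemma splice_derivr c f g t d : c < t -> deriv1 g t d -> deriv1 (splice c f g) t d.
Proof.
move=> ct; apply: (@deriv1_itv _ _ _ c (t + 1)).
  by rewrite in_itv/= ct ltrDl ltr01.
by move=> r; rewrite in_itv/= => /andP[cr _]; rewrite splice_gt.
Qed.

Lemma C1_ext_smooth a b f F F' : (forall t, deriv1 F t (F' t)) -> continuous F' ->
  (forall t, t \in `[a, b] -> f t = F t) -> C1_ext a b f.
Proof. by move=> dF cF fF; exists F, F'. Qed.

Lemma deriv1_affine f a b t d : deriv1 f (a + b * t) d -> deriv1 (fun t => f (a + b * t)) t (d * b).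
Proof.
move=> df; apply: (@deriv1_comp _ f (fun t => a + b * t) t d b df).
by derivs; rewrite add0r.
Qed.

Lemma affine_cont f a b : continuous f -> continuous (fun t => f (a + b * t)).
Proof.
move=> cf t; apply: continuous_comp; last exact: cf.
have c : continuous (fun t => a + b * t) by conts.
exact: c.
Qed.

Lemma partition2 c : 0 < c < 1 -> itv_partition 0 1 [:: c; 1].
Proof. by case/andP=> c0 c1; rewrite /itv_partition/= c0 c1. Qed.

Lemma partition3 c d : 0 < c -> c < d -> d < 1 -> itv_partition 0 1 [:: c; d; 1].
Proof. by move=> c0 cd d1; rewrite /itv_partition/= c0 cd d1. Qed.

End Splice.

Section Concatenation.
Context {R : realType}.
Variable xi : R.
Hypothesis xi0 : 0 < xi.
Implicit Types (x y th f g X Y V W Th Lam : R -> R) (s S : seq R) (a b c t u v p q m : R).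
Implicit Types (P Q T : R2P1 R).

Lemma ctl_speed_at x y th t u v c : 0 <= c -> deriv1 x t (u * cos (th t)) ->
  deriv1 y t (u * sin (th t)) -> deriv1 th t v -> xi ^+ 2 * u ^+ 2 + v ^+ 2 = c ^+ 2 ->
  derive1 x t * sin (th t) = derive1 y t * cos (th t) /\ speed xi x y th t = c.
Proof.
move=> c0 dx dy dth E; split; first by rewrite (deriv1_val dx) (deriv1_val dy); ring.
apply/eqP; rewrite -(@eqrXn2 _ 2)// ?sqrtr_ge0//; apply/eqP.
rewrite speed_sqr -E (deriv1_val dth) /ctl (deriv1_val dx) (deriv1_val dy).
rewrite [u * cos _ * cos _]mulrAC -[u * cos _ * cos _]mulrA -expr2.
by congr (_ * _ ^+ 2 + _); rewrite -[RHS]mulr1 -(cos2Dsin2 (th t)); ring.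
Qed.

(** Two minimizers are run one after the other, each at double speed. Their angles agree at the
    junction only modulo pi, so the second is shifted by [de]. This may reverse the sign of its
    control, which is why the argument does not serve [d_c]. *)
Lemma d_proj_triangle P Q T : (d_proj xi P T <= d_proj xi P Q + d_proj xi Q T)%E.
Proof.
have [m1 m10 e1] := d_proj_fin xi P Q; have [m2 m20 e2] := d_proj_fin xi Q T.
have [X1 [Y1 [Th1 [V1 [p1 [q1 [G1 J1]]]]]]] := geodesic_exists xi0 m10 e1.
have [X2 [Y2 [Th2 [V2 [p2 [q2 [G2 J2]]]]]]] := geodesic_exists xi0 m20 e2.
rewrite e1 e2 -EFinD.
have [dTh1 cV1 dXY1 H1] := G1; have [cX1 cY1 cTh1 _] := geodesic_cont G1.
have [dTh2 cV2 dXY2 H2] := G2; have [cX2 cY2 cTh2 _] := geodesic_cont G2.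
have [J10 J11] := J1; have [J20 J21] := J2.
have /class_circ[/row2_inj[xx yy] tt] :
  class_of (curve_of X1 Y1 Th1 1) = class_of (curve_of X2 Y2 Th2 0) by rewrite J11.
pose de := Th1 1 - Th2 0.
have sde : sin de = 0 by [].
have cde : cos de ^+ 2 = 1 by rewrite -(cos2Dsin2 de) sde expr0n addr0.
pose h := 2^-1 : R.
have h0 : 0 < h by rewrite invr_gt0.
have h1 : h < 1 by rewrite invf_lt1// ltr1n.
have hh : 2 * h = 1 by rewrite mulfV// pnatr_eq0.
have ah : 0 + 2 * h = 1 by rewrite hh add0r.
have bh : -1 + 2 * h = 0 by rewrite hh addNr.
pose x := splice h (fun t => X1 (0 + 2 * t)) (fun t => X2 (-1 + 2 * t)).
pose y := splice h (fun t => Y1 (0 + 2 * t)) (fun t => Y2 (-1 + 2 * t)).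
pose th := splice h (fun t => Th1 (0 + 2 * t)) (fun t => Th2 (-1 + 2 * t) + de).
(* The constant m1 - m2 makes both branches take the value m1 at the junction. *)
pose Lam := splice h (fun t => 2 * m1 * t) (fun t => m1 - m2 + 2 * m2 * t).
have gx : X1 (0 + 2 * h) = X2 (-1 + 2 * h) by rewrite ah bh.
have gy : Y1 (0 + 2 * h) = Y2 (-1 + 2 * h) by rewrite ah bh.
have gt : Th1 (0 + 2 * h) = Th2 (-1 + 2 * h) + de by rewrite ah bh /de addrC subrK.
have gL : 2 * m1 * h = m1 - m2 + 2 * m2 * h.
  by rewrite mulrAC hh [2 * m2 * h]mulrAC hh !mul1r subrK.
have cx : continuous x by apply: splice_cont => //; exact: affine_cont.
have cy : continuous y by apply: splice_cont => //; exact: affine_cont.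
have cth2 : continuous (fun t => Th2 (-1 + 2 * t) + de).
  by apply: contD; [exact: affine_cont|exact: cont_cst].
have cth : continuous th by apply: splice_cont => //; exact: affine_cont.
have cLam : continuous Lam by apply: splice_cont => //; conts.
have p2' : itv_partition 0 1 [:: h; 1] by apply: partition2; rewrite h0.
have pc f1 f2 d1 d2 e : continuous d1 -> continuous d2 -> (forall t, deriv1 f1 t (d1 t)) ->
    (forall t, deriv1 f2 t (d2 t)) -> f1 (0 + 2 * h) = f2 (-1 + 2 * h) + e ->
    pieces [:: h; 1] (fun a b => C1_ext a b
      (splice h (fun t => f1 (0 + 2 * t)) (fun t => f2 (-1 + 2 * t) + e))).
  move=> cd1 cd2 df1 df2 fe; split => // -[|[|//]] _ /=.
    apply: (@C1_ext_smooth _ _ _ _ (fun t => f1 (0 + 2 * t)) (fun t => d1 (0 + 2 * t) * 2)).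
    - by move=> t; exact: deriv1_affine.
    - by apply: contM; [exact: affine_cont|exact: cont_cst].
    - by move=> t; rewrite in_itv/= => /andP[_ th']; rewrite splice_le.
  apply: (@C1_ext_smooth _ _ _ _ (fun t => f2 (-1 + 2 * t) + e) (fun t => d2 (-1 + 2 * t) * 2)).
  - move=> t; apply: deriv1_eq (deriv1D (deriv1_affine (df2 _)) (deriv1_cst e t)) _.
    by rewrite addr0.
  - by apply: contM; [exact: affine_cont|exact: cont_cst].
  - by move=> t; rewrite in_itv/= => /andP[th' _]; rewrite splice_ge.
have cp1 := geodesic_pn_cont G1; have cp2 := geodesic_pn_cont G2.
have add0 f : (fun t => f (-1 + 2 * t)) = (fun t => f (-1 + 2 * t) + 0 : R).
  by apply/funext => t; rewrite addr0.
have px : pieces [:: h; 1] (fun a b => C1_ext a b x).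
  rewrite /x add0; apply: (pc X1 X2 _ _ 0 _ _ (fun t => (dXY1 t).1) (fun t => (dXY2 t).1)).
  - by conts.
  - by conts.
  - by rewrite addr0.
have py : pieces [:: h; 1] (fun a b => C1_ext a b y).
  rewrite /y add0; apply: (pc Y1 Y2 _ _ 0 _ _ (fun t => (dXY1 t).2) (fun t => (dXY2 t).2)).
  - by conts.
  - by conts.
  - by rewrite addr0.
have pth : pieces [:: h; 1] (fun a b => C1_ext a b th).
  by apply: (pc Th1 Th2 _ _ de cV1 cV2 dTh1 dTh2 gt).
have local t : t \in `]0, 1[ -> t \notin [:: h; 1] ->
    derive1 x t * sin (th t) = derive1 y t * cos (th t) /\ deriv1 Lam t (speed xi x y th t).
  rewrite in_itv/= !inE negb_or => /andP[t0 t1] /andP[th' _].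
  have [tl|tl|/eqP] := ltgtP t h; last by rewrite (negbTE th').
    have I : 0 + 2 * t \in `[0, 1].
      by rewrite in_itv/=; apply/andP; split; lra.
    have [_ E] := H1 _ I.
    have thE : th t = Th1 (0 + 2 * t) by rewrite /th splice_le// ltW.
    have c0 : 0 <= m1 * 2 by rewrite mulr_ge0.
    have [||||-> ->] := @ctl_speed_at x y th t (pn p1 q1 (Th1 (0 + 2 * t)) * 2)
      (V1 (0 + 2 * t) * 2) (m1 * 2) c0.
    - rewrite thE; apply: splice_derivl => //; rewrite mulrAC.
      by apply: deriv1_affine; have [] := dXY1 (0 + 2 * t).
    - rewrite thE; apply: splice_derivl => //; rewrite mulrAC.
      by apply: deriv1_affine; have [] := dXY1 (0 + 2 * t).
    - by apply: splice_derivl => //; exact: deriv1_affine.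
    - by rewrite !exprMn -E; ring.
    by split => //; apply: splice_derivl => //; rewrite [m1 * 2]mulrC; exact: deriv1_mull.
  have I : -1 + 2 * t \in `[0, 1].
    by rewrite in_itv/=; apply/andP; split; lra.
  have [_ E] := H2 _ I.
  have thE : th t = Th2 (-1 + 2 * t) + de by rewrite /th splice_gt.
  have c0 : 0 <= m2 * 2 by rewrite mulr_ge0.
    have [||||-> ->] := @ctl_speed_at x y th t (pn p2 q2 (Th2 (-1 + 2 * t)) * cos de * 2)
    (V2 (-1 + 2 * t) * 2) (m2 * 2) c0.
  - rewrite thE cosD sde mulr0 subr0; apply: splice_derivr => //.
    apply: deriv1_eq (deriv1_affine (dXY2 (-1 + 2 * t)).1) _.
    by rewrite -[LHS]mulr1 -cde; ring.
  - rewrite thE sinD sde mulr0 addr0; apply: splice_derivr => //.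
    apply: deriv1_eq (deriv1_affine (dXY2 (-1 + 2 * t)).2) _.
    by rewrite -[LHS]mulr1 -cde; ring.
  - apply: splice_derivr => //.
    by apply: deriv1_eq (deriv1D (deriv1_affine (dTh2 _)) (deriv1_cst de t)) _; rewrite addr0.
  - by rewrite !exprMn -E cde; ring.
  split => //; apply: splice_derivr => //.
  by apply: deriv1_eq (deriv1D (deriv1_cst _ t) (deriv1_mull _ t)) _; rewrite add0r mulrC.
have L : lifted [:: h; 1] x y th.
  by split => //; move=> t t01 ts; have [] := local t t01 ts.
have g0 (f g : R -> R) : splice h f g 0 = f 0 by rewrite splice_le// ltW.
have g1 (f g : R -> R) : splice h f g 1 = g 1 by rewrite splice_gt.
have J : joins x y th P T.
  rewrite /joins -J10 -J21 /curve_of /x /y /th !g0 !g1 mulr0 addr0.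
  split => //; apply/class_circ; rewrite mulr1.
  have -> : -1 + 2 = 1 :> R by lra.
  split => //.
  by rewrite addrAC subrr add0r.
have := d_proj_le L J cLam (fun t t01 ts => (local t t01 ts).2).
rewrite /Lam g0 g1 mulr0 subr0 mulr1.
by have -> : m1 - m2 + 2 * m2 = m1 + m2 by lra.
Qed.

End Concatenation.

Section Reversal.
Context {R : realType}.
Variable xi : R.
Hypothesis xi0 : 0 < xi.
Implicit Types (x y th f g X Y V W Th Lam : R -> R) (s S : seq R) (a b c t u v p q m : R).
Implicit Types (P Q T : R2P1 R).

(** On [t1, t2] a reflected copy of [prim f], adjusted to agree with it at both ends, is a primitive
    of the reversed function. *)
Lemma prim_reversal f t1 t2 (F : R -> R) : continuous f -> continuous F ->
  0 < t1 -> t1 < t2 -> t2 < 1 ->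
  (forall t, t < t1 -> F t = f t) ->
  (forall t, t1 < t -> t < t2 -> F t = f (t1 + t2 + -1 * t)) ->
  (forall t, t2 < t -> F t = f t) -> prim F 1 = prim f 1.
Proof.
move=> cf cF t10 t12 t21 F1 F2 F3.
have cH : continuous (prim f) by exact: prim_cont.
have dH t := prim_deriv t cf.
pose H2 := fun t => prim f t1 + prim f t2 - prim f (t1 + t2 + -1 * t).
have cH2 : continuous H2.
  have ca : continuous (fun t => prim f (t1 + t2 + -1 * t)) by exact: affine_cont.
  by rewrite /H2; conts.
have e2 : H2 t2 = prim f t2 by rewrite /H2 mulN1r addrK addrAC subrr add0r.
have cin : continuous (splice t2 H2 (prim f)) by exact: splice_cont.
have e1 : prim f t1 = splice t2 H2 (prim f) t1.
  by rewrite splice_le ?ltW// /H2 mulN1r [t1 + t2]addrC addrK addrK.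
pose H := splice t1 (prim f) (splice t2 H2 (prim f)).
have cHH : continuous H by exact: splice_cont.
have t11 := lt_trans t12 t21.
rewrite (primE (G := H) (S := [:: t1; t2]) cF cHH ler01).
  by rewrite /H splice_gt// splice_gt// splice_le ?ltW// prim0// subr0.
move=> t t01; rewrite !inE negb_or => /andP[n1 n2].
have [tl|tl|/eqP] := ltgtP t t1; last by rewrite (negbTE n1).
  by rewrite F1//; exact: splice_derivl.
have [tr|tr|/eqP] := ltgtP t t2; last by rewrite (negbTE n2).
  rewrite F2//; apply: splice_derivr => //; apply: splice_derivl => //.
  apply: deriv1_eq (deriv1D (deriv1_cst (prim f t1 + prim f t2) t)
    (deriv1N (deriv1_affine (dH (t1 + t2 + -1 * t))))) _.
  by rewrite mulrN1 opprK add0r.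
by rewrite F3//; apply: splice_derivr => //; exact: splice_derivr.
Qed.

(* Two zeros of the spatial control at which the angle turns in the same direction would
   allow to run the arc between them backwards, keeping both the end points and the length;
   the new minimizer has a corner, whereas minimizers are C1. *)
Lemma geodesic_zero_uniq m P Q X Y Th V p q t1 t2 : 0 < m -> d_proj xi P Q = m%:E ->
  geodesic xi m p q X Y Th V -> joins X Y Th P Q -> (p != 0) || (q != 0) ->
  0 < t1 -> t1 < t2 -> t2 < 1 -> pn p q (Th t1) = 0 -> pn p q (Th t2) = 0 -> V t1 <> V t2.
Proof.
move=> mp md G [J0 J1] pq0 t10 t12 t21 z1 z2 eV.
have m0 := ltW mp; have t11 := lt_trans t12 t21.
have [dTh cV dXY H] := G; have [cX cY cTh _] := geodesic_cont G.
(* Both orientations are orthogonal to (p, q), so [de] is a multiple of pi. Shifting the reversed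
   arc by [de] and the final arc by twice [de] makes the angle continuous. *)
pose de := Th t1 - Th t2.
have sde : sin de = 0 by exact: pn_zero_sin pq0 z1 z2.
have cde : cos de ^+ 2 = 1 by rewrite -(cos2Dsin2 de) sde expr0n addr0.
pose f2 t := Th (t1 + t2 + -1 * t) + de; pose f3 t := Th t + (de + de).
have cf2 : continuous f2 by apply: contD; [exact: affine_cont|exact: cont_cst].
have cf3 : continuous f3 by apply: contD; [exact: cTh|exact: cont_cst].
have df2 t : deriv1 f2 t (- V (t1 + t2 + -1 * t)).
  apply: deriv1_eq (deriv1D (deriv1_affine (dTh _)) (deriv1_cst de t)) _.
  by rewrite addr0 mulrN1.
have df3 t : deriv1 f3 t (V t).
  by apply: deriv1_eq (deriv1D (dTh t) (deriv1_cst (de + de) t)) _; rewrite addr0.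
have e2 : f2 t2 = f3 t2 by rewrite /f2 /f3 mulN1r addrK /de; ring.
have cin : continuous (splice t2 f2 f3) by exact: splice_cont.
have e1 : Th t1 = splice t2 f2 f3 t1.
  by rewrite splice_le ?ltW// /f2 mulN1r [t1 + t2]addrC addrK /de addrC subrK.
pose th := splice t1 Th (splice t2 f2 f3).
have cth : continuous th by exact: splice_cont.
have th1 t : t <= t1 -> th t = Th t by move=> ?; rewrite /th splice_le.
have th2 t : t1 <= t -> t <= t2 -> th t = f2 t.
  by move=> ? ?; rewrite /th splice_ge// splice_le.
have th3 t : t2 <= t -> th t = f3 t.
  by move=> tt; rewrite /th splice_gt ?(lt_le_trans t12)// splice_ge.
have dth1 t : t < t1 -> deriv1 th t (V t) by move=> ?; exact: splice_derivl.
have dth2 t : t1 < t -> t < t2 -> deriv1 th t (- V (t1 + t2 + -1 * t)).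
  by move=> ? ?; apply: splice_derivr => //; exact: splice_derivl.
have dth3 t : t2 < t -> deriv1 th t (V t).
  by move=> tt; apply: splice_derivr; [exact: lt_trans tt|exact: splice_derivr].
have pth : pieces [:: t1; t2; 1] (fun a b => C1_ext a b th).
  split; first exact: partition3.
  have cV2 : continuous (fun t => - V (t1 + t2 + -1 * t)).
    by apply: contN; exact: affine_cont.
  case=> [|[|[|//]]] _ /=.
  - apply: C1_ext_smooth dTh cV _ => t; rewrite in_itv/= => /andP[_ h]; exact: th1.
  - apply: C1_ext_smooth df2 cV2 _ => t; rewrite in_itv/= => /andP[h h']; exact: th2.
  - apply: C1_ext_smooth df3 cV _ => t; rewrite in_itv/= => /andP[h _]; exact: th3.
(* The moments integrate functions of the angle that are invariant under the shift by [de], and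
   reversal preserves such integrals; hence (p, q) still solves the moment equations. *)
have per (g : R -> R) : continuous g -> (forall a, g (a + de) = g a) ->
    prim (fun t => g (th t)) 1 = prim (fun t => g (Th t)) 1.
  move=> cg gp.
  have cg1 : continuous (fun t => g (th t)).
    by move=> t; apply: continuous_comp; [exact: cth|exact: cg].
  have cg2 : continuous (fun t => g (Th t)).
    by move=> t; apply: continuous_comp; [exact: cTh|exact: cg].
  apply: prim_reversal cg2 cg1 t10 t12 t21 _ _ _ => t.
  - by move=> tt; rewrite th1// ltW.
  - by move=> ? ?; rewrite th2 ?ltW// /f2 gp.
  - by move=> tt; rewrite th3 ?ltW// /f3 addrA !gp.
have cosde a : cos (a + de) = cos a * cos de by rewrite cosD sde mulr0 subr0.
have sinde a : sin (a + de) = sin a * cos de by rewrite sinD sde mulr0 addr0.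
have cc : continuous (@cos R) by exact: continuous_cos.
have cs : continuous (@sin R) by exact: continuous_sin.
have Ea : Ma th = Ma Th.
  apply: (per (fun a => cos a ^+ 2)); first exact: contX.
  by move=> a; rewrite cosde exprMn cde mulr1.
have Eb : Mb th = Mb Th.
  apply: (per (fun a => cos a * sin a)); first exact: contM.
  by move=> a; rewrite cosde sinde mulrACA -expr2 cde mulr1.
have Ec : Mc th = Mc Th.
  apply: (per (fun a => sin a ^+ 2)); first exact: contX.
  by move=> a; rewrite sinde exprMn cde mulr1.
have me : moment_eq (X 1 - X 0) (Y 1 - Y 0) th p q.
  by have := geodesic_moment G; rewrite /moment_eq Ea Eb Ec.
have [||X' [Y' [L ctlE _ J]]] := angle_joins (al := Th 0) (be := Th 1) cth pth _ _ me.
- by rewrite th1 ?ltW// subrr sin0.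
- rewrite th3 ?ltW// /f3 addrAC subrr add0r.
  by rewrite sinde sde mul0r.
have J' : joins X' Y' th P Q by move: J; rewrite -J0 -J1.
have pper a : pn p q (a + de) ^+ 2 = pn p q a ^+ 2.
  by rewrite /pn cosde sinde !mulrA -mulrDl exprMn cde mulr1.
have sp t : t \in `]0, 1[ -> t \notin [:: t1; t2; 1] -> speed xi X' Y' th t = m.
  rewrite in_itv/= !inE !negb_or => /andP[t0 tle1] /andP[n1 /andP[n2 _]].
  apply/eqP; rewrite -(@eqrXn2 _ 2)// ?sqrtr_ge0//; apply/eqP.
  rewrite speed_sqr ctlE addrC.
  have Ht u : 0 < u -> u < 1 -> V u ^+ 2 + xi ^+ 2 * pn p q (Th u) ^+ 2 = m ^+ 2.
    by move=> u0 u1; have [] := H u; rewrite ?in_itv/= ?(ltW u0) ?(ltW u1).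
  have [tl|tl|/eqP] := ltgtP t t1; last by rewrite (negbTE n1).
    by rewrite (deriv1_val (dth1 t tl)) th1 ?ltW//; exact: Ht.
  have [tr|tr|/eqP] := ltgtP t t2; last by rewrite (negbTE n2).
    rewrite (deriv1_val (dth2 t tl tr)) th2 ?ltW// /f2 pper sqrrN.
    by apply: Ht; lra.
  by rewrite (deriv1_val (dth3 t tr)) th3 ?ltW// /f3 addrA !pper; exact: Ht.
have [X2 [Y2 [Th2 [V2 [p2 [q2 [[dTh2 cV2 _ _] _ thE]]]]]]] :=
  geodesic_of_minimal_speed xi0 m0 md L J' sp.
have V2E t v : 0 < t -> t < 1 -> deriv1 th t v -> V2 t = v.
  move=> t0 t1' dv; apply: deriv1_uniq (dTh2 t) _.
  apply: (@deriv1_itv _ _ _ 0 1 _ _ _ _ dv); first by rewrite in_itv/= t0.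
  by move=> r r01; apply: thE; exact: subset_itv_oo_cc.
(* The velocity [V2] of the new minimizer is continuous; its value at t1 is V t1 seen from the left
   and - V t2 seen from the right. *)
have l1 : V2 t1 - V t1 = 0.
  have c1 : continuous (fun t => V2 t - V t) by conts.
  apply: (eq0_closed_itv t10 c1); last by rewrite in_itv/= lexx ltW.
  move=> t; rewrite in_itv/= => /andP[t0 tt].
  by rewrite (V2E t (V t)) ?subrr ?(lt_trans tt)//; exact: dth1.
have l2 : V2 t1 + V (t1 + t2 + -1 * t1) = 0.
  have cVa : continuous (fun t => V (t1 + t2 + -1 * t)) by exact: affine_cont.
  have c1 : continuous (fun t => V2 t + V (t1 + t2 + -1 * t)) by conts.
  apply: (eq0_closed_itv t12 c1); last by rewrite in_itv/= lexx ltW.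
  move=> t; rewrite in_itv/= => /andP[tl tr].
  by rewrite (V2E t _ _ _ (dth2 t tl tr)) ?addNr ?(lt_trans t10)// (lt_trans tr).
have Vt1 : V t1 = 0.
  have ee : t1 + t2 + -1 * t1 = t2 by ring.
  by move: l1 l2; rewrite ee -eV; lra.
(* Where the control vanishes the whole speed is angular, so V^2 = m^2 > 0. *)
have [|_] := H t1; first by rewrite in_itv/= !ltW.
rewrite Vt1 z1 !expr0n mulr0 addr0 => /esym/eqP.
by rewrite sqrf_eq0 gt_eqF.
Qed.

End Reversal.

(** * Cusps *)

Section CuspFree.
Context {R : realType}.
Variable xi : R.
Hypothesis xi0 : 0 < xi.
Implicit Types (X Y Th V : R -> R) (t p q m : R) (P : R2P1 R).

Lemma Q_tilde_of_sign m P X Y Th V p q : 0 <= m -> d_proj xi (class_of p_origin) P = m%:E ->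
  geodesic xi m p q X Y Th V -> joins X Y Th (class_of p_origin) P ->
  (forall t, t \in `]0, 1[ -> 0 <= pn p q (Th t)) \/ (forall t, V t = 0) -> Q_tilde xi P.
Proof.
move=> m0 md G J sgn; exists (curve_of X Y Th); split.
  exact: (geodesic_minimizing m0 G md J).
exact: (cusp_free_sign G (fun t t01 => geodesic_u1 G t01) sgn).
Qed.

(** Either m = 0 and both terms of the squared speed vanish, or (p, q) = 0. These cases are set
    apart because zeros of the control then need not be cusps. *)
Lemma geodesic_degenerate m X Y Th V p q t : geodesic xi m p q X Y Th V ->
  ~~ (0 < m) || ~~ ((p != 0) || (q != 0)) -> 0 <= m -> t \in `]0, 1[ -> pn p q (Th t) = 0.
Proof.
move=> [_ _ _ H] /orP[mp|pq0] m0 t01; last first.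
  by move: pq0; rewrite negb_or !negbK => /andP[/eqP -> /eqP ->]; rewrite /pn !mul0r addr0.
have mm : m = 0 by apply/eqP; rewrite eq_le m0 andbT leNgt.
have [_] := H t (subset_itv_oo_cc t01); rewrite mm expr0n => /eqP.
rewrite paddr_eq0 ?sqr_ge0//; last by apply: mulr_ge0; exact: sqr_ge0.
by rewrite sqrf_eq0 mulf_eq0 !sqrf_eq0 (gt_eqF xi0) => /andP[_ /eqP].
Qed.

Lemma cusp_free_pn_sign m X Y Th V p q (gamma : R -> R2S1 R) : 0 <= m ->
  geodesic xi m p q X Y Th V ->
  (forall t : R, t \in `]0, 1[ -> u1 gamma t = pn p q (Th t)) -> cusp_free gamma ->
  (forall t, t \in `]0, 1[ -> 0 <= pn p q (Th t)) \/
  (forall t, t \in `]0, 1[ -> pn p q (Th t) <= 0).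
Proof.
move=> m0 G uE cf.
have [dg|] := boolP (~~ (0 < m) || ~~ ((p != 0) || (q != 0))).
  by left => t t01; rewrite (geodesic_degenerate G dg m0 t01).
rewrite negb_or !negbK => /andP[mp pq0].
apply: constant_sign => [|t t01]; first exact: (geodesic_pn_cont G).
by apply/eqP => pn0; apply: (cf t); exact: (zero_cusp G uE mp pq0 t01 pn0).
Qed.

End CuspFree.

Theorem theorem2 (R : realType) (xi : R) (P1 : R2P1 R) :
  (0 < xi)%R ->
  let P0 : R2P1 R := class_of p_origin in
  (Q_tilde xi P1 ->
     [/\ exists gamma, minimizing_geodesic xi P0 P1 gamma /\ cusp_free gamma,
         d_c xi P0 P1 = d_proj xi P0 P1 &
         forall P2 : R2P1 R, (d_c xi P0 P1 <= d_c xi P0 P2 + d_c xi P2 P1)%E])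
  /\
  (~ Q_tilde xi P1 ->
     (d_proj xi P0 P1 < d_c xi P0 P1)%E /\
     ((exists r1 : R2P1 R,
         (d_c xi P0 r1 + d_c xi r1 P1 < d_c xi P0 P1)%E) \/
      (exists r1 r2 : R2P1 R,
         (d_c xi P0 r1 + d_c xi r1 r2 + d_c xi r2 P1 < d_c xi P0 P1)%E))).
Proof.
move=> xi0 P0; have [m m0 md] := d_proj_fin xi P0 P1; split.
  move=> [gamma [mg cf]].
  have [X [Y [Th [V [p [q [G [J0 J1] uE]]]]]]] := minimizing_geodesic_u1 xi0 m0 md mg.
  (* A cusp-free minimizer is a single arc of constant sign, to which [d_c_piece] applies on the
     whole of [0, 1]. *)
  have dc : d_c xi P0 P1 = d_proj xi P0 P1.
    apply/eqP; rewrite eq_le d_proj_le_d_c andbT md.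
    have := d_c_piece m0 G (lexx 0) ltr01 (lexx 1) (cusp_free_pn_sign xi0 m0 G uE cf).
    by rewrite J0 J1 subr0 mul1r.
  split => //; first by exists gamma.
  (* The inequality is inherited from [d_proj], which satisfies it and is at most [d_c]. *)
  move=> P2; rewrite dc; apply: le_trans (d_proj_triangle xi0 P0 P2 P1) _.
  by apply: leeD; exact: d_proj_le_d_c.
move=> nQ.
have lt : (d_proj xi P0 P1 < d_c xi P0 P1)%E.
  rewrite lt_neqAle d_proj_le_d_c andbT; apply/eqP => e; apply: nQ.
  have [|X [Y [Th [V [p [q [G J sgn]]]]]]] := geodesic_exists_plus xi0 m0 md.
    by rewrite -e md.
  exact: (Q_tilde_of_sign m0 md G J sgn).
split => //.
have [X [Y [Th [V [p [q [G J]]]]]]] := geodesic_exists xi0 m0 md.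
have uE := geodesic_u1 G.
have [dg|] := boolP (~~ (0 < m) || ~~ ((p != 0) || (q != 0))).
  case: nQ; apply: (Q_tilde_of_sign m0 md G J _); left => t t01.
  by rewrite (geodesic_degenerate xi0 G dg m0 t01).
rewrite negb_or !negbK => /andP[mp pq0].
pose zero t := (0 < t < 1) && (pn p q (Th t) == 0).
have Vm t : zero t -> V t = m \/ V t = - m.
  move=> /andP[/andP[t0 t1] /eqP z]; have [_ _ _ H] := G.
  have [|_] := H t; first by rewrite in_itv/= !ltW.
  by rewrite z expr0n mulr0 addr0 => /eqP; rewrite eqf_sqr => /orP[]/eqP; [left|right].
have uniq t r : zero t -> zero r -> t < r -> V t <> V r.
  move=> /andP[/andP[t0 _] /eqP zt] /andP[/andP[_ r1] /eqP zr] tr.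
  exact: (geodesic_zero_uniq xi0 mp md G J pq0 t0 tr r1 zt zr).
(* Between consecutive zeros the control keeps its sign, so the arc competes for [d_c] at the cost
   of its length. *)
have piece a b : 0 <= a -> a < b -> b <= 1 -> (forall t, zero t -> ~~ (a < t < b)) ->
    (d_c xi (class_of (curve_of X Y Th a)) (class_of (curve_of X Y Th b)) <=
      ((b - a) * m)%:E)%E.
  move=> a0 ab b1 nz; apply: (d_c_piece m0 G a0 ab b1).
  apply: constant_sign => [|t]; first exact: (geodesic_pn_cont G).
  rewrite in_itv/= => tab; apply/negP => z; move: (nz t); rewrite /zero z tab.
  by case/andP: tab => at' tb; rewrite (le_lt_trans a0 at') (lt_le_trans tb b1) => /(_ isT).
have eqV t r : zero t -> zero r -> V t = V r -> t = r.
  by move=> Zt Zr E; have [h|h|//] := ltgtP t r; [case: (uniq t r)|case: (uniq r t)].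
have [[z1 Z1]|nz] := pselect (exists t, zero t); last first.
  case: nQ; exists (curve_of X Y Th); split; first exact: (geodesic_minimizing m0 G md J).
  move=> t [/[!inE] t01 u0 _ _]; apply: nz; exists t.
  by rewrite /zero -(uE t t01) u0 eqxx andbT.
have [J0 J1] := J.
have fin : (m%:E < d_c xi P0 P1)%E by rewrite -md.
have [[z2 [Z2 ne]]|one] := pselect (exists t, zero t /\ t != z1); last first.
  have Zz t : zero t -> t = z1.
    by move=> Zt; apply/eqP/negPn/negP => ne; apply: one; exists t.
  have /andP[/andP[z0 z1'] _] := Z1.
  left; exists (class_of (curve_of X Y Th z1)); apply: le_lt_trans fin.
  have -> : m = (z1 - 0) * m + (1 - z1) * m by ring.
  rewrite EFinD -J0 -J1; apply: leeD; apply: piece => //; try exact: ltW.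
    by move=> t /Zz ->; rewrite ltxx andbF.
  by move=> t /Zz ->; rewrite ltxx.
have [y1 [y2 [Y1 Y2 yy]]] : exists y1 y2, [/\ zero y1, zero y2 & y1 < y2].
  by have [h|h|h] := ltgtP z1 z2; [exists z1, z2|exists z2, z1|rewrite h eqxx in ne].
(* V takes only the values m and - m at zeros, and different values at different zeros, which leaves
   no room for a third one. *)
have Zz t : zero t -> t = y1 \/ t = y2.
  move=> Zt; have ney : V y1 <> V y2 by exact: uniq.
  have [e|e] := Vm _ Zt; have [e1|e1] := Vm _ Y1; have [e2|e2] := Vm _ Y2;
    by [case: ney; rewrite e1 e2|left; apply: eqV => //; rewrite e e1|
        right; apply: eqV => //; rewrite e e2].
have /andP[/andP[y10 y11] _] := Y1; have /andP[/andP[y20 y21] _] := Y2.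
right; exists (class_of (curve_of X Y Th y1)), (class_of (curve_of X Y Th y2)).
apply: le_lt_trans fin.
have -> : m = (y1 - 0) * m + (y2 - y1) * m + (1 - y2) * m by ring.
rewrite !EFinD -J0 -J1; apply: leeD; first apply: leeD; apply: piece => //; try exact: ltW.
- by move=> t /Zz[] ->; rewrite ?ltxx ?andbF// (ltNge y2) (ltW yy) andbF.
- by move=> t /Zz[] ->; rewrite ?ltxx ?andbF.
- by move=> t /Zz[] ->; rewrite ?ltxx// (ltNge y2) (ltW yy).
Qed.
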